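(* Let $p\ge1$, $k\in\{1,\dots,p\}$ and $\alpha\ge0$. The following are equivalent: (i) A Wishart semigroup with state space $D_p(k)$ and drift parameter $\alpha$ exists. (ii) If $k\in\{1,\dots,p-1\}$ then $\alpha=k$; if $k=p$ then $\alpha\ge p-1$.
   Context: $D_p(k)$ is the (closed) set of positive semidefinite $p\times p$ matrices of rank $\le k$; $D_p(p)=\bar{\mathcal S}_p^+$. For $u\in\bar{\mathcal S}_p^+$, $f_u(x)=\exp(-\operatorname{tr}(ux))$. A Wishart semigroup on a closed set $D\subseteq\bar{\mathcal S}_p^+$ with drift parameter $\alpha\ge0$ is a positive, strongly continuous contraction semigroup $(P_t)_{t\ge0}$ on $C_0(D)$ such that for all $u\in\mathcal S_p^+$, $t\ge0$, $x\in D$: $P_tf_u(x)=\det(I+2tu)^{-\alpha/2}\exp(-\operatorname{tr}(x(u^{-1}+2tI)^{-1}))$. *)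

(* Defs.v *)
From Stdlib Require Import Reals ClassicalEpsilon.
From HB Require Import structures.
From mathcomp Require Import all_boot all_fingroup.



Unset Printing Implicit Defensive.

Local Open Scope R_scope.

HB.instance Definition _ := Monoid.isComLaw.Build R R0 Rplus
  (fun a b c => esym (Rplus_assoc a b c)) Rplus_comm Rplus_0_l.
HB.instance Definition _ := Monoid.isComLaw.Build R R1 Rmult
  (fun a b c => esym (Rmult_assoc a b c)) Rmult_comm Rmult_1_l.

Definition rmat (p : nat) := 'I_p -> 'I_p -> R.
Definition rvec (p : nat) := 'I_p -> R.

Definition mid (p : nat) : rmat p := fun i j => if i == j then 1 else 0.
Definition madd (p : nat) (A B : rmat p) : rmat p := fun i j => A i j + B i j.
Definition msub (p : nat) (A B : rmat p) : rmat p := fun i j => A i j - B i j.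
Definition mscale (p : nat) (a : R) (A : rmat p) : rmat p := fun i j => a * A i j.
Definition mmul (p : nat) (A B : rmat p) : rmat p :=
  fun i j => \big[Rplus/0]_(l < p) (A i l * B l j).
Definition mtrace (p : nat) (A : rmat p) : R := \big[Rplus/0]_(i < p) A i i.

Definition mdet (p : nat) (A : rmat p) : R :=
  \big[Rplus/0]_(s : {perm 'I_p})
     ((-1) ^ (odd_perm s) * \big[Rmult/1]_(i < p) A i (s i)).

Definition minv (p : nat) (A : rmat p) : rmat p :=
  epsilon (inhabits A) (fun B => mmul p A B = mid p /\ mmul p B A = mid p).

Definition msymmetric (p : nat) (A : rmat p) : Prop := forall i j, A i j = A j i.

Definition quad (p : nat) (A : rmat p) (v : rvec p) : R :=
  \big[Rplus/0]_(i < p) \big[Rplus/0]_(j < p) (v i * A i j * v j).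

Definition psd (p : nat) (A : rmat p) : Prop :=
  msymmetric p A /\ forall v : rvec p, 0 <= quad p A v.

Definition pd (p : nat) (A : rmat p) : Prop :=
  msymmetric p A /\ forall v : rvec p, (exists i, v i <> 0) -> 0 < quad p A v.

Definition lin_indep_cols (p : nat) (A : rmat p) (S : {set 'I_p}) : Prop :=
  forall c : rvec p,
    (forall j, j \notin S -> c j = 0) ->
    (forall i, \big[Rplus/0]_(j < p) (A i j * c j) = 0) ->
    forall j, c j = 0.

(* rank A <= k : every linearly independent family of columns has at most k
   members (rank = maximal number of linearly independent columns) *)
Definition rank_le (p : nat) (A : rmat p) (k : nat) : Prop :=
  forall S : {set 'I_p}, lin_indep_cols p A S -> (#|S| <= k)%N.

Definition Dp (p k : nat) (x : rmat p) : Prop := psd p x /\ rank_le p x k.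

Definition mdist (p : nat) (A B : rmat p) : R :=
  sqrt (\big[Rplus/0]_(i < p) \big[Rplus/0]_(j < p) ((A i j - B i j) ^ 2)).
Definition mnorm (p : nat) (A : rmat p) : R := mdist p A (fun _ _ => 0).

Definition fnD (p : nat) (D : rmat p -> Prop) := {x : rmat p | D x} -> R.

Definition C0 (p : nat) (D : rmat p -> Prop) (f : fnD p D) : Prop :=
  (forall x : {x : rmat p | D x}, forall eps, 0 < eps ->
     exists delta, 0 < delta /\
       forall y : {x : rmat p | D x},
         mdist p (proj1_sig x) (proj1_sig y) < delta -> Rabs (f y - f x) < eps)
  /\
  (forall eps, 0 < eps -> exists M,
     forall x : {x : rmat p | D x}, M < mnorm p (proj1_sig x) -> Rabs (f x) < eps).

(* positive, strongly continuous contraction semigroup on C_0(D);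
   P t is only relevant for t >= 0 and on arguments in C_0(D) *)
Definition feller_semigroup (p : nat) (D : rmat p -> Prop)
    (P : R -> fnD p D -> fnD p D) : Prop :=
  (forall t f, 0 <= t -> C0 p D f -> C0 p D (P t f)) /\
  (forall t (a b : R) (f g : fnD p D), 0 <= t -> C0 p D f -> C0 p D g ->
     forall x, P t (fun y => a * f y + b * g y) x = a * P t f x + b * P t g x) /\
  (forall f, C0 p D f -> forall x, P 0 f x = f x) /\
  (forall t s f, 0 <= t -> 0 <= s -> C0 p D f ->
     forall x, P (t + s) f x = P t (P s f) x) /\
  (forall t f, 0 <= t -> C0 p D f -> (forall x, 0 <= f x) -> forall x, 0 <= P t f x) /\
  (forall t f, 0 <= t -> C0 p D f -> forall c, (forall x, Rabs (f x) <= c) ->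
     forall x, Rabs (P t f x) <= c) /\
  (forall f, C0 p D f -> forall eps, 0 < eps -> exists delta, 0 < delta /\
     forall t, 0 <= t < delta -> forall x, Rabs (P t f x - f x) <= eps).

Definition f_u (p : nat) (D : rmat p -> Prop) (u : rmat p) : fnD p D :=
  fun x => exp (- mtrace p (mmul p u (proj1_sig x))).

Definition wishart_semigroup (p : nat) (D : rmat p -> Prop) (alpha : R)
    (P : R -> fnD p D -> fnD p D) : Prop :=
  feller_semigroup p D P /\
  forall (u : rmat p) (t : R) (x : {x : rmat p | D x}), pd p u -> 0 <= t ->
    P t (f_u p D u) x =
      Rpower (mdet p (madd p (mid p) (mscale p (2 * t) u))) (- alpha / 2) *
      exp (- mtrace p (mmul p (proj1_sig x)
                   (minv p (madd p (minv p u) (mscale p (2 * t) (mid p)))))).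

(* Main.v *)
Require Import Defs.
From Stdlib Require Import Reals Lra Lia Classical ClassicalEpsilon FunctionalExtensionality Factorial.
From mathcomp Require Import all_boot all_fingroup all_algebra.
From mathcomp Require Import complex Rstruct.
From mathcomp Require spectral sesquilinear.
From Coquelicot Require Import Coquelicot.
Set Implicit Arguments.
Unset Strict Implicit.
Unset Printing Implicit Defensive.
Local Open Scope R_scope.

(** A Wishart semigroup is determined by its action on the exponentials [f_u], whose span is
    dense in [C_0] (Bernstein polynomials in finitely many of the [f_u]).  It therefore exists
    as soon as the prescribed action on the span is a contraction, and this follows from the
    parabolic maximum principle: the generator [A f_u = (2 tr (x u^2) - alpha tr u) f_u] with
    [alpha = k] is half the Laplacian in [Y], where [x = Y Y^T] with [Y] of size [p * k]; on
    the full cone with [alpha >= p - 1], a maximum on the boundary is of the form [Y Y^T] with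
    [Y] of size [p * (p - 1)] and the remaining drift points into the cone, while the gradient
    vanishes at an interior maximum.

    Conversely, positivity of [P_t] on finite combinations of exponentials gives two bounds.
    If [k < p], then [alpha <= k]: a matrix of rank at most [k] annihilates a vector supported
    on [k + 1] coordinates, hence almost annihilates one of [O(m^k)] vectors of a net, and the
    Laplace transform at [x = 0] bounds the mass near each of them by [O(m^(-alpha))].
    If [r < p] and [r <= k], then [r <= alpha]: write [M i j = exp (h * x i j) - 1], a positive
    semidefinite matrix by Schur's product theorem.  Then [z^T M z], for a suitable [z = z(x)],
    is a nonnegative combination of exponentials, which vanishes at [diag (1, .., 1, 0, .., 0)]
    ([r] ones), and where the generator gives a multiple of [alpha - r h / (exp h - 1)]. *)

(* The lower bound has a geometric origin. Near [diag (1, .., 1, 0, .., 0)], with first zero at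
   index [s], the Schur complement of the block of ones is [x s s - sum_(i < r) x i s ^ 2] to
   leading order. It is nonnegative on the cone and vanishes at that matrix, where the generator
   sends it to [alpha - r]. But the semigroup is prescribed only on decaying exponentials. Replacing
   [x i j] by [exp (h * x i j) - 1] and multiplying by [exp (- c tr x)] brings the function into
   their span, keeps its sign, and costs the factor [h / (exp h - 1)], which tends to 1 with [h]. In
   the existence part the obstacle is that [Dp p k] is not smooth. Gram factors [Y] provide linear
   coordinates in which second derivative tests and compactness are available. A drift that is not
   an integer has no factor with the matching number of columns, hence the comparison with [p]
   inside the full cone and with [p - 1] on its boundary. The contraction estimate also makes the
   extension well defined: combinations with close values have close images. *)
Reserved Notation "\rsum_ ( i <- r ) F"
  (at level 41, F at level 41, i, r at level 50).
Reserved Notation "\rsum_ ( i < n ) F"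
  (at level 41, F at level 41, i, n at level 50).
Notation "\rsum_ ( i <- r ) F" := (\big[Rplus/0]_(i <- r) F) : R_scope.
Notation "\rsum_ ( i < n ) F" := (\big[Rplus/0]_(i < n) F) : R_scope.

(** * Finite sums of real numbers *)

Section Sums.
Variables (I : Type) (r : seq I) (Q : pred I).
Implicit Types F G : I -> R.

Lemma rsum_mull c F :
  c * \big[Rplus/0]_(i <- r | Q i) F i = \big[Rplus/0]_(i <- r | Q i) (c * F i).
Proof. by rewrite big_distrr. Qed.

Lemma rsum_mulr c F :
  \big[Rplus/0]_(i <- r | Q i) F i * c = \big[Rplus/0]_(i <- r | Q i) (F i * c).
Proof. by rewrite big_distrl. Qed.

Lemma rsum_add F G : \big[Rplus/0]_(i <- r | Q i) (F i + G i) =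
  \big[Rplus/0]_(i <- r | Q i) F i + \big[Rplus/0]_(i <- r | Q i) G i.
Proof. by rewrite big_split. Qed.

Lemma rsum_sub F G : \big[Rplus/0]_(i <- r | Q i) (F i - G i) =
  \big[Rplus/0]_(i <- r | Q i) F i - \big[Rplus/0]_(i <- r | Q i) G i.
Proof.
elim: r => [|a s IH]; first by rewrite !big_nil; lra.
by rewrite !big_cons; case: (Q a); rewrite IH; lra.
Qed.

Lemma rsum_opp F : \big[Rplus/0]_(i <- r | Q i) (- F i) =
  - \big[Rplus/0]_(i <- r | Q i) F i.
Proof.
elim: r => [|a s IH]; first by rewrite !big_nil; lra.
by rewrite !big_cons; case: (Q a); rewrite IH; lra.
Qed.

Lemma rsum_le F G : (forall i, Q i -> F i <= G i) ->
  \big[Rplus/0]_(i <- r | Q i) F i <= \big[Rplus/0]_(i <- r | Q i) G i.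
Proof.
move=> H; elim: r => [|a s IH]; first by rewrite !big_nil; lra.
by rewrite !big_cons; case Qa: (Q a) => //; move: (H a Qa); lra.
Qed.

Lemma rsum_ge0 F : (forall i, Q i -> 0 <= F i) -> 0 <= \big[Rplus/0]_(i <- r | Q i) F i.
Proof.
move=> H; elim: r => [|a s IH]; first by rewrite !big_nil; lra.
by rewrite !big_cons; case Qa: (Q a) => //; move: (H a Qa); lra.
Qed.

Lemma rsum_abs F : Rabs (\big[Rplus/0]_(i <- r | Q i) F i) <=
  \big[Rplus/0]_(i <- r | Q i) Rabs (F i).
Proof.
elim: r => [|a s IH]; first by rewrite !big_nil Rabs_R0; lra.
rewrite !big_cons; case Qa: (Q a) => //.
by move: (Rabs_triang (F a) (\big[Rplus/0]_(j <- s | Q j) F j)); lra.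
Qed.

Lemma rsum0 F : (forall i, Q i -> F i = 0) -> \big[Rplus/0]_(i <- r | Q i) F i = 0.
Proof. by move=> H; rewrite big1. Qed.

End Sums.

Lemma rsum_term_le (I : finType) (F : I -> R) i :
  (forall j, 0 <= F j) -> F i <= \big[Rplus/0]_j F j.
Proof.
move=> H; rewrite (bigD1 i) //=.
by move: (@rsum_ge0 _ (index_enum I) (fun j => j != i) F (fun j _ => H j)); lra.
Qed.

Lemma rsum_eq0 (I : finType) (F : I -> R) :
  (forall j, 0 <= F j) -> \big[Rplus/0]_j F j = 0 -> forall i, F i = 0.
Proof. by move=> H E i; move: (rsum_term_le i H) (H i); rewrite E; lra. Qed.

Lemma rsum_const (I : finType) (c : R) : \big[Rplus/0]_(i : I) c = INR #|I| * c.
Proof.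
rewrite big_const; elim: (#|I|) => [|n IH]; first by rewrite /=; lra.
by rewrite iterS IH S_INR; lra.
Qed.

Lemma rsum_deltal p (i : 'I_p) (F : 'I_p -> R) :
  \rsum_(j < p) (mid p i j * F j) = F i.
Proof.
rewrite (bigD1 i) //= big1; last first.
  by move=> j; rewrite /mid eq_sym => /negbTE ->;  rewrite Rmult_0_l.
by rewrite /mid eqxx /= Rmult_1_l Rplus_0_r.
Qed.

Lemma midC p (i j : 'I_p) : mid p i j = mid p j i.
Proof. by rewrite /mid eq_sym. Qed.

Lemma rsum_deltar p (i : 'I_p) (F : 'I_p -> R) :
  \rsum_(j < p) (F j * mid p j i) = F i.
Proof. by rewrite -[RHS](rsum_deltal i); apply: eq_bigr => j _; rewrite midC Rmult_comm. Qed.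

Lemma rsum_sqr I (r : seq I) (F : I -> R) :
  (\rsum_(i <- r) F i) ^ 2 = \rsum_(i <- r) \rsum_(j <- r) (F i * F j).
Proof.
rewrite /= Rmult_1_r rsum_mulr; apply: eq_bigr => i _; exact: rsum_mull.
Qed.

Lemma mat_ext p q (A B : 'I_p -> 'I_q -> R) : (forall i j, A i j = B i j) -> A = B.
Proof. by move=> H; do 2!apply: functional_extensionality => ?. Qed.

(** * The real spectral theorem *)

Section RealSpectral.
Import GRing.Theory.
Local Open Scope ring_scope.
Local Notation C := (complex R).

(** The complexification is Hermitian, so its spectral decomposition has real diagonal entries. The
    first of them is a root of the characteristic polynomial, which comes from that of [A], hence an
    eigenvalue of [A] itself. *)
Lemma symmetric_eigenvalue n (A : 'M[R]_n.+1) : A^T = A -> exists a : R, eigenvalue A a.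
Proof.
move=> symA; pose f : {rmorphism R -> C} := real_complex R.
pose B : 'M[C]_n.+1 := map_mx f A.
have hB : B \is sesquilinear.hermsymmx.
  apply: spectral.realsym_hermsym.
    apply/sesquilinear.is_hermitianmxP; rewrite expr0 scale1r.
    by apply/matrixP=> i j; rewrite !mxE -[in LHS]symA mxE.
  apply/mxOverP=> i j; rewrite mxE.
  by apply/complex_realP; exists (A i j).
have nB := spectral.hermitian_normalmx hB.
have := spectral.hermitian_spectral_diag_real hB.
move/spectral.orthomx_spectralP: nB.
set P := spectral.spectralmx B; set D := spectral.spectral_diag B => eB realD.
have uP : P \in unitmx by apply: spectral.spectral_unit.
have ev : eigenvalue B (D 0 0).
  apply/eigenvalueP; exists (row 0 P).
    rewrite {1}eB !mulmxA -row_mul mulmxV // -row_mul mul1mx.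
    apply/rowP=> j; rewrite !mxE (bigD1 0) //= big1 ?addr0 ?mxE ?eqxx ?mulr1n //.
    by move=> k /negbTE kn0; rewrite !mxE eq_sym kn0 mulr0n mul0r.
  apply/eqP=> r0.
  have /matrixP/(_ 0 0) : P *m invmx P = 1%:M by rewrite mulmxV.
  set X := invmx P.
  have -> : (P *m X) 0 0 = (row 0 P *m X) 0 0 by rewrite -row_mul [RHS]mxE.
  by rewrite r0 mul0mx !mxE /= => /eqP; rewrite eq_sym oner_eq0.
have [a Da] : exists a : R, D 0 0 = f a.
  by move/mxOverP: realD => /(_ 0 0) /complex_realP.
exists a; move: ev; rewrite Da !eigenvalue_root_char -map_char_poly.
by rewrite fmorph_root.
Qed.


Lemma dot_row_eq0 n (v : 'rV[R]_n) : (v *m v^T) 0 0 = 0 -> v = 0.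
Proof.
rewrite mxE => H; apply/rowP=> i; rewrite mxE.
have : forall j, v 0 j * v 0 j = 0.
  apply: rsum_eq0 => [j|]; first exact: Rle_0_sqr.
  by rewrite -[RHS]H; apply: eq_bigr => j _; rewrite mxE.
by move/(_ i)/eqP; rewrite mulf_eq0 orbb => /eqP.
Qed.

Lemma dot_row_ge0 n (v : 'rV[R]_n) : Rle 0 ((v *m v^T) 0 0).
Proof. by rewrite mxE; apply: rsum_ge0 => j _; rewrite mxE; exact: Rle_0_sqr. Qed.

(* The Householder reflection exchanging [q] and [e]. *)
Lemma orthogonal_with_image n (e q : 'rV[R]_n) : e *m e^T = q *m q^T ->
  exists H : 'M[R]_n, [/\ H^T = H, H *m H = 1%:M & e *m H = q].
Proof.
move=> eq1; case: (eqVneq e q) => [<-|neq].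
  by exists 1%:M; rewrite trmx1 !mulmx1.
pose w := e - q; pose c := (w *m w^T) 0 0.
have c0 : c != 0.
  by apply: contra_neq neq => /dot_row_eq0 /eqP; rewrite subr_eq0 => /eqP.
have wwc : w *m w^T = c%:M by rewrite [LHS]mx11_scalar.
(* As [e] and [q] have equal length, [w *m w^T] is twice [e *m w^T]; this is why the reflection
   along [w] carries [e] to [e - w], that is, to [q]. *)
have ewc : e *m w^T = (c / 2%:R)%:M.
  have comm : q *m e^T = e *m q^T.
    by rewrite [RHS]mx11_scalar [LHS]mx11_scalar; congr _%:M; rewrite !mxE;
       apply: eq_bigr => j _; rewrite !mxE mulrC.
  have E : c%:M = (e *m w^T) *+ 2 :> 'M[R]_1.
    rewrite -wwc /w linearB /= mulmxBl !mulmxBr comm -eq1.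
    by rewrite opprB mulr2n.
  have two0 : (2%:R : R) != 0 by rewrite Num.Theory.pnatr_eq0.
  rewrite [LHS]mx11_scalar; congr _%:M; apply: (mulIf two0); rewrite mulfVK //.
  by rewrite mulr_natr -[LHS]/((_ *+ 2)) -mulmxnE -E mxE eqxx mulr1n.
have two0 : (2%:R : R) != 0 by rewrite Num.Theory.pnatr_eq0.
have ew : e - w = q by rewrite /w opprB addrC subrK.
clearbody c w.
exists (1%:M - (2%:R / c) *: (w^T *m w)); split.
- by rewrite linearB /= linearZ /= trmx1 trmx_mul trmxK.
- rewrite mulmxBl mul1mx mulmxBr mulmx1 -!scalemxAl -scalemxAr.
  rewrite -mulmxA [w *m _]mulmxA wwc mul_scalar_mx -scalemxAr !scalerA.
  by rewrite mulfVK // mulr_natr -scalerMnl mulr2n opprB addrK subrK.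
- rewrite mulmxBr mulmx1 -scalemxAr mulmxA ewc mul_scalar_mx scalerA.
  by rewrite mulrA mulfVK // mulfV // scale1r.
Qed.

(** Deflation: conjugating by a reflection that carries the first basis vector to a unit eigenvector
    makes the matrix block diagonal, and the induction hypothesis diagonalizes the lower block. *)
Lemma symmetric_diagonalizable n (A : 'M[R]_n) : A^T = A ->
  exists (Q : 'M[R]_n) (d : 'rV[R]_n), Q *m Q^T = 1%:M /\ A = Q^T *m diag_mx d *m Q.
Proof.
elim: n A => [|n IH] A symA.
  by exists 1%:M, 0; split; apply/matrixP=> [[]].
have [a /eigenvalueP [v vA v0]] := symmetric_eigenvalue symA.
pose c := (v *m v^T) 0 0.
have c0 : Rlt 0 c.
  have [//|E] := Rle_lt_or_eq_dec _ _ (dot_row_ge0 v).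
  by case/eqP: v0; apply: dot_row_eq0.
pose s := sqrt c.
have s0 : s != 0.
  by apply/eqP=> E; move: (sqrt_lt_R0 _ c0); rewrite -/s E; exact: Rlt_irrefl.
have ss : s * s = c by apply: sqrt_sqrt; exact: Rlt_le.
pose q := s^-1 *: v.
have qA : q *m A = a *: q by rewrite -scalemxAl vA scalerA mulrC -scalerA.
pose e : 'rV[R]_n.+1 := delta_mx 0 0.
have [|H [symH HH eH]] := @orthogonal_with_image n.+1 e q.
  rewrite /q linearZ /= -scalemxAr -scalemxAl scalerA.
  have -> : v *m v^T = (s * s)%:M by rewrite ss [LHS]mx11_scalar.
  rewrite scale_scalar_mx mulrACA mulVf // mulr1 trmx_delta mul_delta_mx.
  by apply/matrixP=> i j; rewrite !ord1 !mxE.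
pose B := H *m A *m H.
have symB : B^T = B by rewrite /B !trmx_mul symA symH mulmxA.
have eB : e *m B = a *: e.
  by rewrite /B !mulmxA eH qA -scalemxAl -eH -mulmxA HH mulmx1.
have AB : A = H *m B *m H by rewrite /B !mulmxA HH mul1mx -mulmxA HH mulmx1.
have B0 j : B 0 j = a *+ (j == 0).
  by move/rowP: eB => /(_ j); rewrite -rowE !mxE => ->; rewrite mulr_natr.
clearbody B.
pose B' : 'M[R]_n := \matrix_(i, j) B (lift 0 i) (lift 0 j).
have [|Q [d [QQ EB]]] := IH B'.
  by apply/matrixP=> i j; rewrite !mxE -[in LHS]symB mxE.
have EBB : B = block_mx (a%:M : 'M_1) 0 0 B' :> 'M_(1 + n).
  apply/matrixP=> i j; rewrite -(splitK i) -(splitK j).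
  case: (split i) => i'; case: (split j) => j' /=.
  - by rewrite block_mxEul !ord1 lshift0 B0 !mxE.
  - by rewrite block_mxEur ord1 lshift0 B0 !mxE.
  - by rewrite block_mxEdl ord1 lshift0 -[B]symB mxE B0 !mxE.
  - by rewrite block_mxEdr mxE; congr (B _ _); apply: val_inj.
pose Q1 : 'M[R]_(1 + n) := block_mx 1%:M 0 0 Q.
have Q1T : Q1^T = block_mx 1%:M 0 0 Q^T by rewrite tr_block_mx !trmx0 trmx1.
have Q1Q1 : Q1 *m Q1^T = 1%:M.
  rewrite Q1T mulmx_block !mulmx0 !mul0mx !addr0 !add0r.
  by rewrite mulmx1 QQ -scalar_mx_block.
have EQ : block_mx (a%:M : 'M_1) 0 0 B' =
    Q1^T *m diag_mx (row_mx (a%:M : 'M_1) d) *m Q1.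
  rewrite Q1T diag_mx_row !mulmx_block.
  rewrite !(mulmx0, mul0mx, addr0, add0r, mul1mx, mulmx1) -EB.
  congr (block_mx _ _ _ _).
  by apply/matrixP=> i j; rewrite !ord1 !mxE.
exists (Q1 *m H : 'M[R]_n.+1).
exists (row_mx (a%:M : 'M_1) d : 'rV[R]_n.+1).
split.
  by rewrite trmx_mul symH mulmxA -[Q1 *m H *m H]mulmxA HH mulmx1 Q1Q1.
rewrite trmx_mul symH {1}AB EBB.
by rewrite -!mulmxA; congr (_ *m _); rewrite !mulmxA; congr (_ *m _).
Qed.

End RealSpectral.

(** * Functional calculus for symmetric matrices *)

Section SpectralCalculus.
Variable p : nat.
Implicit Types (A B x u : rmat p) (q : 'I_p -> rvec p) (m l : rvec p).

Definition orthonormal q :=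
  (forall i j, \rsum_(a < p) (q i a * q j a) = mid p i j) /\
  (forall a b, \rsum_(i < p) (q i a * q i b) = mid p a b).

(** The matrix [Q^T diag(m) Q] with rows [q i]. For a given [u], all matrices in the Wishart formula
    built from [u] share its eigenbasis, so identities between them become scalar identities between
    eigenvalues. *)
Definition spec q m : rmat p := fun a b => \rsum_(i < p) (m i * (q i a * q i b)).

Lemma mdet_matrix A : mdet p A = (\det (\matrix_(i, j) A i j))%R.
Proof.
rewrite /mdet; apply: eq_bigr => s _; rewrite RpowE; congr (_ * _).
by apply: eq_bigr => i _; rewrite mxE.
Qed.

Lemma symmetric_spec A : msymmetric p A ->
  exists l q, orthonormal q /\ A = spec q l.
Proof.
move=> symA; pose M := (\matrix_(i, j) A i j)%R : 'M[R]_p.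
have [|Q [d [QQ EM]]] := @symmetric_diagonalizable p M.
  by apply/matrixP=> i j; rewrite !mxE.
exists (fun i => d 0%R i), (fun i a => Q i a); split; first split.
- move=> i j; move/matrixP: QQ => /(_ i j); rewrite !mxE /mid => E.
  transitivity (\rsum_(k < p) Q i k * (Q^T)%R k j).
    by apply: eq_bigr => k _; rewrite mxE.
  by rewrite [LHS]E; case: eqP.
- move=> a b; move/mulmx1C/matrixP: QQ => /(_ a b); rewrite !mxE /mid => E.
  transitivity (\rsum_(k < p) (Q^T)%R a k * Q k b).
    by apply: eq_bigr => k _; rewrite mxE.
  by rewrite [LHS]E; case: eqP.
apply: mat_ext => a b; move/matrixP: EM => /(_ a b); rewrite [LHS]mxE => ->.
rewrite mxE /spec; apply: eq_bigr => i _.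
rewrite mxE (bigD1 i) //= big1 => [|j /negbTE ji]; rewrite !mxE ?ji ?eqxx.
  by rewrite GRing.mulr1n GRing.addr0 -!RmultE (Rmult_comm (Q i a)) Rmult_assoc.
by rewrite GRing.mulr0n GRing.mulr0.
Qed.

Lemma mdet_spec q m : orthonormal q -> mdet p (spec q m) = \big[Rmult/1]_(i < p) m i.
Proof.
move=> [q1 q2]; rewrite mdet_matrix.
pose Q := (\matrix_(i, a) q i a)%R : 'M[R]_p.
pose d := (\row_i m i)%R : 'rV[R]_p.
have QQ : (Q *m Q^T = 1%:M)%R.
  apply/matrixP=> i j; rewrite !mxE; transitivity (mid p i j); last first.
    by rewrite /mid; case: eqP.
  by rewrite -q1; apply: eq_bigr => a _; rewrite !mxE.
have -> : ((\matrix_(i, j) spec q m i j) = Q^T *m diag_mx d *m Q)%R.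
  apply/matrixP=> a b; rewrite !mxE; apply: eq_bigr => i _.
  rewrite mxE (bigD1 i) //= big1 => [|j /negbTE ji]; rewrite !mxE ?ji ?eqxx.
    by rewrite GRing.mulr1n GRing.addr0 -!RmultE; lra.
  by rewrite GRing.mulr0n GRing.mulr0.
have dQ : (\det Q * \det Q = 1)%R by rewrite -[X in (_ * X)%R]det_tr -det_mulmx QQ det1.
rewrite !det_mulmx det_tr GRing.mulrAC dQ GRing.mul1r det_diag.
by apply: eq_bigr => i _; rewrite mxE.
Qed.

Lemma mmulA A B x : mmul p A (mmul p B x) = mmul p (mmul p A B) x.
Proof.
apply: mat_ext => i j; rewrite /mmul.
under eq_bigr => l _ do rewrite rsum_mull.
rewrite exchange_big /=; apply: eq_bigr => l _.
by rewrite rsum_mulr; apply: eq_bigr => k _; lra.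
Qed.

Lemma mmul1 A : mmul p A (mid p) = A.
Proof. by apply: mat_ext => i j; rewrite /mmul rsum_deltar. Qed.

Lemma mul1m A : mmul p (mid p) A = A.
Proof. by apply: mat_ext => i j; rewrite /mmul rsum_deltal. Qed.

Lemma mtrace_mulC A B : mtrace p (mmul p A B) = mtrace p (mmul p B A).
Proof.
rewrite /mtrace /mmul exchange_big /=; apply: eq_bigr => i _.
by apply: eq_bigr => j _; lra.
Qed.

(** [minv] is an [epsilon], so nothing is known of it until a two-sided inverse is exhibited;
    uniqueness of inverses then determines it. *)
Lemma minv_uniq A B : mmul p A B = mid p -> mmul p B A = mid p -> minv p A = B.
Proof.
move=> AB BA.
have [AX XA] := epsilon_spec (inhabits A)
  (fun B => mmul p A B = mid p /\ mmul p B A = mid p) (ex_intro _ B (conj AB BA)).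
by rewrite -/(minv p A) in AX XA; rewrite -[minv p A]mul1m -BA -mmulA AX mmul1.
Qed.

Lemma spec_mul q m l : orthonormal q ->
  mmul p (spec q m) (spec q l) = spec q (fun i => m i * l i).
Proof.
move=> [q1 _]; apply: mat_ext => a b; rewrite /mmul /spec.
under eq_bigr => c _ do rewrite rsum_mulr.
rewrite exchange_big /=; apply: eq_bigr => i _.
under eq_bigr => c _ do rewrite rsum_mull.
rewrite exchange_big /=.
transitivity (\rsum_(j < p) (mid p i j * (m i * l j * (q i a * q j b)))).
  apply: eq_bigr => j _; rewrite -(q1 i j) rsum_mulr.
  by apply: eq_bigr => c _; lra.
by rewrite rsum_deltal.
Qed.

Lemma spec_mid q : orthonormal q -> mid p = spec q (fun _ => 1).
Proof.
move=> [_ q2]; apply: mat_ext => a b; rewrite /spec -q2.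
by apply: eq_bigr => i _; lra.
Qed.

Lemma spec_add q m l : madd p (spec q m) (spec q l) = spec q (fun i => m i + l i).
Proof.
apply: mat_ext => a b; rewrite /madd /spec -rsum_add.
by apply: eq_bigr => i _; lra.
Qed.

Lemma spec_scale q c m : mscale p c (spec q m) = spec q (fun i => c * m i).
Proof.
apply: mat_ext => a b; rewrite /mscale /spec rsum_mull.
by apply: eq_bigr => i _; lra.
Qed.

Lemma eq_spec q m l : (forall i, m i = l i) -> spec q m = spec q l.
Proof. by move=> E; congr spec; apply: functional_extensionality. Qed.

Lemma minv_spec q m : orthonormal q -> (forall i, m i <> 0) ->
  minv p (spec q m) = spec q (fun i => / m i).
Proof.
move=> oq m0; apply: minv_uniq; rewrite spec_mul // (spec_mid oq);
  by apply: eq_spec => i; field; apply: m0.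
Qed.

Lemma quad_rank1 x v : quad p x v = mtrace p (mmul p x (fun a b => v a * v b)).
Proof.
rewrite /quad /mtrace /mmul; apply: eq_bigr => i _.
by apply: eq_bigr => j _; lra.
Qed.

Lemma mtrace_mul_spec x q m :
  mtrace p (mmul p x (spec q m)) = \rsum_(i < p) (m i * quad p x (q i)).
Proof.
rewrite /mtrace /mmul /spec /quad.
under [RHS]eq_bigr => i _ do rewrite rsum_mull.
rewrite [RHS]exchange_big /=; apply: eq_bigr => a _.
under [RHS]eq_bigr => i _ do rewrite rsum_mull.
rewrite [RHS]exchange_big /=; apply: eq_bigr => b _.
by rewrite rsum_mull; apply: eq_bigr => i _; lra.
Qed.

Lemma mtrace_spec q m : orthonormal q -> mtrace p (spec q m) = \rsum_(i < p) m i.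
Proof.
move=> [q1 _]; rewrite /mtrace /spec exchange_big /=; apply: eq_bigr => i _.
by rewrite -rsum_mull q1 /mid eqxx /= Rmult_1_r.
Qed.

Lemma mtrace_quad x q : orthonormal q -> mtrace p x = \rsum_(i < p) quad p x (q i).
Proof.
move=> oq; rewrite -[in LHS](mmul1 x) (spec_mid oq) mtrace_mul_spec.
by apply: eq_bigr => i _; lra.
Qed.

Lemma quad_spec q m v :
  quad p (spec q m) v = \rsum_(i < p) (m i * (\rsum_(a < p) (q i a * v a)) ^ 2).
Proof.
rewrite quad_rank1 mtrace_mulC mtrace_mul_spec; apply: eq_bigr => i _; congr (_ * _).
rewrite rsum_sqr /quad; apply: eq_bigr => a _; apply: eq_bigr => b _; lra.
Qed.

Lemma spec_sym q m : msymmetric p (spec q m).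
Proof. by move=> a b; apply: eq_bigr => i _; lra. Qed.

Lemma spec_psd q m : (forall i, 0 <= m i) -> psd p (spec q m).
Proof.
move=> m0; split; first exact: spec_sym.
move=> v; rewrite quad_spec; apply: rsum_ge0 => i _.
by apply: Rmult_le_pos => //; apply: pow2_ge_0.
Qed.

Lemma norm2_orthonormal q v : orthonormal q ->
  \rsum_(a < p) (v a ^ 2) = \rsum_(i < p) (\rsum_(a < p) (q i a * v a)) ^ 2.
Proof.
move=> oq; transitivity (quad p (mid p) v).
  rewrite /quad; apply: eq_bigr => a _.
  rewrite (eq_bigr (fun b => (mid p a b) * (v a * v b))); last by move=> b _; lra.
  by rewrite rsum_deltal /=; lra.
by rewrite (spec_mid oq) quad_spec; apply: eq_bigr => i _; lra.
Qed.

Lemma norm2_gt0 v : (exists i, v i <> 0) -> 0 < \rsum_(a < p) (v a ^ 2).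
Proof.
move=> [i vi]; have h : forall j, 0 <= v j ^ 2 by move=> j; apply: pow2_ge_0.
exact: Rlt_le_trans (pow2_gt_0 _ vi) (rsum_term_le i h).
Qed.

Lemma spec_pd q m : orthonormal q -> (forall i, 0 < m i) -> pd p (spec q m).
Proof.
move=> oq m0; split; first exact: spec_sym.
move=> v /norm2_gt0; rewrite (norm2_orthonormal v oq) quad_spec => H.
have h : forall i, 0 <= m i * (\rsum_(a < p) (q i a * v a)) ^ 2.
  by move=> i; apply: Rmult_le_pos; [apply: Rlt_le|apply: pow2_ge_0].
case: (Rle_lt_or_eq_dec 0 (\rsum_(i < p) (m i * (\rsum_(a < p) (q i a * v a)) ^ 2))).
- by apply: rsum_ge0.
- by [].
move=> E; move: H; rewrite rsum0; first by lra.
move=> i _; have /Rmult_integral [|//] := rsum_eq0 h (esym E) i.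
by have := m0 i; lra.
Qed.

Lemma quad_eigenvector q l i : orthonormal q -> quad p (spec q l) (q i) = l i.
Proof.
move=> [q1 _]; rewrite quad_spec (eq_bigr (fun j => mid p i j * l j)) ?rsum_deltal //.
by move=> j _; rewrite q1 midC /mid; case: eqP => _ /=; lra.
Qed.

Lemma pd_spec u : pd p u ->
  exists l q, [/\ orthonormal q, forall i, 0 < l i & u = spec q l].
Proof.
move=> [symu pu]; have [l [q [oq E]]] := symmetric_spec symu.
exists l, q; split => // i.
rewrite -(quad_eigenvector l i oq) -E.
apply: pu; apply: NNPP => H.
case: (oq) => /(_ i i) + _; rewrite /mid eqxx big1; first by move=> /=; lra.
by move=> a _; case: (Req_dec (q i a) 0) => [->|]; [lra|move=> ?; case: H; exists a].
Qed.

Lemma psd_spec x : psd p x ->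
  exists l q, [/\ orthonormal q, forall i, 0 <= l i & x = spec q l].
Proof.
move=> [symx psx]; have [l [q [oq E]]] := symmetric_spec symx.
by exists l, q; split => // i; rewrite -(quad_eigenvector l i oq) -E.
Qed.

Lemma quad_le_mtrace x v : psd p x -> quad p x v <= (\rsum_(a < p) v a ^ 2) * mtrace p x.
Proof.
move=> /psd_spec [l [q [oq l0 E]]]; rewrite E (mtrace_spec _ oq) quad_spec (norm2_orthonormal v oq) rsum_mulr.
apply: rsum_le => i _; rewrite Rmult_comm; apply: Rmult_le_compat_l.
  exact: pow2_ge_0.
exact: rsum_term_le.
Qed.

End SpectralCalculus.

(** * Positive semidefinite matrices of bounded rank as Gram matrices *)

Section Gram.
Variable p : nat.
Implicit Types (x : rmat p) (v w : rvec p).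

Definition gram k (Y : 'I_p -> 'I_k -> R) : rmat p :=
  fun a b => \rsum_(l < k) (Y a l * Y b l).

Lemma quad_gram k (Y : 'I_p -> 'I_k -> R) v :
  quad p (gram Y) v = \rsum_(l < k) (\rsum_(a < p) (v a * Y a l)) ^ 2.
Proof.
rewrite /quad /gram.
under [RHS]eq_bigr => l _ do rewrite rsum_sqr.
rewrite [RHS]exchange_big /=; apply: eq_bigr => a _.
rewrite [RHS]exchange_big /=; apply: eq_bigr => b _.
by rewrite rsum_mull rsum_mulr; apply: eq_bigr => l _; lra.
Qed.

Lemma gram_psd k (Y : 'I_p -> 'I_k -> R) : psd p (gram Y).
Proof.
split; first by move=> a b; apply: eq_bigr => l _; lra.
by move=> v; rewrite quad_gram; apply: rsum_ge0 => l _; apply: pow2_ge_0.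
Qed.

(** More than [k] rows of [Y] are linearly dependent. The coefficients of a relation, extended by
    zero, are annihilated by [Y^T], hence by [Y Y^T]. *)
Lemma gram_rank_le k (Y : 'I_p -> 'I_k -> R) : rank_le p (gram Y) k.
Proof.
move=> S indep; rewrite leqNgt; apply/negP=> kS.
pose M := (\matrix_(i, l) Y (enum_val i) l)%R : 'M[R]_(#|S|, k).
have : kermx M != 0%R.
  by rewrite -mxrank_eq0 mxrank_ker subn_eq0 -ltnNge (leq_ltn_trans (rank_leq_col M)).
case/rowV0Pn=> v /sub_kermxP vM v0.
pose vf (i : 'I_#|S|) : R := v 0%R i.
pose c j := \rsum_(i < #|S|) (vf i * mid p (enum_val i) j).
have cY l : \rsum_(j < p) (Y j l * c j) = 0.
  move/rowP: vM => /(_ l); rewrite !mxE => E; rewrite -[RHS]E /c.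
  under eq_bigr => j _ do rewrite rsum_mull.
  rewrite exchange_big /=; apply: eq_bigr => i _.
  rewrite (eq_bigr (fun j => mid p (enum_val i) j * (vf i * Y j l))).
    by rewrite rsum_deltal mxE.
  by move=> j _; lra.
case/eqP: v0; apply/rowP=> i; rewrite mxE.
suff E : c (enum_val i) = vf i.
  rewrite -/(vf i) -E.
  apply: indep => [j jS|a].
    rewrite /c rsum0 // => i' _; rewrite /mid; case: eqP => [E2|_]; last by lra.
    by rewrite -E2 enum_valP in jS.
  rewrite /gram.
  under eq_bigr => j _ do rewrite rsum_mulr.
  rewrite exchange_big /= rsum0 // => l _.
  rewrite (eq_bigr (fun j => Y a l * (Y j l * c j))); last by move=> j _; lra.
  by rewrite -rsum_mull cY; lra.
rewrite /c (bigD1 i) //= rsum0 => [|j ji]; rewrite /mid.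
  by rewrite eqxx; lra.
by rewrite (inj_eq enum_val_inj) (negbTE ji); lra.
Qed.

Lemma gram_Dp k (Y : 'I_p -> 'I_k -> R) : Dp p k (gram Y).
Proof. split; [exact: gram_psd|exact: gram_rank_le]. Qed.

Lemma psd_isotropic x v : psd p x -> quad p x v = 0 ->
  forall i, \rsum_(j < p) (x i j * v j) = 0.
Proof.
move=> /psd_spec [l [q [oq l0 ->]]]; rewrite quad_spec => E i.
have h j : l j * (\rsum_(a < p) (q j a * v a)) = 0.
  have h0 i' : 0 <= l i' * (\rsum_(a < p) (q i' a * v a)) ^ 2.
    by apply: Rmult_le_pos => //; apply: pow2_ge_0.
  have /Rmult_integral [->|H] := rsum_eq0 h0 E j; first by lra.
  rewrite (Rsqr_0_uniq (\rsum_(a < p) (q j a * v a))) ?Rmult_0_r //.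
  by rewrite /Rsqr -[RHS]H; lra.
rewrite /spec; under eq_bigr => j _ do rewrite rsum_mulr.
rewrite exchange_big /= rsum0 // => j _.
transitivity (q j i * (l j * (\rsum_(a < p) (q j a * v a)))); last by rewrite h; lra.
by rewrite !rsum_mull; apply: eq_bigr => a _; lra.
Qed.

Lemma quad_mid x i : quad p x (mid p i) = x i i.
Proof.
rewrite /quad; under eq_bigr => a _.
  rewrite (eq_bigr (fun b => mid p i b * (mid p i a * x a b))); last by move=> b _; lra.
  rewrite rsum_deltal.
  over.
by rewrite rsum_deltal.
Qed.

Lemma psd_diag_ge0 x i : psd p x -> 0 <= x i i.
Proof. by move=> [_ /(_ (mid p i))]; rewrite quad_mid. Qed.

Lemma psd_diag_eq0 x i j : psd p x -> x i i = 0 -> x j i = 0.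
Proof.
move=> psx; rewrite -quad_mid => /(psd_isotropic psx) /(_ j).
by under eq_bigr => a _ do rewrite midC; rewrite rsum_deltar.
Qed.

Lemma quad_shift x v i c : msymmetric p x ->
  quad p x (fun a => v a + c * mid p i a) =
  quad p x v + 2 * c * (\rsum_(a < p) (v a * x a i)) + c ^ 2 * x i i.
Proof.
move=> symx; rewrite -(quad_mid x) /quad.
transitivity (\rsum_(a < p) \rsum_(b < p)
  (v a * x a b * v b + mid p i b * (c * (v a * x a b))
   + mid p i a * (c * (x a b * v b)) + c ^ 2 * (mid p i a * x a b * mid p i b))).
  by apply: eq_bigr => a _; apply: eq_bigr => b _; lra.
rewrite (eq_bigr (fun a => \rsum_(b < p) (v a * x a b * v b) + c * (v a * x a i) +
    mid p i a * (c * (\rsum_(b < p) (x a b * v b))) +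
    c ^ 2 * (\rsum_(b < p) (mid p i a * x a b * mid p i b)))); last first.
  by move=> a _; rewrite !rsum_add rsum_deltal !rsum_mull.
rewrite !rsum_add rsum_deltal -!rsum_mull.
have -> : \rsum_(b < p) (x i b * v b) = \rsum_(b < p) (v b * x b i).
  by apply: eq_bigr => b _; rewrite symx; lra.
rewrite /=; lra.
Qed.

(** The Schur complement of the entry [x i i]: its form at [v] is the minimum over [c] of the form
    of [x] at [v + c e_i], attained at [c = - s / x i i]. *)
Lemma psd_peel x i : psd p x -> 0 < x i i ->
  psd p (fun a b => x a b - x a i * x b i / x i i).
Proof.
move=> [symx psx] xi; split; first by move=> a b; rewrite symx; lra.
move=> v; pose s := \rsum_(a < p) (v a * x a i).
suff -> : quad p (fun a b => x a b - x a i * x b i / x i i) v =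
          quad p x (fun a => v a + (- (s / x i i)) * mid p i a) by apply: psx.
rewrite quad_shift // -/s.
transitivity (quad p x v - s ^ 2 / x i i); last by field; lra.
rewrite /quad /s rsum_sqr /Rdiv rsum_mulr -rsum_sub; apply: eq_bigr => a _.
rewrite rsum_mulr -rsum_sub; apply: eq_bigr => b _; lra.
Qed.

(** Column [i] of the Schur complement is zero, so [i] is not in an independent [S]; adding [i] to
    [S] gives an independent family of columns of [x], which has at most [k + 1] members. *)
Lemma rank_peel x i k : msymmetric p x -> 0 < x i i -> rank_le p x k.+1 ->
  rank_le p (fun a b => x a b - x a i * x b i / x i i) k.
Proof.
move=> symx xi rk S indep.
have iS : i \notin S.
  apply/negP=> iS; have := indep (mid p i) _ _ i.
  rewrite {3}/mid eqxx => H; suff : 1 = 0 by lra.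
  apply: H => [j jS|a].
    by rewrite /mid; case: eqP => // E; rewrite -E iS in jS.
  by under eq_bigr => j _ do rewrite midC; rewrite rsum_deltar; field; lra.
suff /rk : lin_indep_cols p x (i |: S) by rewrite cardsU1 iS.
move=> c cS xc.
have cN j : j != i -> c j = 0.
  move=> ji; pose c' j := c j - c i * mid p i j.
  have : forall j, c' j = 0.
    apply: indep => [a aS|a].
      rewrite /c' /mid; case: eqP => [<-|/eqP ia]; first by lra.
      by rewrite cS ?in_setU1 ?(negbTE aS) ?orbF 1?eq_sym //; lra.
    rewrite /c'.
    transitivity (\rsum_(b < p) (x a b * c b) - \rsum_(b < p) (mid p i b * (x a b * c i))
      - x a i / x i i * (\rsum_(b < p) (x i b * c b) -
          \rsum_(b < p) (mid p i b * (x i b * c i)))).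
      rewrite -!rsum_sub rsum_mull -rsum_sub; apply: eq_bigr => b _.
      by rewrite (symx b i); field; lra.
    by rewrite !rsum_deltal !xc; field; lra.
  move/(_ j); rewrite /c' /mid eq_sym (negbTE ji); lra.
move=> j; case: (eqVneq j i) => [->|]; last exact: cN.
have := xc i; rewrite (bigD1 i) //= rsum0 => [|b bi]; last by rewrite cN //; lra.
by rewrite Rplus_0_r => /Rmult_integral [|//]; lra.
Qed.

Lemma rank0 x : rank_le p x 0 -> forall i j, x i j = 0.
Proof.
move=> rk i j; apply: NNPP => xij; suff /rk : lin_indep_cols p x [set j] by rewrite cards1.
move=> c cS xc.
have cN a : a != j -> c a = 0 by move=> aj; apply: cS; rewrite in_set1.
move=> a; case: (eqVneq a j) => [->|]; last exact: cN.
have := xc i; rewrite (bigD1 j) //= rsum0 => [|b bi]; last by rewrite cN //; lra.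
by rewrite Rplus_0_r => /Rmult_integral [].
Qed.

(** Cholesky elimination with pivots: each positive diagonal entry contributes one column of [Y] and
    lowers the rank bound by one. Once no diagonal entry is positive the matrix is zero, and so are
    the remaining columns. *)
Lemma psd_rank_gram k x : psd p x -> rank_le p x k ->
  exists Y : 'I_p -> 'I_k -> R, x = gram Y.
Proof.
elim: k x => [|k IH] x psx rk.
  by exists (fun _ _ => 0); apply: mat_ext => a b; rewrite /gram big_ord0 rank0.
case: (classic (exists i, 0 < x i i)) => [[i xi]|H].
  have symx := proj1 psx.
  have [Y E] := IH _ (psd_peel psx xi) (rank_peel symx xi rk).
  pose s := sqrt (x i i).
  have ss : s * s = x i i by apply: sqrt_sqrt; lra.
  have s0 : s <> 0 by move=> s0; rewrite s0 in ss; lra.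
  exists (fun a l => if unlift ord0 l is Some l' then Y a l' else x a i / s).
  apply: mat_ext => a b; rewrite /gram big_ord_recl unlift_none.
  under eq_bigr => l _ do rewrite liftK.
  rewrite -/(gram Y a b) -E -ss; field; lra.
exists (fun _ _ => 0); apply: mat_ext => a b; rewrite /gram rsum0 => [|l _]; last by lra.
apply: psd_diag_eq0 => //; apply: Rle_antisym; last exact: psd_diag_ge0.
by apply: Rnot_lt_le => xb; apply: H; exists b.
Qed.

Lemma Dp_gramP k x : Dp p k x <-> exists Y : 'I_p -> 'I_k -> R, x = gram Y.
Proof.
split=> [[psx rk]|[Y ->]]; [exact: psd_rank_gram|exact: gram_Dp].
Qed.

Lemma Dp_full x : psd p x -> Dp p p x.
Proof. by split=> // S _; rewrite -[X in (_ <= X)%N]card_ord max_card. Qed.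

(** If all columns were independent, an isotropic vector, which lies in the kernel, would be zero,
    and [x] would be positive definite. *)
Lemma psd_not_pd_rank x : (0 < p)%N -> psd p x -> ~ pd p x -> rank_le p x p.-1.
Proof.
move=> p0 psx npd S indep; rewrite -ltnS prednK // ltn_neqAle.
rewrite -[X in _ && (_ <= X)%N]card_ord max_card andbT; apply/negP=> /eqP cS.
have ST : S = [set: 'I_p] by apply/eqP; rewrite eqEcard subsetT cardsT card_ord cS /=.
apply: npd; split; first exact: (proj1 psx).
move=> v [i vi]; case: (Rle_lt_or_eq_dec _ _ (proj2 psx v)) => // E.
case: vi; apply: indep; last by apply: psd_isotropic.
by move=> j; rewrite ST in_setT.
Qed.

End Gram.

(** * The Wishart flow on exponentials *)

Lemma exp_le_mono x y : x <= y -> exp x <= exp y.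
Proof. by case=> [/exp_increasing|->]; lra. Qed.

Lemma is_derive_rsum I (r : seq I) (F : I -> R -> R) (dF : I -> R) (t : R) :
  (forall i, is_derive (F i) t (dF i)) ->
  is_derive (fun s => \rsum_(i <- r) F i s) t (\rsum_(i <- r) dF i).
Proof.
move=> H; elim: r => [|a r IH].
  apply: (is_derive_ext (fun _ => 0)) => [s|]; first by rewrite big_nil.
  by rewrite big_nil; apply: is_derive_const.
apply: (is_derive_ext (fun s => F a s + \rsum_(i <- r) F i s)) => [s|].
  by rewrite big_cons.
by rewrite big_cons; apply: is_derive_plus.
Qed.

Lemma ln_rprod I (r : seq I) (F : I -> R) : (forall i, 0 < F i) ->
  0 < \big[Rmult/1]_(i <- r) F i /\
  ln (\big[Rmult/1]_(i <- r) F i) = \rsum_(i <- r) ln (F i).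
Proof.
move=> H; elim: r => [|a r [IH1 IH2]]; first by rewrite !big_nil ln_1; lra.
rewrite !big_cons; split; first exact: Rmult_lt_0_compat.
by rewrite ln_mult // IH2.
Qed.

Lemma pos_lower_bound (I : finType) (F : I -> R) : (forall i, 0 < F i) ->
  exists c, 0 < c /\ forall i, c <= F i.
Proof.
move=> H; exists (/ (1 + \big[Rplus/0]_i / F i)).
have H' i : 0 <= / F i by apply: Rlt_le; apply: Rinv_0_lt_compat.
have S0 : 0 <= \big[Rplus/0]_i / F i by apply: rsum_ge0.
split; first by apply: Rinv_0_lt_compat; lra.
move=> i; rewrite -[X in _ <= X]Rinv_inv; apply: Rinv_le_contravar.
  exact: Rinv_0_lt_compat.
by move: (rsum_term_le i H') => /=; lra.
Qed.

Section Flow.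
Variables (p : nat) (alpha : R).
Implicit Types (x u : rmat p) (t s : R).

(** Solution of the Riccati equation [u' = - 2 u^2]: an eigenvalue [l] moves to [l / (1 + 2 t l)].
    In these terms the Wishart formula says that [P_t f_u] is [dfac t u] times the exponential of
    [flow t u]. *)
Definition flow t u := minv p (madd p (minv p u) (mscale p (2 * t) (mid p))).

Definition dfac t u := Rpower (mdet p (madd p (mid p) (mscale p (2 * t) u))) (- alpha / 2).

Definition gen u x := 2 * mtrace p (mmul p x (mmul p u u)) - alpha * mtrace p u.

Lemma one_plus_pos t l : 0 <= t -> 0 < l -> 0 < 1 + 2 * t * l.
Proof. by move=> t0 l0; have := Rmult_le_pos _ _ t0 (Rlt_le _ _ l0); lra. Qed.

Section OnSpectrum.
Variables (q : 'I_p -> rvec p) (l : rvec p).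
Hypotheses (oq : orthonormal q) (l0 : forall i, 0 < l i).

Lemma flow_spec t : 0 <= t -> flow t (spec q l) = spec q (fun i => l i / (1 + 2 * t * l i)).
Proof.
move=> t0; have h i : 0 < 1 + 2 * t * l i by apply: one_plus_pos.
have h' i : 0 < / l i + 2 * t.
  by have := Rinv_0_lt_compat _ (l0 i); lra.
rewrite /flow minv_spec // => [|i]; last by have := l0 i; lra.
rewrite [in mscale _ _ _](spec_mid oq) spec_scale spec_add minv_spec // => [|i].
  by apply: eq_spec => i; have := l0 i; have := h i; move=> ? ?; field; split; nra.
by have := h' i; lra.
Qed.

Lemma dfac_spec t : 0 <= t ->
  dfac t (spec q l) = exp (- alpha / 2 * (\rsum_(i < p) ln (1 + 2 * t * l i))).
Proof.
move=> t0; rewrite /dfac /Rpower [mid p](spec_mid oq) spec_scale spec_add mdet_spec //.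
by rewrite (proj2 (ln_rprod _ _)) // => i; apply: one_plus_pos.
Qed.

End OnSpectrum.

Lemma flow_pd t u : 0 <= t -> pd p u -> pd p (flow t u).
Proof.
move=> t0 /pd_spec [l [q [oq l0 ->]]]; rewrite flow_spec //; apply: spec_pd => // i.
by apply: Rdiv_lt_0_compat => //; apply: one_plus_pos.
Qed.

Lemma flow_0 u : pd p u -> flow 0 u = u.
Proof.
move=> /pd_spec [l [q [oq l0 ->]]]; rewrite flow_spec //; last by lra.
by apply: eq_spec => i; field; lra.
Qed.

Lemma dfac_0 u : pd p u -> dfac 0 u = 1.
Proof.
move=> /pd_spec [l [q [oq l0 ->]]]; rewrite dfac_spec //; last by lra.
rewrite rsum0 ?Rmult_0_r ?exp_0 // => i _.
by rewrite -[RHS]ln_1; congr ln; lra.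
Qed.

Lemma flow_flow t s u : 0 <= t -> 0 <= s -> pd p u -> flow t (flow s u) = flow (t + s) u.
Proof.
move=> t0 s0 /pd_spec [l [q [oq l0 ->]]].
have h1 i : 0 < 1 + 2 * s * l i by apply: one_plus_pos.
have h2 i : 0 < 1 + 2 * (t + s) * l i by apply: one_plus_pos => //; lra.
rewrite flow_spec // flow_spec //; last by move=> i; apply: Rdiv_lt_0_compat.
rewrite flow_spec //; last by lra.
apply: eq_spec => i; move: (h1 i) (h2 i) => ? ?; field.
by repeat split; lra.
Qed.

(** The cocycle identity behind the semigroup law; for each eigenvalue, [(1 + 2 s l) (1 + 2 t l / (1
    + 2 s l)) = 1 + 2 (t + s) l]. *)
Lemma dfac_flow t s u : 0 <= t -> 0 <= s -> pd p u ->
  dfac s u * dfac t (flow s u) = dfac (t + s) u.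
Proof.
move=> t0 s0 /pd_spec [l [q [oq l0 ->]]].
have h1 i : 0 < 1 + 2 * s * l i by apply: one_plus_pos.
have h2 i : 0 < 1 + 2 * (t + s) * l i by apply: one_plus_pos => //; lra.
have h3 i : 0 < l i / (1 + 2 * s * l i) by apply: Rdiv_lt_0_compat.
rewrite flow_spec // !dfac_spec //; last by lra.
rewrite -exp_plus -Rmult_plus_distr_l -rsum_add; congr (exp (_ * _)).
apply: eq_bigr => i _; rewrite -ln_mult //; last exact: one_plus_pos.
by congr ln; field; move: (h1 i); lra.
Qed.

Lemma dfac_pos t u : 0 < dfac t u.
Proof. exact: exp_pos. Qed.

Lemma dfac_le1 t u : 0 <= alpha -> 0 <= t -> pd p u -> dfac t u <= 1.
Proof.
move=> a0 t0 /pd_spec [l [q [oq l0 ->]]]; rewrite dfac_spec // -[X in _ <= X]exp_0.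
set S := (X in exp (_ * X)).
suff S0 : 0 <= S by apply: exp_le_mono; have := Rmult_le_pos _ _ a0 S0; lra.
apply: rsum_ge0 => i _; have H := Rmult_le_pos _ _ t0 (Rlt_le _ _ (l0 i)).
have : ln 1 <= ln (1 + 2 * t * l i) by apply: ln_le; lra.
by rewrite ln_1.
Qed.

(** Eigenvalues of the flow decrease in time, so their values at [T] bound them below on the whole
    interval. The resulting decay at infinity, uniform in [t], supplies the compactness for the
    maximum principle. *)
Lemma flow_lower_bound T u : 0 <= T -> pd p u ->
  exists c, 0 < c /\ forall t x, 0 <= t <= T -> psd p x ->
    c * mtrace p x <= mtrace p (mmul p x (flow t u)).
Proof.
move=> T0 /pd_spec [l [q [oq l0 ->]]].
have [|c [c0 H]] := @pos_lower_bound _ (fun i => l i / (1 + 2 * T * l i)).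
  by move=> i; apply: Rdiv_lt_0_compat => //; apply: one_plus_pos.
exists c; split=> // t x tT psx.
rewrite flow_spec //; last by lra.
rewrite (mtrace_quad x oq) mtrace_mul_spec rsum_mull.
apply: rsum_le => i _; apply: Rmult_le_compat_r; first exact: (proj2 psx).
apply: Rle_trans (H i) _; apply: Rmult_le_compat_l; first exact: Rlt_le.
apply: Rinv_le_contravar; first by apply: one_plus_pos => //; lra.
by have := l0 i; nra.
Qed.

(* The Wishart transform of [f_u], in a form that is smooth in [t] near [0]. *)
Definition wtr (l : rvec p) (q : 'I_p -> rvec p) t x :=
  exp (- alpha / 2 * (\rsum_(i < p) ln (1 + 2 * t * l i)) -
       \rsum_(i < p) (l i / (1 + 2 * t * l i) * quad p x (q i))).

Lemma wtrE l q t x : orthonormal q -> (forall i, 0 < l i) -> 0 <= t ->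
  wtr l q t x = dfac t (spec q l) * exp (- mtrace p (mmul p x (flow t (spec q l)))).
Proof.
by move=> oq l0 t0; rewrite flow_spec // dfac_spec // mtrace_mul_spec -exp_plus.
Qed.

Lemma is_derive_wtr l q t x : orthonormal q -> (forall i, 0 < l i) -> 0 <= t ->
  is_derive (fun s => wtr l q s x) t (gen (flow t (spec q l)) x * wtr l q t x).
Proof.
move=> oq l0 t0.
have h i : 0 < 1 + 2 * t * l i by apply: one_plus_pos.
pose d1 i := 2 * l i / (1 + 2 * t * l i).
pose d2 i := - (2 * (l i / (1 + 2 * t * l i)) ^ 2) * quad p x (q i).
have -> : gen (flow t (spec q l)) x =
    - alpha / 2 * (\rsum_(i < p) d1 i) - \rsum_(i < p) d2 i.
  rewrite /gen flow_spec // spec_mul // mtrace_spec // mtrace_mul_spec.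
  rewrite !rsum_mull -!rsum_sub; apply: eq_bigr => i _; rewrite /d1 /d2.
  by field; move: (h i); lra.
rewrite /wtr; apply: (is_derive_comp exp); first exact: is_derive_exp.
apply: is_derive_minus.
  apply: is_derive_scal; apply: is_derive_rsum => i.
  auto_derive; first exact: h.
  by rewrite /d1; field; move: (h i); lra.
apply: is_derive_rsum => i.
auto_derive; first by move: (h i); lra.
by rewrite /d2; field; move: (h i); lra.
Qed.

End Flow.

(** * The positive maximum principle for the generator *)

Lemma derive_pos_right (G : R -> R) x d : is_derive G x d -> 0 < d ->
  exists delta, 0 < delta /\ forall h, 0 < h < delta -> G x < G (x + h).
Proof.
move=> /is_derive_Reals H d0; have [delta D] := H (d / 2) ltac:(lra).
exists delta; split=> [|h hd]; first exact: cond_pos.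
have := D h ltac:(lra) ltac:(by rewrite Rabs_right; lra).
move=> /Rabs_def2 [_ lo]; apply: Rnot_le_lt => le.
suff : (G (x + h) - G x) / h <= 0 by lra.
by have := Rinv_0_lt_compat _ (proj1 hd); rewrite /Rdiv; nra.
Qed.

Lemma derive_pos_left (G : R -> R) x d : is_derive G x d -> 0 < d ->
  exists delta, 0 < delta /\ forall h, 0 < h < delta -> G (x - h) < G x.
Proof.
move=> dG d0; have [||delta [D0 D]] := @derive_pos_right (fun y => - G (2 * x - y)) x d => //.
  have -> : d = - (- 1 * d) by lra.
  apply: is_derive_opp; apply: (is_derive_comp G).
    by have -> : 2 * x - x = x by lra.
  by auto_derive; rewrite //; lra.
exists delta; split=> // h hd; have := D h hd.
have -> : 2 * x - (x + h) = x - h by lra.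
have -> : 2 * x - x = x by lra.
lra.
Qed.

(** [G1 0 >= 0], since otherwise [G] would be larger to the left of 0. If [d > 0], then [G1] is
    positive just to the right of 0, and the mean value theorem makes [G] exceed [G 0] there. *)
Lemma max_second_derivative (G G1 : R -> R) d : (forall e, is_derive G e (G1 e)) ->
  is_derive G1 0 d -> (forall e, G e <= G 0) -> d <= 0.
Proof.
move=> dG dG1 mx; apply: Rnot_lt_le => d0.
have G10 : 0 <= G1 0.
  apply: Rnot_lt_le => neg; have [|delta [D0 D]] := derive_pos_left (is_derive_opp _ _ _ (dG 0)).
    by rewrite /opp /=; lra.
  by have := D (delta / 2) ltac:(lra); have := mx (0 - delta / 2); rewrite /opp /=; lra.
have [delta [D0 D]] := derive_pos_right dG1 d0.
have [|c [E [c0 c1]]] := @MVT_cor2 G G1 0 (delta / 2) ltac:(lra).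
  by move=> c _; apply/is_derive_Reals; apply: dG.
have := D c ltac:(lra); rewrite Rplus_0_l => pos.
by have := mx (delta / 2); nra.
Qed.

(** Along the line that moves one entry of [Y] by [e], each exponent [tr (u Y Y^T)] is quadratic in
    [e]; the conclusion is the second derivative test at [e = 0]. *)
Lemma max_exp_quadratics I (r : seq I) (c A B C : I -> R) :
  (forall e, \rsum_(i <- r) (c i * exp (- (A i + 2 * B i * e + C i * e ^ 2))) <=
             \rsum_(i <- r) (c i * exp (- A i))) ->
  \rsum_(i <- r) (c i * ((4 * B i ^ 2 - 2 * C i) * exp (- A i))) <= 0.
Proof.
move=> H.
pose G e := \rsum_(i <- r) (c i * exp (- (A i + 2 * B i * e + C i * e ^ 2))).
pose G1 e := \rsum_(i <- r)
  (c i * (- (2 * B i + 2 * C i * e) * exp (- (A i + 2 * B i * e + C i * e ^ 2)))).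
apply: (@max_second_derivative G G1).
- by move=> e; apply: is_derive_rsum => i; auto_derive => //=; ring.
- apply: is_derive_rsum => i; auto_derive => //=.
  have -> : A i + 2 * B i * 0 + C i * (0 * (0 * 1)) = A i by lra.
  by ring.
- move=> e; apply: Rle_trans (H e) _; rewrite /G; right; apply: eq_bigr => i _.
  by congr (_ * exp _); lra.
Qed.

Section PositiveMaximum.
Variables (p : nat) (alpha : R).
Implicit Types (x : rmat p).

Definition pdmat := {u : rmat p | pd p u}.
(* Formal linear combinations of the functions [f_u]. *)
Definition comb := seq (R * pdmat).
Implicit Types (g : comb).

Definition mu (a : R * pdmat) : rmat p := proj1_sig a.2.

Lemma mu_pd a : pd p (mu a).
Proof. exact: proj2_sig. Qed.

Definition ev g x := \rsum_(a <- g) (a.1 * exp (- mtrace p (mmul p (mu a) x))).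

(** The generator with drift [b], applied to [ev g]. The drift is a parameter because [alpha] is
    compared with [INR p] and [INR p.-1], for which Gram coordinates are available. *)
Definition genc (b : R) g x := \rsum_(a <- g)
  (a.1 * ((2 * mtrace p (mmul p x (mmul p (mu a) (mu a))) - b * mtrace p (mu a)) *
          exp (- mtrace p (mmul p (mu a) x)))).

(** Minus the derivative of [ev g] in the direction of the identity; generators with different
    drifts differ by a multiple of it. *)
Definition trc g x := \rsum_(a <- g)
  (a.1 * (mtrace p (mu a) * exp (- mtrace p (mmul p (mu a) x)))).

Lemma genc_shift b b' g x : genc b g x = genc b' g x - (b - b') * trc g x.
Proof. by rewrite /genc /trc rsum_mull -rsum_sub; apply: eq_bigr => a _; lra. Qed.

Lemma mtrace_mul_gram k (u : rmat p) (Y : 'I_p -> 'I_k -> R) :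
  mtrace p (mmul p u (gram Y)) = \rsum_(l < k) quad p u (fun a => Y a l).
Proof.
rewrite /mtrace /mmul /gram /quad [RHS]exchange_big /=; apply: eq_bigr => a _.
rewrite [RHS]exchange_big /=; apply: eq_bigr => b _.
by rewrite rsum_mull; apply: eq_bigr => l _; lra.
Qed.

Lemma mtrace_gram k (Y : 'I_p -> 'I_k -> R) :
  mtrace p (gram Y) = \rsum_(a < p) \rsum_(l < k) Y a l ^ 2.
Proof. by apply: eq_bigr => a _; apply: eq_bigr => l _; lra. Qed.

(* In the coordinates [x = Y Y^T] with [Y] of size [p * k], the generator with drift [k]
   is half the Laplacian. *)
Lemma genc_gram_le0 k g (Y : 'I_p -> 'I_k -> R) :
  (forall Y' : 'I_p -> 'I_k -> R, ev g (gram Y') <= ev g (gram Y)) ->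
  genc (INR k) g (gram Y) <= 0.
Proof.
move=> mx; pose S (u : rmat p) b l := \rsum_(a < p) (Y a l * u a b).
(* Second derivative test in the entry of [Y] at row [b] and column [l]; the sum over all entries is
   the Laplacian. *)
have dir b l : \rsum_(a <- g) (a.1 * ((4 * S (mu a) b l ^ 2 - 2 * mu a b b) *
    exp (- mtrace p (mmul p (mu a) (gram Y))))) <= 0.
  apply: max_exp_quadratics => e.
  apply: Rle_trans (mx (fun a l' => Y a l' + (e * mid k l l') * mid p b a)).
  right; apply: eq_bigr => a _; congr (_ * exp (- _)).
  rewrite !mtrace_mul_gram.
  rewrite [RHS](eq_bigr (fun l' => quad p (mu a) (fun c => Y c l') +
    2 * (e * mid k l l') * S (mu a) b l' + (e * mid k l l') ^ 2 * mu a b b)); last first.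
    by move=> l' _; rewrite quad_shift //; case: (mu_pd a).
  rewrite !rsum_add.
  rewrite [X in _ = _ + X + _](eq_bigr (fun l' => mid k l l' * (2 * S (mu a) b l' * e))) => [|l' _]; last first.
    by rewrite /S; lra.
  rewrite [X in _ = _ + _ + X](eq_bigr (fun l' => mid k l l' * (mu a b b * e ^ 2))) => [|l' _].
    by rewrite !rsum_deltal.
  by rewrite /mid; case: eqP => _; lra.
have -> : genc (INR k) g (gram Y) = / 2 * (\rsum_(b < p) \rsum_(l < k)
    \rsum_(a <- g) (a.1 * ((4 * S (mu a) b l ^ 2 - 2 * mu a b b) *
    exp (- mtrace p (mmul p (mu a) (gram Y)))))).
  under [in RHS]eq_bigr => b _ do rewrite exchange_big /=.
  rewrite [in RHS]exchange_big /= rsum_mull; apply: eq_bigr => a _.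
  have -> : mtrace p (mmul p (gram Y) (mmul p (mu a) (mu a))) =
            \rsum_(b < p) \rsum_(l < k) S (mu a) b l ^ 2.
    rewrite mtrace_mulC mtrace_mul_gram [RHS]exchange_big; apply: eq_bigr => l _.
    rewrite /S; under [RHS]eq_bigr => b _ do rewrite rsum_sqr.
    rewrite /quad /mmul [RHS]exchange_big /=; apply: eq_bigr => c _.
    rewrite [RHS]exchange_big /=; apply: eq_bigr => d _.
    rewrite rsum_mull rsum_mulr; apply: eq_bigr => b _.
    by rewrite (proj1 (mu_pd a) b d); lra.
  set E := exp _.
  transitivity (/ 2 * (\rsum_(b < p) \rsum_(l < k) ((4 * S (mu a) b l ^ 2 -
      2 * mu a b b) * (a.1 * E)))); last first.
    congr (_ * _); apply: eq_bigr => b _; apply: eq_bigr => l _; lra.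
  have -> : \rsum_(b < p) \rsum_(l < k) ((4 * S (mu a) b l ^ 2 - 2 * mu a b b) * (a.1 * E))
     = (4 * (\rsum_(b < p) \rsum_(l < k) S (mu a) b l ^ 2) -
        2 * INR k * mtrace p (mu a)) * (a.1 * E).
    rewrite /mtrace !rsum_mull -rsum_sub rsum_mulr; apply: eq_bigr => b _.
    rewrite -rsum_mulr rsum_sub rsum_const card_ord -rsum_mull; congr (_ * _); rewrite /=; lra.
  by lra.
suff : \rsum_(b < p) \rsum_(l < k) \rsum_(a <- g)
   (a.1 * ((4 * S (mu a) b l ^ 2 - 2 * mu a b b) *
    exp (- mtrace p (mmul p (mu a) (gram Y))))) <= 0 by lra.
rewrite -[X in _ <= X](@rsum0 _ (index_enum 'I_p) xpredT (fun=> 0)) //.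
apply: rsum_le => b _.
rewrite -[X in _ <= X](@rsum0 _ (index_enum 'I_k) xpredT (fun=> 0)) //.
by apply: rsum_le => l _; apply: dir.
Qed.

Lemma is_derive_ev_mid g x : is_derive
  (fun e => ev g (madd p x (mscale p e (mid p)))) 0 (- trc g x).
Proof.
have E e : ev g (madd p x (mscale p e (mid p))) = \rsum_(a <- g)
    (a.1 * exp (- (mtrace p (mmul p (mu a) x) + e * mtrace p (mu a)))).
  apply: eq_bigr => a _; congr (_ * exp (- _)).
  rewrite /mtrace rsum_mull -rsum_add; apply: eq_bigr => i _.
  rewrite /mmul /madd /mscale.
  rewrite (eq_bigr (fun j => mu a i j * x j i + e * (mu a i j * mid p j i))).
    by rewrite rsum_add -rsum_mull rsum_deltar.
  by move=> j _; lra.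
apply: (is_derive_ext _ _ _ _ (fun e => esym (E e))).
rewrite /trc -rsum_opp; apply: is_derive_rsum => a.
auto_derive => //; rewrite Rmult_0_l Rplus_0_r; lra.
Qed.

Lemma psd_add_mid x e : psd p x -> 0 <= e -> psd p (madd p x (mscale p e (mid p))).
Proof.
move=> /psd_spec [l [q [oq l0 ->]]] e0.
rewrite (spec_mid oq) spec_scale spec_add; apply: spec_psd => i.
by have := l0 i; lra.
Qed.

Lemma pd_sub_mid x : pd p x ->
  exists c, 0 < c /\ forall e, - c < e -> psd p (madd p x (mscale p e (mid p))).
Proof.
move=> /pd_spec [l [q [oq l0 ->]]]; have [c [c0 H]] := pos_lower_bound l0.
exists c; split=> // e ec.
rewrite [mid p](spec_mid oq) spec_scale spec_add; apply: spec_psd => i.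
by have := H i; lra.
Qed.

Definition admissible k :=
  ((k < p)%N -> alpha = INR k) /\ (k = p -> INR p - 1 <= alpha).

Lemma genc_max_le0 k g x0 : (1 <= k <= p)%N -> admissible k -> Dp p k x0 ->
  (forall x, Dp p k x -> ev g x <= ev g x0) -> genc alpha g x0 <= 0.
Proof.
move=> /andP[k1 kp] [adm1 adm2] D0 mx.
move: kp; rewrite leq_eqVlt => /orP[/eqP E|kp]; last first.
  have [Y E] := (proj1 (Dp_gramP k x0)) D0; rewrite adm1 // E.
  by apply: genc_gram_le0 => Y'; rewrite -E; apply: mx; apply: gram_Dp.
subst k; have al := adm2 erefl; have psx := proj1 D0.
have mxp x : psd p x -> ev g x <= ev g x0 by move/Dp_full/mx.
have E0 : ev g (madd p x0 (mscale p 0 (mid p))) = ev g x0.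
  by congr ev; apply: mat_ext => i j; rewrite /madd /mscale; lra.
(* Adding a positive multiple of the identity does not leave the cone, so the derivative in this
   direction is nonpositive at every maximum. *)
have tr0 : - trc g x0 <= 0.
  apply: Rnot_lt_le => neg.
  have [d [d0 /(_ (d / 2)) H]] := derive_pos_right (is_derive_ev_mid g x0) neg.
  have := H ltac:(lra); rewrite E0 Rplus_0_l; apply: Rle_not_lt.
  by apply: mxp; apply: psd_add_mid => //; lra.
(* At an interior point a small multiple of the identity may also be subtracted, so [trc g x0 = 0]
   and the drift [alpha] can be exchanged for [p]. *)
case: (classic (pd p x0)) => [pdx|npd].
  have tr1 : trc g x0 <= 0.
    apply: Rnot_lt_le => neg; have [c [c0 Hc]] := pd_sub_mid pdx.
    have := is_derive_opp _ _ _ (is_derive_ev_mid g x0).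
    move=> /derive_pos_left [|d [d0 H]]; first by rewrite /opp /=; lra.
    have m0 : 0 < Rmin c d by apply: Rmin_pos.
    have := Rmin_l c d; have := Rmin_r c d => md mc.
    have := H (Rmin c d / 2) ltac:(lra); rewrite /opp /= E0.
    have := mxp _ (Hc (0 - Rmin c d / 2) ltac:(lra)); lra.
  have [Y E] := (proj1 (Dp_gramP p x0)) D0.
  have := @genc_gram_le0 p g Y; rewrite -E => /(_ _) H.
  rewrite (genc_shift alpha (INR p)).
  have -> : trc g x0 = 0 by lra.
  suff : genc (INR p) g x0 <= 0 by lra.
  by apply: H => Y'; apply: mxp; apply: gram_psd.
(* On the boundary [p - 1] columns suffice, and the excess drift contributes
   [- (alpha - (p - 1)) * trc g x0 <= 0]. For [p = 1] there are no columns and [x0 = 0]. *)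
have [Y E] := psd_rank_gram psx (psd_not_pd_rank k1 psx npd).
have := @genc_gram_le0 p.-1 g Y; rewrite -E => H.
rewrite (genc_shift alpha (INR p.-1)).
have pE : INR p.-1 = INR p - 1 by rewrite -[in RHS](prednK k1) S_INR; lra.
suff : genc (INR p.-1) g x0 <= 0 by rewrite pE; nra.
by apply: H => Y'; apply: mxp; apply: gram_psd.
Qed.

End PositiveMaximum.

(** * Compactness and the parabolic maximum principle *)

Lemma is_lim_seq_rsum I (r : seq I) (F : I -> nat -> R) (l : I -> R) :
  (forall i, is_lim_seq (F i) (l i)) ->
  is_lim_seq (fun n => \rsum_(i <- r) F i n) (\rsum_(i <- r) l i).
Proof.
move=> H; elim: r => [|a r IH].
  apply: (is_lim_seq_ext (fun _ => 0)) => [n|]; first by rewrite big_nil.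
  by rewrite big_nil; apply: is_lim_seq_const.
apply: (is_lim_seq_ext (fun n => F a n + \rsum_(i <- r) F i n)) => [n|].
  by rewrite big_cons.
by rewrite big_cons; apply: is_lim_seq_plus'.
Qed.

Lemma is_lim_seq_exp u (l : R) : is_lim_seq u l -> is_lim_seq (fun n => exp (u n)) (exp l).
Proof.
move=> H; apply: (is_lim_seq_continuous exp) => //.
by apply: derivable_continuous_pt; apply: derivable_pt_exp.
Qed.

Lemma is_lim_seq_ln u (l : R) : 0 < l -> is_lim_seq u l -> is_lim_seq (fun n => ln (u n)) (ln l).
Proof.
move=> l0 H; apply: (is_lim_seq_continuous ln) => //.
by apply/continuity_pt_filterlim; apply: continuous_ln.
Qed.

Definition extraction (phi : nat -> nat) := forall n, (phi n < phi (S n))%coq_nat.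

(** The limit superior is finite by boundedness and is approached within any tolerance at
    arbitrarily late indices; these are picked recursively. *)
Lemma bolzano_weierstrass (u : nat -> R) M : (forall n, Rabs (u n) <= M) ->
  exists phi (l : R), extraction phi /\ is_lim_seq (fun n => u (phi n)) l.
Proof.
move=> bd; have [L HL] := ex_LimSup_seq u.
have [l El] : exists l : R, L = l.
  case: L HL => [l _|H|H]; first by exists l.
    have [n [_]] := H M O; have := Rle_abs (u n); have := bd n; lra.
  have [N] := H (- M - 1) => /(_ N (Nat.le_refl N)).
  have := Rle_abs (- u N); rewrite Rabs_Ropp; have := bd N; lra.
subst L.
have ex N k : exists n, (N < n)%coq_nat /\ Rabs (u n - l) < / INR (S k).
  have e0 : 0 < / INR (S k) by apply: Rinv_0_lt_compat; apply: lt_0_INR; lia.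
  have [H1 [N2 H2]] := HL (mkposreal _ e0).
  have [n [nN un]] := H1 (S N + N2)%coq_nat.
  exists n; split; first by lia.
  by have := H2 n ltac:(lia); rewrite /= in un * => un2; apply: Rabs_def1; lra.
pose nx N k := proj1_sig (constructive_indefinite_description _ (ex N k)).
have nxP N k : (N < nx N k)%coq_nat /\ Rabs (u (nx N k) - l) < / INR (S k).
  exact: proj2_sig (constructive_indefinite_description _ (ex N k)).
pose phi := fix phi n := if n is S m then nx (phi m) (S m) else nx O O.
exists phi, l; split=> [n|]; first by case: (nxP (phi n) (S n)).
have H n : Rabs (u (phi n) - l) < / INR (S n).
  by case: n => [|n]; [exact: (proj2 (nxP O O))|exact: (proj2 (nxP (phi n) (S n)))].
apply/is_lim_seq_spec => eps.
have [N HN] := archimed_cor1 eps (cond_pos eps).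
exists N => n nN; apply: Rlt_trans (H n) _.
apply: Rle_lt_trans (proj1 HN); apply: Rinv_le_contravar.
  by apply: lt_0_INR; lia.
by apply: le_INR; lia.
Qed.

Lemma bolzano_weierstrass_fin (I : finType) (u : nat -> I -> R) M :
  (forall n i, Rabs (u n i) <= M) ->
  exists phi (l : I -> R), extraction phi /\ forall i, is_lim_seq (fun n => u (phi n) i) (l i).
Proof.
move=> bd.
suff [phi [l [ephi H]]] : exists phi (l : I -> R), extraction phi /\
    forall i, i \in enum I -> is_lim_seq (fun n => u (phi n) i) (l i).
  by exists phi, l; split=> // i; apply: H; rewrite mem_enum.
elim: (enum I) => [|i s [phi [l [ephi H]]]].
  by exists id, (fun _ => 0); split=> // n /=; lia.
have [psi [li [epsi Hi]]] := @bolzano_weierstrass (fun n => u (phi n) i) M (fun n => bd _ _).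
exists (fun n => phi (psi n)), (fun j => if j == i then li else l j); split.
  have mono m n : (m <= n)%coq_nat -> (phi m <= phi n)%coq_nat.
    by elim=> [|k _ IH]; [lia|have := ephi k; lia].
  move=> n; have := epsi n; case: (psi (S n)) => [|k]; first by lia.
  by move=> nk; have := mono (psi n) k ltac:(lia); have := ephi k; lia.
move=> j; rewrite inE; case: eqVneq => [->|_] //= js.
by apply: (is_lim_seq_subseq (fun n => u (phi n) j)); [apply: eventually_subseq|apply: H].
Qed.

(** * Evolution of combinations and the contraction estimate *)

Section Contraction.
Variables (p : nat) (alpha : R).
Hypothesis alpha0 : 0 <= alpha.
Implicit Types (x : rmat p) (g : comb p) (t : R).

(** One eigenbasis per [u], chosen once, makes [wt] a formula with a two-sided derivative at
    [t = 0], whereas [flow] and [dfac] are computed only for [0 <= t]. *)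
Definition spectrum (u : pdmat p) : {d : rvec p * ('I_p -> rvec p) |
  [/\ orthonormal d.2, forall i, 0 < d.1 i & proj1_sig u = spec d.2 d.1]}.
Proof.
apply: constructive_indefinite_description.
by have [l [q H]] := pd_spec (proj2_sig u); exists (l, q).
Qed.

Definition wt t (u : pdmat p) x :=
  wtr alpha (proj1_sig (spectrum u)).1 (proj1_sig (spectrum u)).2 t x.

Definition evt t g x := \rsum_(a <- g) (a.1 * wt t a.2 x).

Lemma wtE t u x : 0 <= t ->
  wt t u x = dfac alpha t (proj1_sig u) *
             exp (- mtrace p (mmul p x (flow t (proj1_sig u)))).
Proof.
rewrite /wt; case: (spectrum u) => [[l q] [/= oq l0 ->]] t0.
exact: wtrE.
Qed.

(** The evolution maps combinations to combinations, so the maximum principle for the generator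
    applies at every time and not only at time 0. *)
Definition flowc t (t0 : 0 <= t) g : comb p := [seq (a.1 * dfac alpha t (mu a),
  exist _ (flow t (mu a)) (flow_pd t0 (mu_pd a)) : pdmat p) | a <- g].

Lemma evtE t (t0 : 0 <= t) g x : evt t g x = ev (flowc t0 g) x.
Proof.
rewrite /ev /flowc big_map; apply: eq_bigr => a _.
by rewrite wtE // /mu /= mtrace_mulC; lra.
Qed.

Lemma evt_0 g x : evt 0 g x = ev g x.
Proof.
apply: eq_bigr => a _; rewrite wtE; last by lra.
by rewrite flow_0 ?dfac_0 ?Rmult_1_l ?(mtrace_mulC x) //; exact: mu_pd.
Qed.

Lemma is_derive_evt t (t0 : 0 <= t) g x :
  is_derive (fun s => evt s g x) t (genc alpha (flowc t0 g) x).
Proof.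
rewrite /genc /flowc big_map; apply: is_derive_rsum => a.
have -> : (a.1 * dfac alpha t (mu a), exist _ (flow t (mu a)) (flow_pd t0 (mu_pd a))).1 *
   (gen alpha (flow t (mu a)) x * exp (- mtrace p (mmul p (flow t (mu a)) x))) =
   a.1 * (gen alpha (flow t (mu a)) x * wt t a.2 x).
  by rewrite /= wtE // (mtrace_mulC x) /mu; lra.
apply: is_derive_scal; rewrite /wt /mu.
case: (spectrum a.2) => [[l q] [/= oq l0 ->]].
exact: is_derive_wtr.
Qed.

Lemma evt_decay T g : 0 <= T -> exists c, 0 < c /\ forall t x, 0 <= t <= T -> psd p x ->
  Rabs (evt t g x) <= (\rsum_(a <- g) Rabs a.1) * exp (- (c * mtrace p x)).
Proof.
move=> T0; elim: g => [|a g [c [c0 IH]]].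
  by exists 1; split=> [|t x _ _]; [lra|rewrite /evt !big_nil Rabs_R0; lra].
have [d [d0 H]] := flow_lower_bound T0 (mu_pd a).
exists (Rmin c d); split; first exact: Rmin_pos.
move=> t x tT psx; rewrite /evt !big_cons -/(evt t g x).
have tr0 : 0 <= mtrace p x by apply: rsum_ge0 => i _; apply: psd_diag_ge0.
have mc : exp (- (c * mtrace p x)) <= exp (- (Rmin c d * mtrace p x)).
  by apply: exp_le_mono; have := Rmin_l c d; nra.
have md : exp (- (d * mtrace p x)) <= exp (- (Rmin c d * mtrace p x)).
  by apply: exp_le_mono; have := Rmin_r c d; nra.
apply: Rle_trans (Rabs_triang _ _) _; rewrite Rmult_plus_distr_r.
apply: Rplus_le_compat; last first.
  apply: Rle_trans (IH t x tT psx) _; apply: Rmult_le_compat_l mc.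
  by apply: rsum_ge0 => b _; apply: Rabs_pos.
rewrite Rabs_mult; apply: Rmult_le_compat_l; first exact: Rabs_pos.
rewrite wtE; last by lra.
have dp := dfac_pos alpha t (mu a).
have d1 := dfac_le1 alpha0 (proj1 tT) (mu_pd a).
have ep := exp_pos (- mtrace p (mmul p x (flow t (mu a)))).
rewrite Rabs_right; last by apply: Rle_ge; apply: Rlt_le; apply: Rmult_lt_0_compat.
apply: Rle_trans md; apply: Rle_trans (_ : exp (- mtrace p (mmul p x (flow t (mu a)))) <= _).
  by rewrite -/(mu a); nra.
by apply: exp_le_mono; have := H t x tT psx; lra.
Qed.

(** From [exp (- z) <= 1 / (1 + z)] with [z = c * tr x]: a value of at least [b] forces
    [b (1 + z) <= C], hence [tr x <= C / (b c)]. *)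
Lemma evt_superlevel T g b : 0 <= T -> 0 < b ->
  exists M, 0 <= M /\ forall t x, 0 <= t <= T -> psd p x -> b <= Rabs (evt t g x) ->
    mtrace p x <= M.
Proof.
move=> T0 b0; have [c [c0 H]] := evt_decay g T0.
set C := \rsum_(a <- g) Rabs a.1 in H.
have C0 : 0 <= C by apply: rsum_ge0 => a _; apply: Rabs_pos.
have bc : 0 < b * c by apply: Rmult_lt_0_compat.
exists (C / (b * c)); split.
  by apply: Rmult_le_pos => //; apply: Rlt_le; apply: Rinv_0_lt_compat.
move=> t x tT psx bx; have := H t x tT psx.
have tr0 : 0 <= mtrace p x by apply: rsum_ge0 => i _; apply: psd_diag_ge0.
move: (mtrace p x) tr0 => z z0 Hz.
apply: (Rmult_le_reg_r (b * c)) => //; rewrite /Rdiv Rmult_assoc Rinv_l; last by lra.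
have cz : 0 <= c * z by apply: Rmult_le_pos; lra.
have e1 := exp_ineq1_le (c * z).
have : exp (- (c * z)) * exp (c * z) = 1 by rewrite -exp_plus Rplus_opp_l exp_0.
have := exp_pos (- (c * z)).
move: (exp (- (c * z))) (exp (c * z)) Hz e1 => e e' Hz e1 ep ee.
have : e * (1 + c * z) <= 1 by nra.
have : b <= C * e by lra.
move=> h1 h2; have : b * (1 + c * z) <= C * (e * (1 + c * z)) by nra.
nra.
Qed.

Lemma is_lim_seq_wt k u (t : nat -> R) (Y : nat -> 'I_p -> 'I_k -> R)
    (t0 : R) (Y0 : 'I_p -> 'I_k -> R) :
  0 <= t0 -> is_lim_seq t t0 -> (forall a l, is_lim_seq (fun n => Y n a l) (Y0 a l)) ->
  is_lim_seq (fun n => wt (t n) u (gram (Y n))) (wt t0 u (gram Y0)).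
Proof.
rewrite /wt /wtr; case: (spectrum u) => [[l q] [/= oq l0 _]] t00 Ht HY.
have h i : 0 < 1 + 2 * t0 * l i by apply: one_plus_pos.
have Hd i : is_lim_seq (fun n => 1 + 2 * t n * l i) (1 + 2 * t0 * l i).
  apply: is_lim_seq_plus'; first exact: is_lim_seq_const.
  apply: is_lim_seq_mult'; last exact: is_lim_seq_const.
  by apply: is_lim_seq_mult' => //; exact: is_lim_seq_const.
apply: is_lim_seq_exp; apply: is_lim_seq_minus'.
  apply: is_lim_seq_mult'; first exact: is_lim_seq_const.
  by apply: is_lim_seq_rsum => i; apply: is_lim_seq_ln.
apply: is_lim_seq_rsum => i; apply: is_lim_seq_mult'.
  apply: is_lim_seq_div' => //; first exact: is_lim_seq_const.
  by have := h i; lra.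
apply: (is_lim_seq_ext (fun n => \rsum_(j < k) (\rsum_(a < p) (q i a * Y n a j)) ^ 2)).
  by move=> n; rewrite quad_gram.
rewrite quad_gram; apply: is_lim_seq_rsum => j /=.
have HS : is_lim_seq (fun n => \rsum_(a < p) (q i a * Y n a j)) (\rsum_(a < p) (q i a * Y0 a j)).
  apply: is_lim_seq_rsum => a.
  apply: (is_lim_seq_mult' (fun _ => q i a) (fun n => Y n a j)).
    exact: is_lim_seq_const.
  exact: HY.
apply: is_lim_seq_mult' => //; apply: is_lim_seq_mult' => //; exact: is_lim_seq_const.
Qed.

Lemma is_lim_seq_evt k g (t : nat -> R) (Y : nat -> 'I_p -> 'I_k -> R)
    (t0 : R) (Y0 : 'I_p -> 'I_k -> R) :
  0 <= t0 -> is_lim_seq t t0 -> (forall a l, is_lim_seq (fun n => Y n a l) (Y0 a l)) ->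
  is_lim_seq (fun n => evt (t n) g (gram (Y n))) (evt t0 g (gram Y0)).
Proof.
move=> t00 Ht HY; apply: is_lim_seq_rsum => a; apply: is_lim_seq_mult'.
  exact: is_lim_seq_const.
exact: is_lim_seq_wt.
Qed.

Lemma gram_entry_bound k (Y : 'I_p -> 'I_k -> R) a l : Rabs (Y a l) <= 1 + mtrace p (gram Y).
Proof.
rewrite mtrace_gram.
have h1 b : 0 <= \rsum_(j < k) Y b j ^ 2 by apply: rsum_ge0 => j _; apply: pow2_ge_0.
have h2 j : 0 <= Y a j ^ 2 by apply: pow2_ge_0.
have := Rle_trans _ _ _ (rsum_term_le l h2) (rsum_term_le a h1).
move: (\rsum_(b < p) _) => s /= H; apply: Rabs_le; nra.
Qed.

(** Parabolic maximum principle. The penalty [eta * t] makes it strict: at a maximum of [G] at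
    positive time, the time derivative is at most [- eta], so [G] would be larger slightly earlier.
    The maximum exists because combinations vanish at infinity and [B >= 0], so that values above
    [B] can be followed on a bounded set. Working with [Y] instead of [x] keeps limits in
    [Dp p k]. *)
Lemma contraction k g T B : (1 <= k <= p)%N -> admissible p alpha k -> 0 <= T -> 0 <= B ->
  (forall x, Dp p k x -> ev g x <= B) -> forall x, Dp p k x -> evt T g x <= B.
Proof.
move=> kp adm T0 B0 gB x1 D1; apply: Rnot_lt_le => bad.
have [Y1 EY1] := proj1 (Dp_gramP k x1) D1.
have Tpos : 0 < T.
  case: T0 => // E; move: bad; rewrite -E evt_0 => bad.
  by have := gB x1 D1; lra.
(* With this value, half of the excess over [B] at time [T] survives the penalty. *)
pose eta := (evt T g x1 - B) / (2 * T).
have eta0 : 0 < eta by apply: Rdiv_lt_0_compat; lra.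
pose G t (Y : 'I_p -> 'I_k -> R) := evt t g (gram Y) - eta * t.
have G1 : B < G T Y1.
  rewrite /G -EY1 (_ : eta * T = (evt T g x1 - B) / 2); first by lra.
  by rewrite /eta; field; lra.
pose E r := exists t Y, 0 <= t <= T /\ r = G t Y.
have [c [c0 dec]] := evt_decay g T0.
have ubE : bound E.
  exists (\rsum_(a <- g) Rabs a.1) => r [t [Y [tT ->]]]; rewrite /G.
  have psY := @gram_psd p k Y.
  have := dec t (gram Y) tT psY; have := Rle_abs (evt t g (gram Y)).
  have : exp (- (c * mtrace p (gram Y))) <= 1.
    rewrite -exp_0; apply: exp_le_mono.
    have : 0 <= mtrace p (gram Y) by apply: rsum_ge0 => i _; apply: psd_diag_ge0.
    by nra.
  have : 0 <= \rsum_(a <- g) Rabs a.1 by apply: rsum_ge0 => a _; apply: Rabs_pos.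
  have : 0 <= eta * t by nra.
  by move: (\rsum_(a <- g) _) (exp _) => s e; nra.
have [m [ubm lubm]] := completeness E ubE (ex_intro _ _ (ex_intro _ T
  (ex_intro _ Y1 (conj (conj T0 (Rle_refl T)) erefl)))).
have mG t Y : 0 <= t <= T -> G t Y <= m by move=> tT; apply: ubm; exists t, Y.
have mB : B < m by apply: Rlt_le_trans G1 (mG T Y1 _); lra.
(* A maximizing sequence; staying above [m / 2 > 0] confines it to a set of bounded trace. *)
have near (n : nat) : exists tY : R * ('I_p -> 'I_k -> R),
    0 <= tY.1 <= T /\ Rmax (m - / INR (S n)) (m / 2) < G tY.1 tY.2.
  apply: NNPP => no; suff : m <= Rmax (m - / INR (S n)) (m / 2).
    have : 0 < / INR (S n) by apply: Rinv_0_lt_compat; apply: lt_0_INR; lia.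
    by move=> e0; apply: Rlt_not_le; apply: Rmax_lub_lt; lra.
  apply: lubm => r [t [Y [tT ->]]]; apply: Rnot_lt_le => H.
  by apply: no; exists (t, Y).
pose sq n := proj1_sig (constructive_indefinite_description _ (near n)).
have sqP n : 0 <= (sq n).1 <= T /\ Rmax (m - / INR (S n)) (m / 2) < G (sq n).1 (sq n).2.
  exact: proj2_sig (constructive_indefinite_description _ (near n)).
have [M [M0 HM]] := @evt_superlevel T g (m / 2) T0 ltac:(lra).
(* Time ([None]) and the entries of the factor ([Some]) form one finite family, so that a single
   extraction serves both. *)
pose w n (i : option ('I_p * 'I_k)) := if i is Some j then (sq n).2 j.1 j.2 else (sq n).1.
have [|phi [lim [ephi Hlim]]] := @bolzano_weierstrass_fin _ w (T + 1 + M).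
  move=> n [[a l]|] /=; have [tT Gn] := sqP n; last by apply: Rabs_le; lra.
  apply: Rle_trans (gram_entry_bound _ _ _) _.
  suff : mtrace p (gram (sq n).2) <= M by lra.
  apply: (HM (sq n).1) => //; first exact: gram_psd.
  apply: Rle_trans (Rle_abs _); have := Rmax_r (m - / INR (S n)) (m / 2).
  have e1 : 0 <= eta * (sq n).1 by nra.
  by move: Gn; rewrite /G; lra.
pose t0 := lim None; pose Y0 a l := lim (Some (a, l)).
have t0T : 0 <= t0 <= T.
  have Ht := Hlim None; split.
    have := is_lim_seq_le (fun _ => 0) _ 0 t0 _ (is_lim_seq_const 0) Ht.
    by apply=> n; case: (sqP (phi n)) => [[]].
  have := is_lim_seq_le _ (fun _ => T) t0 T _ Ht (is_lim_seq_const T).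
  by apply=> n; case: (sqP (phi n)) => [[]].
have G0 : G t0 Y0 = m.
  apply: Rle_antisym; first exact: mG.
  have LG : is_lim_seq (fun n => G (sq (phi n)).1 (sq (phi n)).2) (G t0 Y0).
    apply: is_lim_seq_minus'.
      apply: is_lim_seq_evt => [|| a l]; first exact: (proj1 t0T).
        exact: (Hlim None).
      exact: (Hlim (Some (a, l))).
    by apply: is_lim_seq_mult'; [exact: is_lim_seq_const|exact: (Hlim None)].
  have L1 : is_lim_seq (fun n => m - / INR (S (phi n))) m.
    apply: (is_lim_seq_subseq (fun n => m - / INR (S n))); first exact: eventually_subseq.
    have {2}-> : m = m - 0 by lra.
    apply: is_lim_seq_minus'; first exact: is_lim_seq_const.
    apply: (is_lim_seq_inv _ p_infty) => //.
    exact: (proj1 (is_lim_seq_incr_1 INR p_infty) is_lim_seq_INR).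
  have := is_lim_seq_le _ _ m (G t0 Y0) _ L1 LG; apply=> n.
  have [_] := sqP (phi n); have := Rmax_l (m - / INR (S (phi n))) (m / 2); lra.
have t0pos : 0 < t0.
  case: (proj1 t0T) => // E0; move: G0; rewrite /G -E0 evt_0.
  by have := gB _ (gram_Dp Y0); lra.
(* For fixed [t0] the penalty is constant, so [gram Y0] maximizes [evt alpha t0 g] over [Dp p k]. *)
have le0 : genc alpha (flowc (proj1 t0T) g) (gram Y0) <= 0.
  apply: (genc_max_le0 kp adm (gram_Dp Y0)) => x /Dp_gramP [Y ->].
  by rewrite -!evtE; have := mG t0 Y t0T; rewrite -G0 /G; lra.
have dG : is_derive (fun s => - (evt s g (gram Y0) - eta * s)) t0
    (- (genc alpha (flowc (proj1 t0T) g) (gram Y0) - eta)).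
  apply: is_derive_opp; apply: is_derive_minus; first exact: is_derive_evt.
  by auto_derive => //; lra.
have [|d [d0 Hd]] := derive_pos_left dG; first by lra.
pose h := Rmin d t0 / 2.
have h0 : 0 < Rmin d t0 by apply: Rmin_pos.
have hd := Rmin_l d t0; have ht := Rmin_r d t0.
have := Hd h ltac:(rewrite /h; lra); rewrite -/(G t0 Y0) G0 -/(G (t0 - h) Y0).
by have := mG (t0 - h) Y0 ltac:(rewrite /h; lra); lra.
Qed.

End Contraction.

(** * Density of the exponentials in C_0 *)

Lemma is_lim_seq_oppR u (l : R) : is_lim_seq u l -> is_lim_seq (fun n => - u n) (- l).
Proof. by move/is_lim_seq_opp. Qed.

Section Density.
Variables p k : nat.
Hypotheses (p0 : (0 < p)%N) (k0 : (0 < k)%N).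
Local Notation DD := {x : rmat p | Dp p k x}.
Implicit Types (x y : rmat p).

(** Testing [x] on [e_a + e_b] and [e_a - e_b] gives [2 |x a b| <= x a a + x b b]. *)
Lemma psd_entry_le x a b : psd p x -> Rabs (x a b) <= mtrace p x.
Proof.
move=> psx; have dg i : 0 <= x i i by apply: psd_diag_ge0.
have ta := rsum_term_le a dg; have tb := rsum_term_le b dg.
have key e : e ^ 2 = 1 -> 0 <= x a a + 2 * e * x a b + x b b.
  move=> ee; have := proj2 psx (fun i => mid p a i + e * mid p b i).
  rewrite quad_shift; last exact: (proj1 psx).
  rewrite quad_mid ee rsum_deltal; lra.
have k1 := key 1 ltac:(lra); have k2 := key (-1) ltac:(lra).
by move: ta tb; rewrite /= -/(mtrace p x) => ta tb; apply: Rabs_le; lra.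
Qed.

Lemma mdist_entry x y a b : Rabs (x a b - y a b) <= mdist p x y.
Proof.
rewrite /mdist -sqrt_Rsqr_abs; apply: sqrt_le_1_alt.
have h i j : 0 <= (x i j - y i j) ^ 2 by apply: pow2_ge_0.
have h1 i : 0 <= \rsum_(j < p) (x i j - y i j) ^ 2 by apply: rsum_ge0 => j _.
apply: Rle_trans (rsum_term_le a h1); apply: Rle_trans (rsum_term_le b (h a)).
by rewrite /Rsqr; lra.
Qed.

Lemma entry_le_mnorm x a b : Rabs (x a b) <= mnorm p x.
Proof. by rewrite -[x a b]Rminus_0_r; exact: (mdist_entry x (fun _ _ => 0)). Qed.

Lemma mtrace_le_mnorm x : mtrace p x <= INR p * mnorm p x.
Proof.
have -> : INR p * mnorm p x = \rsum_(i < p) mnorm p x by rewrite rsum_const card_ord.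
by apply: rsum_le => i _; apply: Rle_trans (Rle_abs _) (entry_le_mnorm _ _ _).
Qed.

Lemma mnorm_le_mtrace x : psd p x -> mnorm p x <= INR p * mtrace p x.
Proof.
move=> psx; have tr0 : 0 <= mtrace p x by apply: rsum_ge0 => i _; apply: psd_diag_ge0.
have P0 : 0 <= INR p * mtrace p x by apply: Rmult_le_pos => //; apply: pos_INR.
rewrite /mnorm /mdist -[X in _ <= X]sqrt_Rsqr //; apply: sqrt_le_1_alt.
have -> : (INR p * mtrace p x)² = \rsum_(i < p) \rsum_(j < p) mtrace p x ^ 2.
  by rewrite !rsum_const !card_ord /Rsqr; ring.
apply: rsum_le => i _; apply: rsum_le => j _; rewrite Rminus_0_r.
by rewrite -(pow2_abs (x i j)); apply: pow_incr; split; [exact: Rabs_pos|exact: psd_entry_le].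
Qed.

(** Bounded trace bounds the Gram factors, and a limit of factors is again a factor with [k]
    columns, so the limit matrix stays in [Dp p k]. *)
Lemma Dp_seq_compact (x : nat -> rmat p) M : (forall n, Dp p k (x n)) ->
  (forall n, mtrace p (x n) <= M) ->
  exists phi (x0 : rmat p), [/\ extraction phi, Dp p k x0 &
    forall a b, is_lim_seq (fun n => x (phi n) a b) (x0 a b)].
Proof.
move=> Dx bd.
have ex n : exists Y : 'I_p -> 'I_k -> R, x n = gram Y by apply/Dp_gramP.
pose Y n := proj1_sig (constructive_indefinite_description _ (ex n)).
have YE n : x n = gram (Y n) by exact: proj2_sig (constructive_indefinite_description _ (ex n)).
have [|phi [l [ephi H]]] := @bolzano_weierstrass_fin ('I_p * 'I_k)%type
    (fun n i => Y n i.1 i.2) (1 + M).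
  move=> n [a l] /=; apply: Rle_trans (gram_entry_bound _ _ _) _; rewrite -YE.
  by have := bd n; lra.
exists phi, (gram (fun a j => l (a, j))); split=> //; first exact: gram_Dp.
move=> a b; apply: (is_lim_seq_ext (fun n => \rsum_(j < k) (Y (phi n) a j * Y (phi n) b j))).
  by move=> n; rewrite YE.
apply: is_lim_seq_rsum => j.
by apply: is_lim_seq_mult'; [exact: (H (a, j))|exact: (H (b, j))].
Qed.

Lemma C0_seq_continuous (f : fnD p (Dp p k)) (x : nat -> DD) (x0 : DD) :
  C0 p (Dp p k) f ->
  (forall a b, is_lim_seq (fun n => proj1_sig (x n) a b) (proj1_sig x0 a b)) ->
  is_lim_seq (fun n => f (x n)) (f x0).
Proof.
move=> [cf _] H; apply/is_lim_seq_spec => eps.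
have [delta [d0 Hd]] := cf x0 eps (cond_pos eps).
have : is_lim_seq (fun n => mdist p (proj1_sig x0) (proj1_sig (x n))) 0.
  have L : is_lim_seq (fun n => \rsum_(i < p) \rsum_(j < p)
      (proj1_sig x0 i j - proj1_sig (x n) i j) ^ 2)
      (\rsum_(i < p) \rsum_(j < p) (proj1_sig x0 i j - proj1_sig x0 i j) ^ 2).
    apply: is_lim_seq_rsum => i; apply: is_lim_seq_rsum => j.
    have H1 : is_lim_seq (fun n => proj1_sig x0 i j - proj1_sig (x n) i j)
                         (proj1_sig x0 i j - proj1_sig x0 i j).
      by apply: is_lim_seq_minus'; [exact: is_lim_seq_const|exact: H].
    rewrite /=; apply: is_lim_seq_mult' => //; apply: is_lim_seq_mult' => //.
    exact: is_lim_seq_const.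
  move: L; rewrite rsum0 => [L|i _]; last by rewrite rsum0 // => j _; lra.
  rewrite -[Finite 0]/(Finite (IZR 0)) -[in X in is_lim_seq _ X]sqrt_0.
  apply: (is_lim_seq_continuous sqrt) => //.
  by apply/continuity_pt_filterlim; apply: continuous_sqrt.
move/is_lim_seq_spec => /(_ (mkposreal _ d0)) [N HN]; exists N => n nN.
apply: Hd; have := HN n nN; rewrite /= Rminus_0_r; apply: Rle_lt_trans; exact: Rle_abs.
Qed.

Lemma C0_bounded (f : fnD p (Dp p k)) : C0 p (Dp p k) f ->
  exists K, 0 < K /\ forall x : DD, Rabs (f x) <= K.
Proof.
move=> Cf; apply: NNPP => no.
have ex (n : nat) : exists x : DD, INR (S n) < Rabs (f x).
  apply: NNPP => nx; apply: no; exists (INR (S n)); split.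
    by apply: lt_0_INR; lia.
  by move=> x; apply: Rnot_lt_le => H; apply: nx; exists x.
pose x n := proj1_sig (constructive_indefinite_description _ (ex n)).
have xP n : INR (S n) < Rabs (f (x n)).
  exact: proj2_sig (constructive_indefinite_description _ (ex n)).
have [M HM] := proj2 Cf 1 ltac:(lra).
have bd n : mtrace p (proj1_sig (x n)) <= INR p * M.
  apply: Rle_trans (mtrace_le_mnorm _) _; apply: Rmult_le_compat_l; first exact: pos_INR.
  apply: Rnot_lt_le => /HM H; have := xP n; rewrite S_INR; have := pos_INR n; lra.
have [phi [x0 [ephi D0 lim]]] := Dp_seq_compact (fun n => proj2_sig (x n)) bd.
have /is_lim_seq_spec /(_ (mkposreal _ Rlt_0_1)) [N HN] :=
  C0_seq_continuous (x := fun n => x (phi n)) (x0 := exist _ x0 D0) Cf lim.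
have phin n : (n <= phi n)%coq_nat by elim: n => [|n IH]; [lia|have := ephi n; lia].
have [n Hn] := INR_unbounded (1 + Rabs (f (exist _ x0 D0))).
have := HN (N + n)%coq_nat ltac:(lia); have := xP (phi (N + n)%coq_nat).
have : INR n <= INR (S (phi (N + n)%coq_nat)).
  by apply: le_INR; have := phin (N + n)%coq_nat; lia.
rewrite /=; have := Rabs_triang_inv (f (x (phi (N + n)%coq_nat))) (f (exist _ x0 D0)).
lra.
Qed.

Definition var := option ('I_p * 'I_p).

(** Matrices whose pairings with [x] determine all its entries: [tr x] for [None], [2 tr x + x a b]
    for [Some (a, b)]. The multiple 2 of the identity compensates for the indefinite symmetrized
    unit matrix. *)
Definition umat (j : var) : rmat p := fun i i' =>
  if j is Some (a, b)
  then 2 * mid p i i' + / 2 * (mid p a i * mid p b i' + mid p b i * mid p a i')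
  else mid p i i'.

Lemma mtrace_umat j x : msymmetric p x ->
  mtrace p (mmul p (umat j) x) =
  if j is Some (a, b) then 2 * mtrace p x + x a b else mtrace p x.
Proof.
move=> symx; case: j => [[a b]|]; last by rewrite [umat _]/(mid p) mul1m.
rewrite /mtrace /mmul /umat.
transitivity (\rsum_(i < p) (2 * x i i + mid p a i * (/ 2 * x b i) + mid p b i * (/ 2 * x a i))).
  apply: eq_bigr => i _.
  rewrite (eq_bigr (fun l => mid p i l * (2 * x l i) +
     mid p b l * (/ 2 * mid p a i * x l i) + mid p a l * (/ 2 * mid p b i * x l i))).
    by rewrite !rsum_add !rsum_deltal; lra.
  by move=> l _; lra.
by rewrite !rsum_add !rsum_deltal -rsum_mull (symx b a) /=; lra.
Qed.

Lemma quad_umat a b v : quad p (umat (Some (a, b))) v = 2 * (\rsum_(i < p) v i ^ 2) + v a * v b.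
Proof.
rewrite /quad /umat.
transitivity (\rsum_(i < p) (2 * v i ^ 2 + mid p a i * (/ 2 * v i * v b) +
    mid p b i * (/ 2 * v i * v a))).
  apply: eq_bigr => i _.
  rewrite (eq_bigr (fun l => mid p i l * (2 * v i * v l) +
     mid p b l * (/ 2 * mid p a i * v i * v l) + mid p a l * (/ 2 * mid p b i * v i * v l))).
    by rewrite !rsum_add !rsum_deltal; lra.
  by move=> l _; lra.
by rewrite !rsum_add !rsum_deltal -rsum_mull /=; lra.
Qed.

Lemma mid_pd : pd p (mid p).
Proof.
split; first by move=> i j; apply: midC.
move=> v /norm2_gt0; suff -> : quad p (mid p) v = \rsum_(a < p) v a ^ 2 by [].
apply: eq_bigr => i _.
rewrite (eq_bigr (fun j => mid p i j * (v i * v j))); last by move=> j _; lra.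
by rewrite rsum_deltal /=; lra.
Qed.

Lemma umat_pd j : pd p (umat j).
Proof.
case: j => [[a b]|]; last exact: mid_pd.
split; first by move=> i j; rewrite /umat (midC i j); lra.
move=> v /norm2_gt0 H; rewrite quad_umat.
have h i : 0 <= v i ^ 2 by apply: pow2_ge_0.
have ha := rsum_term_le a h; have hb := rsum_term_le b h.
move: H ha hb; move: (\rsum_(i < p) _) => s; have := pow2_ge_0 (v a + v b).
by move=> /=; nra.
Qed.

Definition uvar (j : var) : pdmat p := exist _ (umat j) (umat_pd j).

Definition psi j x := exp (- mtrace p (mmul p (umat j) x)).

Lemma psi_bounds j x : psd p x -> 0 < psi j x <= 1.
Proof.
move=> psx; split; first exact: exp_pos.
rewrite -exp_0; apply: exp_le_mono.
suff : 0 <= mtrace p (mmul p (umat j) x) by lra.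
have tr0 : 0 <= mtrace p x by apply: rsum_ge0 => i _; apply: psd_diag_ge0.
rewrite mtrace_umat; last exact: (proj1 psx).
case: j => [[a b]|] //.
have := psd_entry_le a b psx; have := Rle_abs (- x a b); rewrite Rabs_Ropp; lra.
Qed.

Lemma psi_inj x y : msymmetric p x -> msymmetric p y ->
  (forall j, psi j x = psi j y) -> x = y.
Proof.
move=> sx sy H.
have E j : mtrace p (mmul p (umat j) x) = mtrace p (mmul p (umat j) y).
  by have := exp_inv _ _ (H j); lra.
apply: mat_ext => a b; have := E (Some (a, b)); have := E None.
by rewrite !mtrace_umat //; lra.
Qed.

(** The finitely many [psi j] separate points of the cone and tend to 0 at infinity, so they embed
    the one-point compactification of [Dp p k] in a cube. The statement is uniform continuity of
    [f], extended by 0 at infinity, for the distance of the cube. *)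
Lemma C0_psi_unif (f : fnD p (Dp p k)) eps : C0 p (Dp p k) f -> 0 < eps ->
  exists delta, 0 < delta /\ forall x y : DD,
    (forall j, Rabs (psi j (proj1_sig x) - psi j (proj1_sig y)) <= delta) ->
    Rabs (f x - f y) <= eps.
Proof.
move=> Cf e0; have [M HM] := proj2 Cf (eps / 2) ltac:(lra).
pose M2 := INR p * M; pose tau := exp (- M2).
have tau0 : 0 < tau by apply: exp_pos.
have large (x : DD) : eps / 2 <= Rabs (f x) -> tau <= psi None (proj1_sig x).
  move=> fx; rewrite /psi /tau mtrace_umat; last by case: (proj2_sig x) => [[]].
  apply: exp_le_mono; suff : mtrace p (proj1_sig x) <= M2 by lra.
  apply: Rle_trans (mtrace_le_mnorm _) _; apply: Rmult_le_compat_l; first exact: pos_INR.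
  by apply: Rnot_lt_le => /HM; lra.
apply: NNPP => no.
have ex (n : nat) : exists xy : DD * DD,
    (forall j, Rabs (psi j (proj1_sig xy.1) - psi j (proj1_sig xy.2)) <=
       Rmin (tau / 2) (/ INR (S n))) /\ eps < Rabs (f xy.1 - f xy.2).
  apply: NNPP => nx; apply: no; exists (Rmin (tau / 2) (/ INR (S n))); split.
    by apply: Rmin_pos; [lra|apply: Rinv_0_lt_compat; apply: lt_0_INR; lia].
  by move=> x y H; apply: Rnot_lt_le => lt; apply: nx; exists (x, y).
pose s n := proj1_sig (constructive_indefinite_description _ (ex n)).
have sP n : (forall j, Rabs (psi j (proj1_sig (s n).1) - psi j (proj1_sig (s n).2)) <=
       Rmin (tau / 2) (/ INR (S n))) /\ eps < Rabs (f (s n).1 - f (s n).2).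
  exact: proj2_sig (constructive_indefinite_description _ (ex n)).
pose M3 := M2 + ln 2.
have small (x : DD) : tau / 2 <= psi None (proj1_sig x) -> mtrace p (proj1_sig x) <= M3.
  rewrite /psi mtrace_umat; last by case: (proj2_sig x) => [[]].
  have -> : tau / 2 = exp (- M3).
    by rewrite /M3 Ropp_plus_distr exp_plus (exp_Ropp (ln 2)) exp_ln //; lra.
  by move=> H; apply: Rnot_lt_le => lt; have := exp_increasing _ _ (Ropp_lt_contravar _ _ lt); lra.
(* The two values differ by more than [eps], so one of them exceeds [eps / 2] in absolute value.
   There [psi None] is at least [tau], and at the other point at least [tau / 2]: both points stay
   in a bounded set. *)
have bd n : tau / 2 <= psi None (proj1_sig (s n).1) /\ tau / 2 <= psi None (proj1_sig (s n).2).
  have [/(_ None) H1 H2] := sP n.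
  have := Rle_trans _ _ _ H1 (Rmin_l _ _) => H3.
  have := Rle_abs (psi None (proj1_sig (s n).1) - psi None (proj1_sig (s n).2)).
  have := Rle_abs (- (psi None (proj1_sig (s n).1) - psi None (proj1_sig (s n).2))).
  rewrite Rabs_Ropp => h1 h2.
  case: (Rle_lt_dec (eps / 2) (Rabs (f (s n).1))) => [/large|l1]; first by lra.
  case: (Rle_lt_dec (eps / 2) (Rabs (f (s n).2))) => [/large|l2]; first by lra.
  have := Rabs_triang (f (s n).1) (- f (s n).2); rewrite Rabs_Ropp.
  by rewrite -/(f (s n).1 - f (s n).2); lra.
have [phi [x0 [ephi D0 lim]]] := Dp_seq_compact (fun n => proj2_sig (s n).1)
  (fun n => small _ (proj1 (bd n))).
have [psi' [y0 [epsi D1 lim2]]] := Dp_seq_compact (fun n => proj2_sig (s (phi n)).2)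
  (fun n => small _ (proj2 (bd (phi n)))).
have lim1 a b : is_lim_seq (fun n => proj1_sig (s (phi (psi' n))).1 a b) (x0 a b).
  by apply: (is_lim_seq_subseq (fun n => proj1_sig (s (phi n)).1 a b));
    [exact: eventually_subseq|exact: lim].
have phin n : (n <= phi n)%coq_nat by elim: n => [|n IH]; [lia|have := ephi n; lia].
have psin n : (n <= psi' n)%coq_nat by elim: n => [|n IH]; [lia|have := epsi n; lia].
have lpsi (z : nat -> rmat p) (z0 : rmat p) j :
    (forall a b, is_lim_seq (fun n => z n a b) (z0 a b)) ->
    is_lim_seq (fun n => psi j (z n)) (psi j z0).
  move=> Hz; apply: is_lim_seq_exp; apply: is_lim_seq_oppR.
  apply: is_lim_seq_rsum => i; apply: is_lim_seq_rsum => l.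
  apply: (is_lim_seq_mult' (fun _ => umat j i l) (fun n => z n l i)).
    exact: is_lim_seq_const.
  exact: Hz.
have E : x0 = y0.
  apply: psi_inj; [by case: D0 => [[]]|by case: D1 => [[]]|] => j.
  have L := is_lim_seq_minus' _ _ _ _ (lpsi _ _ j lim1) (lpsi _ _ j lim2).
  have L0 : is_lim_seq (fun n => psi j (proj1_sig (s (phi (psi' n))).1) -
                               psi j (proj1_sig (s (phi (psi' n))).2)) 0.
    apply: (is_lim_seq_le_le (fun n => - / INR (S n)) _ (fun n => / INR (S n))).
    - move=> n; have [/(_ j) H _] := sP (phi (psi' n)).
      have := Rle_trans _ _ _ H (Rmin_r _ _) => {}H.
      have : / INR (S (phi (psi' n))) <= / INR (S n).
        apply: Rinv_le_contravar; first by apply: lt_0_INR; lia.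
        by apply: le_INR; have := phin (psi' n); have := psin n; lia.
      by move=> h; apply/Rabs_le_between; exact: Rle_trans H h.
    - have -> : 0 = - 0 by lra.
      apply: is_lim_seq_oppR; apply: (is_lim_seq_inv _ p_infty) => //.
      exact: (proj1 (is_lim_seq_incr_1 INR p_infty) is_lim_seq_INR).
    - apply: (is_lim_seq_inv _ p_infty) => //.
      exact: (proj1 (is_lim_seq_incr_1 INR p_infty) is_lim_seq_INR).
  have [] : Finite (psi j x0 - psi j y0) = Finite 0.
    by rewrite -(is_lim_seq_unique _ _ L) -(is_lim_seq_unique _ _ L0).
  lra.
subst y0.
have F1 := C0_seq_continuous (x := fun n => (s (phi (psi' n))).1) (x0 := exist _ x0 D0) Cf lim1.
have F2 := C0_seq_continuous (x := fun n => (s (phi (psi' n))).2) (x0 := exist _ x0 D0) Cf lim2.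
have := is_lim_seq_minus' _ _ _ _ F1 F2; rewrite Rminus_diag.
move/is_lim_seq_spec => /(_ (mkposreal _ e0)) [N /(_ N (Nat.le_refl N))].
by rewrite /= Rminus_0_r; have [_] := sP (phi (psi' N)); lra.
Qed.

End Density.

(** * Bernstein approximation by exponentials *)

Section Bernstein.
Variables p k : nat.
Hypotheses (p0 : (0 < p)%N) (k0 : (0 < k)%N).
Local Notation DD := {x : rmat p | Dp p k x}.
Implicit Types x : rmat p.

(* The constants have to be adjoined, as [f_u] is only considered for positive definite [u]. *)
Definition expalg (h : rmat p -> R) := exists r (g : comb p), forall x, h x = r + ev g x.

Lemma ev_cat (g g' : comb p) x : ev (g ++ g') x = ev g x + ev g' x.
Proof. by rewrite /ev big_cat. Qed.

Definition scalec c (g : comb p) : comb p := [seq (c * a.1, a.2) | a <- g].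

Lemma ev_scale c (g : comb p) x : ev (scalec c g) x = c * ev g x.
Proof. by rewrite /ev big_map rsum_mull; apply: eq_bigr => a _; rewrite /mu /=; lra. Qed.

Lemma pd_add (u v : rmat p) : pd p u -> pd p v -> pd p (madd p u v).
Proof.
move=> [su pu] [sv pv]; split; first by move=> i j; rewrite /madd su sv.
move=> w w0; have := pu w w0; have := pv w w0.
suff -> : quad p (madd p u v) w = quad p u w + quad p v w by lra.
rewrite /quad -rsum_add; apply: eq_bigr => i _.
by rewrite -rsum_add; apply: eq_bigr => j _; rewrite /madd; lra.
Qed.

Lemma mtrace_madd_mul (u v x : rmat p) : mtrace p (mmul p (madd p u v) x) =
  mtrace p (mmul p u x) + mtrace p (mmul p v x).
Proof.
rewrite /mtrace -rsum_add; apply: eq_bigr => i _.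
by rewrite /mmul -rsum_add; apply: eq_bigr => j _; rewrite /madd; lra.
Qed.

Definition mulc (g g' : comb p) : comb p := [seq (a.1 * b.1,
  exist _ (madd p (mu a) (mu b)) (pd_add (mu_pd a) (mu_pd b)) : pdmat p) | a <- g, b <- g'].

Lemma ev_mul (g g' : comb p) x : ev (mulc g g') x = ev g x * ev g' x.
Proof.
rewrite /ev /mulc big_allpairs_dep rsum_mulr; apply: eq_bigr => a _.
rewrite rsum_mull; apply: eq_bigr => b _.
by rewrite /= {1}/mu /= mtrace_madd_mul Ropp_plus_distr exp_plus; lra.
Qed.

Lemma expalg_const c : expalg (fun _ => c).
Proof. by exists c, [::] => x; rewrite /ev big_nil; lra. Qed.

Lemma expalg_psi j : expalg (psi j).
Proof. by exists 0, [:: (1, uvar j)] => x; rewrite /ev big_cons big_nil /mu /= /psi; lra. Qed.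

Lemma expalg_add h h' : expalg h -> expalg h' -> expalg (fun x => h x + h' x).
Proof.
move=> [r [g H]] [r' [g' H']]; exists (r + r'), (g ++ g') => x.
by rewrite ev_cat H H'; lra.
Qed.

Lemma expalg_mul h h' : expalg h -> expalg h' -> expalg (fun x => h x * h' x).
Proof.
move=> [r [g H]] [r' [g' H']].
exists (r * r'), (scalec r g' ++ (scalec r' g ++ mulc g g')) => x.
by rewrite !ev_cat !ev_scale ev_mul H H'; lra.
Qed.

(* Expectation of [h] applied to the numbers of successes in independent trials, one for
   each letter [j] of the word, with success probability [psi j x]. *)
Fixpoint bern (w : seq (var p)) (h : (var p -> nat) -> R) x : R :=
  if w is j :: w' then
    (1 + -1 * psi j x) * bern w' h x +
    psi j x * bern w' (fun c => h (fun i => (c i + (i == j))%N)) x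
  else h (fun _ => O).

Lemma bern_expalg w h : expalg (bern w h).
Proof.
elim: w h => [|j w IH] h; first exact: expalg_const.
apply: expalg_add; apply: expalg_mul => //; last exact: expalg_psi.
apply: expalg_add; first exact: expalg_const.
apply: expalg_mul; [exact: expalg_const|exact: expalg_psi].
Qed.

Lemma bern_le w h h' x : psd p x -> (forall c, h c <= h' c) -> bern w h x <= bern w h' x.
Proof.
move=> psx; elim: w h h' => [|j w IH] h h' H /=; first exact: H.
have [b0 b1] := psi_bounds j psx.
have := IH _ _ H; have := IH _ _ (fun c => H (fun i => (c i + (i == j))%N)).
by move=> h1 h2; apply: Rplus_le_compat; apply: Rmult_le_compat_l => //; lra.
Qed.

Lemma bern_lin w h h' a b x :
  bern w (fun c => a * h c + b * h' c) x = a * bern w h x + b * bern w h' x.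
Proof. by elim: w h h' => [//|j w IH] h h' /=; rewrite !IH; lra. Qed.

Lemma bern_cst w a x : bern w (fun _ => a) x = a.
Proof. by elim: w => [//|j w IH] /=; rewrite !IH; lra. Qed.

Lemma bern_rsum I (r : seq I) w (h : I -> (var p -> nat) -> R) x :
  bern w (fun c => \rsum_(i <- r) h i c) x = \rsum_(i <- r) bern w (h i) x.
Proof.
elim: w h => [//|j w IH] h /=.
by rewrite !IH !rsum_mull -rsum_add.
Qed.

(** The shift [a] is arbitrary so that a success at the head letter can be absorbed in it during the
    induction. The second summand is the binomial variance. *)
Lemma bern_second_moment w j a x :
  bern w (fun c => (INR (c j) + a) ^ 2) x =
  (INR (count_mem j w) * psi j x + a) ^ 2 +
  INR (count_mem j w) * (psi j x * (1 - psi j x)).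
Proof.
elim: w a => [|i w IH] a; first by rewrite /=; lra.
rewrite [LHS]/= -/(bern w (fun c => (INR (c j) + a) ^ 2) x) IH.
have -> : (fun c : var p -> nat => (INR (c j + (j == i)) + a) * ((INR (c j + (j == i)) + a) * 1)) =
          (fun c => (INR (c j) + (INR (j == i) + a)) ^ 2).
  by apply: functional_extensionality => c; rewrite -plusE plus_INR; lra.
rewrite IH [count_mem j (i :: w)]/= -plusE plus_INR (eq_sym i j).
by case: eqP => [->|_] /=; lra.
Qed.

Lemma count_flatten_nseq (n : nat) (j : var p) :
  count_mem j (flatten (nseq n (enum {: var p}))) = n.
Proof.
elim: n => [//|n IH] /=; rewrite count_cat IH -add1n; congr addn.
by rewrite count_uniq_mem ?enum_uniq // mem_enum.
Qed.

Lemma bern_variance n j x : psd p x -> (0 < n)%N ->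
  bern (flatten (nseq n (enum {: var p}))) (fun c => (INR (c j) / INR n - psi j x) ^ 2) x
  <= / INR n.
Proof.
move=> psx n0; have n0' : 0 < INR n by apply: lt_0_INR; apply/ltP.
have -> : (fun c : var p -> nat => (INR (c j) / INR n - psi j x) ^ 2) = (fun c =>
    (/ INR n) ^ 2 * (INR (c j) + (- (INR n * psi j x))) ^ 2 +
    0 * (INR (c j) + (- (INR n * psi j x))) ^ 2).
  by apply: functional_extensionality => c; field; lra.
rewrite bern_lin bern_second_moment count_flatten_nseq.
have [b0 b1] := psi_bounds j psx.
have -> : (/ INR n) ^ 2 * ((INR n * psi j x + - (INR n * psi j x)) ^ 2 +
  INR n * (psi j x * (1 - psi j x))) + 0 * ((INR n * psi j x + - (INR n * psi j x)) ^ 2 +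
  INR n * (psi j x * (1 - psi j x))) = / INR n * (psi j x * (1 - psi j x)) by field; lra.
rewrite -[X in _ <= X]Rmult_1_r; apply: Rmult_le_compat_l; last by nra.
by apply: Rlt_le; apply: Rinv_0_lt_compat.
Qed.

(** Chebyshev's argument. [f] lives only on the image of [Dp p k] in the cube, so a grid point gets
    the value of [f] at some nearby point of the image, and 0 if there is none. The bound [K] and
    the estimate [hnear] are all that is asked of this extension. *)
Lemma bernstein_approx (f : fnD p (Dp p k)) eps : C0 p (Dp p k) f -> 0 < eps ->
  exists h, expalg h /\ forall x : DD, Rabs (h (proj1_sig x) - f x) <= eps.
Proof.
move=> Cf e0; have [K [K0 HK]] := C0_bounded Cf.
have [d2 [d20 Hd]] := C0_psi_unif Cf (ltac:(lra) : 0 < eps / 2).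
(* Half of [d2], because two points near the same grid point are then within [d2] of each other. *)
pose d := d2 / 2; have d0 : 0 < d by rewrite /d; lra.
pose N := INR #|{: var p}|.
have N0 : 0 <= N by apply: pos_INR.
have [n0 Hn0] := INR_unbounded (2 * (2 * K / d ^ 2 * N) / eps).
pose n := n0.+1.
have n0' : 0 < INR n by apply: lt_0_INR; rewrite /n; lia.
have Hn : 2 * K / d ^ 2 * N * / INR n <= eps / 2.
  apply: (Rmult_le_reg_r (INR n)) => //.
  rewrite Rmult_assoc Rinv_l ?Rmult_1_r; last by lra.
  have : 2 * (2 * K / d ^ 2 * N) / eps <= INR n by rewrite /n S_INR; lra.
  move: (2 * K / d ^ 2 * N) => z Hz; apply: (Rmult_le_reg_r (2 / eps)).
    by apply: Rdiv_lt_0_compat; lra.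
  have -> : eps / 2 * INR n * (2 / eps) = INR n by field; lra.
  by have -> : z * (2 / eps) = 2 * z / eps by field; lra.
pose near (c : var p -> nat) (y : DD) :=
  forall j, Rabs (INR (c j) / INR n - psi j (proj1_sig y)) <= d.
pose h0 c : R := epsilon (inhabits 0) (fun r => exists2 y, near c y & r = f y).
pose h c : R := if excluded_middle_informative (exists y, near c y) then h0 c else 0.
have hK c : Rabs (h c) <= K.
  rewrite /h /h0; case: (excluded_middle_informative _) => [[y Hy]|no]; last by rewrite Rabs_R0; lra.
  have [y' _ ->] := epsilon_spec (inhabits 0) (fun r => exists2 y, near c y & r = f y)
    (ex_intro _ (f y) (ex_intro2 _ _ y Hy erefl)).
  exact: HK.
have hnear c (x : DD) : near c x -> Rabs (h c - f x) <= eps / 2.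
  move=> Hx; rewrite /h /h0; case: (excluded_middle_informative _) => [yes|no]; last by case: no; exists x.
  have [y Hy ->] := epsilon_spec (inhabits 0) (fun r => exists2 y, near c y & r = f y)
    (ex_intro _ (f x) (ex_intro2 _ _ x Hx erefl)).
  apply: Hd => j; have := Hx j; have := Hy j => h1 h2.
  have := Rabs_triang (- (INR (c j) / INR n - psi j (proj1_sig y)))
    (INR (c j) / INR n - psi j (proj1_sig x)).
  rewrite Rabs_Ropp; have -> : - (INR (c j) / INR n - psi j (proj1_sig y)) +
    (INR (c j) / INR n - psi j (proj1_sig x)) = psi j (proj1_sig y) - psi j (proj1_sig x) by lra.
  by rewrite /d in h1 h2; lra.
pose w := flatten (nseq n (enum {: var p})).
exists (bern w h); split; first exact: bern_expalg.
move=> x; have psx := proj1 (proj2_sig x).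
pose X := proj1_sig x; rewrite -/X in psx *.
pose q c := \big[Rplus/0]_(j : var p) (INR (c j) / INR n - psi j X) ^ 2.
have q0 c j : 0 <= (INR (c j) / INR n - psi j X) ^ 2 by apply: pow2_ge_0.
(* Far from the grid point the error is at most [2 * K], and some coordinate deviates by more than
   [d], so [q c] is at least [d ^ 2]. *)
have dev c : Rabs (h c - f x) <= 1 * (eps / 2) + 2 * K / d ^ 2 * q c.
  have Kd : 0 < 2 * K / d ^ 2 by apply: Rdiv_lt_0_compat; [lra|apply: pow2_gt_0; lra].
  have qc : 0 <= q c by apply: rsum_ge0 => j _; apply: q0.
  case: (classic (near c x)) => [/hnear|nn]; first by nra.
  have [j /Rnot_le_lt Hj] := not_all_ex_not _ _ nn.
  have dq : d ^ 2 <= q c.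
    apply: Rle_trans (rsum_term_le j (q0 c)).
    by rewrite -(pow2_abs (_ - _)); apply: pow_incr; rewrite /X; lra.
  have : 2 * K <= 2 * K / d ^ 2 * q c.
    have {1}-> : 2 * K = 2 * K / d ^ 2 * d ^ 2 by field; lra.
    by apply: Rmult_le_compat_l; lra.
  have := Rabs_triang (h c) (- f x); rewrite Rabs_Ropp -/(h c - f x).
  by have := hK c; have := HK x; lra.
have Eq : bern w (fun c => 1 * (eps / 2) + 2 * K / d ^ 2 * q c) X <= eps.
  rewrite bern_lin bern_cst bern_rsum.
  have : \big[Rplus/0]_(j : var p) bern w (fun c => (INR (c j) / INR n - psi j X) ^ 2) X
     <= N * / INR n.
    by rewrite /N -rsum_const; apply: rsum_le => j _; apply: bern_variance.
  have : 0 <= 2 * K / d ^ 2.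
    by apply: Rmult_le_pos; [lra|apply: Rlt_le; apply: Rinv_0_lt_compat; apply: pow2_gt_0; lra].
  move: Hn; move: (2 * K / d ^ 2) (\big[Rplus/0]_(j : var p) _) => A S HA A0 HS.
  by have := Rmult_le_compat_l _ _ _ A0 HS; lra.
have E1 : bern w (fun c => 1 * h c + -1 * f x) X = bern w h X - f x.
  by rewrite bern_lin bern_cst; lra.
have E2 : bern w (fun c => -1 * h c + 1 * f x) X = f x - bern w h X.
  by rewrite bern_lin bern_cst; lra.
apply: Rabs_le; split.
  suff : f x - bern w h X <= eps by lra.
  rewrite -E2; apply: Rle_trans Eq; apply: bern_le => // c.
  by apply: Rle_trans (dev c); have := Rle_abs (- (h c - f x)); rewrite Rabs_Ropp; lra.
rewrite -E1; apply: Rle_trans Eq; apply: bern_le => // c.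
by apply: Rle_trans (dev c); have := Rle_abs (h c - f x); lra.
Qed.

Lemma Dp_unbounded M : exists x : DD, M < mtrace p (proj1_sig x) /\ M < mnorm p (proj1_sig x).
Proof.
pose s := Rabs M + 1; have s0 : 0 < s by have := Rabs_pos M; rewrite /s; lra.
have sM : M < s by have := Rle_abs M; rewrite /s; lra.
pose i0 : 'I_p := Ordinal p0; pose l0 : 'I_k := Ordinal k0.
pose Y (a : 'I_p) (l : 'I_k) := mid p i0 a * (mid k l0 l * sqrt s).
have E a b : gram Y a b = mid p i0 a * mid p i0 b * s.
  rewrite /gram /Y (eq_bigr (fun l => mid k l0 l * (mid k l0 l * (mid p i0 a * mid p i0 b *
     (sqrt s * sqrt s))))); last by move=> l _; lra.
  by rewrite rsum_deltal /mid eqxx sqrt_sqrt; lra.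
exists (exist _ (gram Y) (gram_Dp Y)); rewrite /=; split.
  rewrite /mtrace; under eq_bigr => i _ do rewrite E Rmult_assoc.
  by rewrite rsum_deltal /mid eqxx; lra.
apply: Rlt_le_trans (entry_le_mnorm (gram Y) i0 i0).
by rewrite E /mid eqxx Rabs_right; lra.
Qed.

Lemma ev_small (g : comb p) eps : 0 < eps ->
  exists M, forall x, psd p x -> M < mtrace p x -> Rabs (ev g x) < eps.
Proof.
move=> e0; have [M [_ H]] := @evt_superlevel p 0 (Rle_refl 0) 0 g eps (Rle_refl 0) e0.
exists M => x psx Mx; apply: Rnot_le_lt => ge.
have := H 0 x ltac:(lra) psx; rewrite evt_0 => /(_ ge); lra.
Qed.

(** The constant [r] of the Bernstein approximation is itself small, as [f] and [ev g] vanish at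
    infinity and [Dp p k] is unbounded; dropping it costs at most [3 * (eps / 4)]. *)
Theorem exp_dense (f : fnD p (Dp p k)) eps : C0 p (Dp p k) f -> 0 < eps ->
  exists g : comb p, forall x : DD, Rabs (f x - ev g (proj1_sig x)) <= eps.
Proof.
move=> Cf e0; have [h [[r [g Hg]] Hh]] := bernstein_approx Cf (ltac:(lra) : 0 < eps / 4).
have rs : Rabs r <= 3 * (eps / 4).
  have [M1 H1] := ev_small g (ltac:(lra) : 0 < eps / 4).
  have [M2 H2] := proj2 Cf (eps / 4) ltac:(lra).
  have [x [T1 T2]] := Dp_unbounded (Rmax M1 M2).
  have F := H2 x (Rle_lt_trans _ _ _ (Rmax_r M1 M2) T2).
  have G := H1 _ (proj1 (proj2_sig x)) (Rle_lt_trans _ _ _ (Rmax_l M1 M2) T1).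
  have := Hh x; rewrite Hg => A.
  have -> : r = (r + ev g (proj1_sig x) - f x) + (f x + - ev g (proj1_sig x)) by lra.
  apply: Rle_trans (Rabs_triang _ _) _.
  by have := Rabs_triang (f x) (- ev g (proj1_sig x)); rewrite Rabs_Ropp; lra.
exists g => x; have := Hh x; rewrite Hg => A.
have -> : f x - ev g (proj1_sig x) = - (r + ev g (proj1_sig x) - f x) + r by lra.
by apply: Rle_trans (Rabs_triang _ _) _; rewrite Rabs_Ropp; lra.
Qed.

End Bernstein.

(** * Construction of the semigroup *)

Lemma exp_opp_lipschitz a b : 0 <= a -> 0 <= b -> Rabs (exp (- a) - exp (- b)) <= Rabs (a - b).
Proof.
have key c d : 0 <= c -> c <= d -> 0 <= exp (- c) - exp (- d) <= d - c.
  move=> c0 cd; split; first by have := exp_le_mono (Ropp_le_contravar _ _ cd); lra.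
  have -> : - d = - c + - (d - c) by lra.
  rewrite exp_plus; have := exp_ineq1_le (- (d - c)).
  have : exp (- c) <= 1 by rewrite -exp_0; apply: exp_le_mono; lra.
  have := exp_pos (- c); move: (exp (- c)) (exp (- (d - c))) => e e'; nra.
move=> a0 b0; case: (Rle_lt_dec a b) => [ab|ba].
  have := key a b a0 ab => H; rewrite Rabs_right; last by lra.
  by rewrite Rabs_left1; lra.
have := key b a b0 (Rlt_le _ _ ba) => H; rewrite Rabs_left1; last by lra.
by rewrite Rabs_right; lra.
Qed.

Section Construction.
Variables (p k : nat) (alpha : R).
Hypotheses (kp : (1 <= k <= p)%N) (adm : admissible p alpha k) (alpha0 : 0 <= alpha).
Local Notation DD := {x : rmat p | Dp p k x}.
Implicit Types (g : comb p) (f : fnD p (Dp p k)).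

Let k0 : (0 < k)%N. Proof. by case/andP: kp. Qed.
Let p0 : (0 < p)%N. Proof. by case/andP: kp => *; apply: (@leq_trans k). Qed.

Lemma evt_cat t g g' x : evt alpha t (g ++ g') x = evt alpha t g x + evt alpha t g' x.
Proof. by rewrite /evt big_cat. Qed.

Lemma evt_scale t c g x : evt alpha t (scalec c g) x = c * evt alpha t g x.
Proof. by rewrite /evt big_map rsum_mull; apply: eq_bigr => a _; rewrite /=; lra. Qed.

Definition close f g e := forall x : DD, Rabs (f x - ev g (proj1_sig x)) <= e.

Lemma evt_le t f g e B (x : DD) : 0 <= t -> close f g e -> 0 <= B + e ->
  (forall y, f y <= B) -> evt alpha t g (proj1_sig x) <= B + e.
Proof.
move=> t0 fg Be fB; apply: (contraction alpha0 kp adm t0 Be); last exact: (proj2_sig x).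
move=> y Dy; have := fg (exist _ y Dy); have := fB (exist _ y Dy).
by move=> h1 /Rabs_le_between /=; lra.
Qed.

Lemma close_lin f f' g g' a b e e' : close f g e -> close f' g' e' ->
  close (fun y => a * f y + b * f' y) (scalec a g ++ scalec b g') (Rabs a * e + Rabs b * e').
Proof.
move=> H H' x; rewrite ev_cat !ev_scale.
have -> : a * f x + b * f' x - (a * ev g (proj1_sig x) + b * ev g' (proj1_sig x)) =
  a * (f x - ev g (proj1_sig x)) + b * (f' x - ev g' (proj1_sig x)) by lra.
apply: Rle_trans (Rabs_triang _ _) _; rewrite !Rabs_mult.
by apply: Rplus_le_compat; apply: Rmult_le_compat_l; try exact: Rabs_pos.
Qed.

Lemma close_ge0 f g e : close f g e -> 0 <= e.
Proof.
have [x _] := @Dp_unbounded p k p0 k0 0.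
by move=> /(_ x); have := Rabs_pos (f x - ev g (proj1_sig x)); lra.
Qed.

(** The difference of the two combinations approximates [f - f = 0] within [e + e'], and the
    contraction estimate preserves this bound. *)
Lemma evt_close t f g g' e e' (x : DD) : 0 <= t -> close f g e -> close f g' e' ->
  evt alpha t g (proj1_sig x) <= evt alpha t g' (proj1_sig x) + (e + e').
Proof.
move=> t0 H H'; have := close_lin 1 (-1) H H'.
have := close_ge0 H; have := close_ge0 H' => e0 e0'.
rewrite Rabs_R1 Rabs_Ropp Rabs_R1 !Rmult_1_l => H2.
have := @evt_le t _ _ _ 0 x t0 H2; rewrite Rplus_0_l evt_cat !evt_scale.
by move=> h; suff : 1 * evt alpha t g (proj1_sig x) + -1 * evt alpha t g' (proj1_sig x) <= e + e';
  [lra|apply: h => [|y]; lra].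
Qed.

(** The value of [P_t f] at [x], constrained by all approximations of [f] at once. Error bounds then
    transfer unchanged, including the case [e = 0]. *)
Definition limit_spec t f (x : DD) r :=
  forall g e, close f g e -> Rabs (evt alpha t g (proj1_sig x) - r) <= e.

(** By [evt_close] every lower bound [evt g - e] lies below every upper bound [evt g' + e'], and the
    supremum of the lower bounds separates them. Density makes the set nonempty. *)
Lemma limit_exists t f x : 0 <= t -> C0 p (Dp p k) f -> exists r, limit_spec t f x r.
Proof.
move=> t0 Cf; pose E z := exists g e, close f g e /\ z = evt alpha t g (proj1_sig x) - e.
have [g1 H1] := exp_dense p0 k0 Cf Rlt_0_1.
have [||r [ub lub]] := completeness E.
- exists (evt alpha t g1 (proj1_sig x) + 1) => z [g [e [H ->]]].
  by have := evt_close x t0 H H1; lra.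
- by exists (evt alpha t g1 (proj1_sig x) - 1), g1, 1.
exists r => g e H; apply: Rabs_le; split.
  suff : r <= evt alpha t g (proj1_sig x) + e by lra.
  by apply: lub => z [g' [e' [H' ->]]]; have := evt_close x t0 H' H; lra.
suff : evt alpha t g (proj1_sig x) - e <= r by lra.
by apply: ub; exists g, e.
Qed.

Definition wsg t f : fnD p (Dp p k) := fun x => epsilon (inhabits 0) (limit_spec t f x).

Lemma wsgP t f x : 0 <= t -> C0 p (Dp p k) f -> limit_spec t f x (wsg t f x).
Proof. by move=> t0 Cf; apply: epsilon_spec; apply: limit_exists. Qed.

Lemma mtrace_pd_psd_ge0 (u : pdmat p) x : psd p x -> 0 <= mtrace p (mmul p (proj1_sig u) x).
Proof.
have [l [q [oq l0 ->]]] := pd_spec (proj2_sig u).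
move=> psx; rewrite mtrace_mulC mtrace_mul_spec; apply: rsum_ge0 => i _.
by apply: Rmult_le_pos; [exact: Rlt_le|exact: (proj2 psx)].
Qed.

Lemma ev_lipschitz g : exists L, 0 <= L /\ forall x y, psd p x -> psd p y ->
  Rabs (ev g x - ev g y) <= L * mdist p x y.
Proof.
elim: g => [|a g [L [L0 IH]]].
  by exists 0; split=> [|x y _ _]; [lra|rewrite /ev !big_nil Rminus_diag Rabs_R0; lra].
pose K := \rsum_(i < p) \rsum_(j < p) Rabs (mu a i j).
have K0 : 0 <= K by apply: rsum_ge0 => i _; apply: rsum_ge0 => j _; apply: Rabs_pos.
have aK : 0 <= Rabs a.1 * K by apply: Rmult_le_pos => //; apply: Rabs_pos.
exists (Rabs a.1 * K + L); split=> [|x y psx psy]; first by lra.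
rewrite /ev !big_cons -!/(ev g _).
set A := exp _; set B := exp _.
have -> : a.1 * A + ev g x - (a.1 * B + ev g y) = a.1 * (A - B) + (ev g x - ev g y) by lra.
apply: Rle_trans (Rabs_triang _ _) _; rewrite Rmult_plus_distr_r.
apply: Rplus_le_compat; last exact: IH.
rewrite Rabs_mult Rmult_assoc; apply: Rmult_le_compat_l; first exact: Rabs_pos.
apply: Rle_trans (exp_opp_lipschitz _ _) _; try exact: mtrace_pd_psd_ge0.
rewrite /mtrace -rsum_sub; apply: Rle_trans (rsum_abs _ _ _) _.
rewrite /K rsum_mulr; apply: rsum_le => i _.
rewrite /mmul -rsum_sub; apply: Rle_trans (rsum_abs _ _ _) _.
rewrite rsum_mulr; apply: rsum_le => j _.
have -> : mu a i j * x j i - mu a i j * y j i = mu a i j * (x j i - y j i) by lra.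
by rewrite Rabs_mult; apply: Rmult_le_compat_l; [exact: Rabs_pos|exact: mdist_entry].
Qed.

Lemma ev_C0 g : C0 p (Dp p k) (fun x : DD => ev g (proj1_sig x)).
Proof.
split=> [x eps e0|eps e0].
  have [L [L0 H]] := ev_lipschitz g; exists (eps / (L + 1)); split.
    by apply: Rdiv_lt_0_compat; lra.
  move=> y xy; have := H _ _ (proj1 (proj2_sig x)) (proj1 (proj2_sig y)).
  rewrite Rabs_minus_sym => h; apply: Rle_lt_trans h _.
  have : (L + 1) * mdist p (proj1_sig x) (proj1_sig y) < eps.
    have := Rmult_lt_compat_l (L + 1) _ _ ltac:(lra) xy.
    by have -> : (L + 1) * (eps / (L + 1)) = eps by field; lra.
  by have := sqrt_pos (\rsum_(i < p) \rsum_(j < p) (proj1_sig x i j - proj1_sig y i j) ^ 2);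
    rewrite -/(mdist p (proj1_sig x) (proj1_sig y)); lra.
have [M H] := ev_small g e0; exists (INR p * M) => x Mx.
have psx := proj1 (proj2_sig x); apply: H => //.
have P0 : 0 < INR p by apply: lt_0_INR; apply/ltP.
apply: (Rmult_lt_reg_l (INR p)) => //.
exact: Rlt_le_trans Mx (mnorm_le_mtrace psx).
Qed.

Lemma C0_unif_limit f : (forall e, 0 < e -> exists h, C0 p (Dp p k) h /\
  forall x, Rabs (f x - h x) <= e) -> C0 p (Dp p k) f.
Proof.
move=> H; split=> [x eps e0|eps e0].
  have [h [[ch _] fh]] := H (eps / 4) ltac:(lra).
  have [d [d0 Hd]] := ch x (eps / 4) ltac:(lra).
  exists d; split=> // y xy; have := Hd y xy; have := fh x; have := fh y.
  rewrite (Rabs_minus_sym (f x)) => h1 h2 h3.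
  have -> : f y - f x = (f y - h y) + ((h y - h x) + (h x - f x)) by lra.
  apply: Rle_lt_trans (Rabs_triang _ _) _.
  by have := Rabs_triang (h y - h x) (h x - f x); lra.
have [h [[_ ch] fh]] := H (eps / 4) ltac:(lra).
have [M HM] := ch (eps / 4) ltac:(lra); exists M => x Mx.
have -> : f x = (f x - h x) + h x by lra.
apply: Rle_lt_trans (Rabs_triang _ _) _.
by have := fh x; have := HM x Mx; lra.
Qed.

(** An evolved combination approximates [wsg t f] with unchanged error; the semigroup law and
    membership in [C0] both rest on this. *)
Lemma wsg_close t (t0 : 0 <= t) f g e : C0 p (Dp p k) f -> close f g e ->
  close (wsg t f) (flowc alpha t0 g) e.
Proof.
by move=> Cf H x; rewrite -evtE Rabs_minus_sym; apply: wsgP.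
Qed.

Lemma wsg_C0 t f : 0 <= t -> C0 p (Dp p k) f -> C0 p (Dp p k) (wsg t f).
Proof.
move=> t0 Cf; apply: C0_unif_limit => e e0.
have [g H] := exp_dense p0 k0 Cf e0.
exists (fun x => ev (flowc alpha t0 g) (proj1_sig x)); split; first exact: ev_C0.
exact: wsg_close.
Qed.

Lemma C0_lin f f' a b : C0 p (Dp p k) f -> C0 p (Dp p k) f' ->
  C0 p (Dp p k) (fun y => a * f y + b * f' y).
Proof.
move=> Cf Cf'; apply: C0_unif_limit => e e0.
pose d := e / (Rabs a + Rabs b + 1).
have D0 : 0 < Rabs a + Rabs b + 1 by have := Rabs_pos a; have := Rabs_pos b; lra.
have d0 : 0 < d by apply: Rdiv_lt_0_compat.
have [g H] := exp_dense p0 k0 Cf d0; have [g' H'] := exp_dense p0 k0 Cf' d0.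
exists (fun x => ev (scalec a g ++ scalec b g') (proj1_sig x)); split; first exact: ev_C0.
move=> x; apply: Rle_trans (close_lin a b H H' x) _.
have -> : e = (Rabs a + Rabs b + 1) * d by rewrite /d; field; lra.
by lra.
Qed.

Lemma evt_flowc t s (s0 : 0 <= s) g x : 0 <= t ->
  evt alpha t (flowc alpha s0 g) x = evt alpha (t + s) g x.
Proof.
move=> t0; rewrite /evt big_map; apply: eq_bigr => a _.
rewrite !wtE //=; last by lra.
rewrite -/(mu a) flow_flow //; last exact: mu_pd.
by rewrite -dfac_flow //; [lra|exact: mu_pd].
Qed.

(** In the constant, [alpha * L] accounts for the determinant factor and [2 * L] for the
    exponential. The latter is uniform in [x] because [a - b <= 2 * t * L * b] and
    [b * exp (- b) <= 1]. *)
Lemma wt_close (u : pdmat p) : exists C, 0 <= C /\ forall t x, 0 <= t -> psd p x ->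
  Rabs (wt alpha t u x - exp (- mtrace p (mmul p (proj1_sig u) x))) <= C * t.
Proof.
have [l [q [oq l0 E]]] := pd_spec (proj2_sig u).
pose L := \rsum_(i < p) l i.
have l0' i : 0 <= l i by apply: Rlt_le.
have L0 : 0 <= L by apply: rsum_ge0.
exists ((alpha + 2) * L); split; first by apply: Rmult_le_pos; lra.
move=> t x t0 psx; rewrite wtE // E (mtrace_mulC _ x) flow_spec // !mtrace_mul_spec.
set b := \rsum_(i < p) (l i / _ * _); set a := \rsum_(i < p) (l i * _).
have h i : 0 < 1 + 2 * t * l i by apply: one_plus_pos.
have hq i : 0 <= quad p x (q i) by apply: (proj2 psx).
have b0 : 0 <= b.
  apply: rsum_ge0 => i _; apply: Rmult_le_pos => //; apply: Rlt_le.
  exact: Rdiv_lt_0_compat.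
have ab : b <= a <= b + 2 * t * L * b.
  split.
    apply: rsum_le => i _; apply: Rmult_le_compat_r => //.
    apply: (Rmult_le_reg_r (1 + 2 * t * l i)) => //.
    rewrite /Rdiv Rmult_assoc Rinv_l; last by have := h i; lra.
    by have := Rmult_le_pos _ _ t0 (l0' i); have := l0' i; nra.
  have -> : b + 2 * t * L * b = (1 + 2 * t * L) * b by lra.
  rewrite /b rsum_mull; apply: rsum_le => i _; rewrite -[X in _ <= X]Rmult_assoc.
  apply: Rmult_le_compat_r => //.
  have lL : l i <= L by apply: rsum_term_le.
  have {1}-> : l i = (1 + 2 * t * l i) * (l i / (1 + 2 * t * l i)).
    by field; have := h i; lra.
  apply: Rmult_le_compat_r; first by apply: Rlt_le; exact: Rdiv_lt_0_compat.
  by have := Rmult_le_compat_l _ _ _ t0 lL; lra.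
have e1 : exp (- b) <= 1 by rewrite -exp_0; apply: exp_le_mono; lra.
have be : b * exp (- b) <= 1.
  have : exp (- b) * exp b = 1 by rewrite -exp_plus Rplus_opp_l exp_0.
  have := exp_ineq1_le b; have := exp_pos (- b).
  by move: (exp (- b)) (exp b) => e e'; nra.
have diff : 0 <= exp (- b) - exp (- a) <= 2 * t * L.
  split; first by have := @exp_le_mono (- a) (- b) ltac:(lra); lra.
  have : exp (- b) - exp (- a) <= exp (- b) * (a - b).
    have -> : - a = - b + - (a - b) by lra.
    rewrite exp_plus; have := exp_ineq1_le (- (a - b)); have := exp_pos (- b).
    by move: (exp (- b)) (exp (- (a - b))) => e e'; nra.
  have := exp_pos (- b); have := Rmult_le_pos _ _ t0 L0.
  move: be; move: (exp (- b)) => e be tL ep.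
  have : e * (a - b) <= e * (2 * t * L * b) by apply: Rmult_le_compat_l; lra.
  have : 2 * (t * L) * (b * e) <= 2 * (t * L) * 1 by apply: Rmult_le_compat_l; lra.
  lra.
have dl := dfac_le1 alpha0 t0 (spec_pd oq l0).
have dg : 1 - alpha * L * t <= dfac alpha t (spec q l).
  rewrite dfac_spec //.
  have lnb : \rsum_(i < p) ln (1 + 2 * t * l i) <= 2 * t * L.
    rewrite /L rsum_mull; apply: rsum_le => i _.
    have : 1 + 2 * t * l i <= exp (2 * t * l i) by apply: exp_ineq1_le.
    by move/(ln_le _ _ (h i)); rewrite ln_exp.
  apply: Rle_trans (exp_ineq1_le _).
  by have := Rmult_le_compat_l _ _ _ alpha0 lnb; rewrite /=; lra.
move: dl dg diff e1; have := exp_pos (- b).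
move: (dfac _ _ _) (exp (- b)) (exp (- a)) => d e e' ep dl dg diff e1.
have : 0 <= (1 - d) * e <= alpha * L * t.
  split; first by apply: Rmult_le_pos; lra.
  by apply: Rle_trans (_ : (1 - d) * 1 <= _); [apply: Rmult_le_compat_l|]; lra.
by move=> hh; apply: Rabs_le; lra.
Qed.

Lemma evt_small_time g : exists C, 0 <= C /\ forall t x, 0 <= t -> psd p x ->
  Rabs (evt alpha t g x - ev g x) <= C * t.
Proof.
elim: g => [|a g [C [C0 IH]]].
  by exists 0; split=> [|t x _ _]; [lra|rewrite /evt /ev !big_nil Rminus_diag Rabs_R0; lra].
have [D [D0 H]] := wt_close a.2.
exists (Rabs a.1 * D + C); split.
  by have := Rmult_le_pos _ _ (Rabs_pos a.1) D0; lra.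
move=> t x t0 psx; rewrite /evt /ev !big_cons -/(evt alpha t g x) -/(ev g x).
set A := wt _ _ _ _; set B := exp _.
have -> : a.1 * A + evt alpha t g x - (a.1 * B + ev g x) =
  a.1 * (A - B) + (evt alpha t g x - ev g x) by lra.
apply: Rle_trans (Rabs_triang _ _) _; rewrite Rmult_plus_distr_r.
apply: Rplus_le_compat; last exact: IH.
rewrite Rabs_mult Rmult_assoc; apply: Rmult_le_compat_l; first exact: Rabs_pos.
exact: H.
Qed.

Lemma Req_le_eps a b C : 0 <= C -> (forall e, 0 < e -> Rabs (a - b) <= C * e) -> a = b.
Proof.
move=> C0 H; apply: cond_eq => e e0.
have := H (e / (C + 1)) ltac:(apply: Rdiv_lt_0_compat; lra).
have -> : C * (e / (C + 1)) = e - e / (C + 1) by field; lra.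
have : 0 < e / (C + 1) by apply: Rdiv_lt_0_compat; lra.
lra.
Qed.

Lemma wsg_lin t a b f f' x : 0 <= t -> C0 p (Dp p k) f -> C0 p (Dp p k) f' ->
  wsg t (fun y => a * f y + b * f' y) x = a * wsg t f x + b * wsg t f' x.
Proof.
move=> t0 Cf Cf'; apply: (@Req_le_eps _ _ (2 * (Rabs a + Rabs b))) => [|e e0].
  by have := Rabs_pos a; have := Rabs_pos b; lra.
have [g H] := exp_dense p0 k0 Cf e0; have [g' H'] := exp_dense p0 k0 Cf' e0.
have h1 := wsgP x t0 Cf H; have h2 := wsgP x t0 Cf' H'.
have h3 := wsgP x t0 (C0_lin a b Cf Cf') (close_lin a b H H').
rewrite evt_cat !evt_scale in h3.
set W := wsg t (fun y => _) x in h3 *.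
set u := evt alpha t g _ in h1 h3; set v := evt alpha t g' _ in h2 h3.
have -> : W - (a * wsg t f x + b * wsg t f' x) =
  - (a * u + b * v - W) + (a * (u - wsg t f x) + b * (v - wsg t f' x)) by lra.
apply: Rle_trans (Rabs_triang _ _) _; rewrite Rabs_Ropp.
have := Rabs_triang (a * (u - wsg t f x)) (b * (v - wsg t f' x)); rewrite !Rabs_mult.
have := Rmult_le_compat_l _ _ _ (Rabs_pos a) h1.
have := Rmult_le_compat_l _ _ _ (Rabs_pos b) h2.
lra.
Qed.

(** Applied to [- f] with [B = 0] this gives positivity; applied to both [f] and [- f] it gives the
    contraction property. *)
Lemma wsg_le t f B x : 0 <= t -> 0 <= B -> C0 p (Dp p k) f -> (forall y, f y <= B) ->
  wsg t f x <= B.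
Proof.
move=> t0 B0 Cf fB; apply: Rnot_lt_le => bad; pose e := (wsg t f x - B) / 4.
have e0 : 0 < e by rewrite /e; lra.
have [g H] := exp_dense p0 k0 Cf e0.
have := evt_le x t0 H (Rplus_le_le_0_compat _ _ B0 (Rlt_le _ _ e0)) fB; have /Rabs_le_between := wsgP x t0 Cf H.
by rewrite /e; lra.
Qed.

Lemma wsg_opp t f x : 0 <= t -> C0 p (Dp p k) f ->
  C0 p (Dp p k) (fun y => - f y) /\ wsg t (fun y => - f y) x = - wsg t f x.
Proof.
move=> t0 Cf; have E : (fun y => - f y) = (fun y => -1 * f y + 0 * f y).
  by apply: functional_extensionality => y; lra.
by split; rewrite E; [apply: C0_lin|rewrite wsg_lin //; lra].
Qed.

Lemma wsg_0 f x : C0 p (Dp p k) f -> wsg 0 f x = f x.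
Proof.
move=> Cf; apply: (@Req_le_eps _ _ 2) => [|e e0]; first by lra.
have [g H] := exp_dense p0 k0 Cf e0.
have := wsgP x (Rle_refl 0) Cf H; rewrite evt_0 => /Rabs_le_between h.
by have /Rabs_le_between h2 := H x; apply: Rabs_le; lra.
Qed.

Lemma wsg_add t s f x : 0 <= t -> 0 <= s -> C0 p (Dp p k) f ->
  wsg (t + s) f x = wsg t (wsg s f) x.
Proof.
move=> t0 s0 Cf; apply: (@Req_le_eps _ _ 2) => [|e e0]; first by lra.
have [g H] := exp_dense p0 k0 Cf e0.
have /Rabs_le_between h1 := wsgP x (Rplus_le_le_0_compat _ _ t0 s0) Cf H.
have := wsgP x t0 (wsg_C0 s0 Cf) (wsg_close s0 Cf H).
rewrite evt_flowc // => /Rabs_le_between h2.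
by apply: Rabs_le; lra.
Qed.

Lemma wsg_strongly_continuous f eps : C0 p (Dp p k) f -> 0 < eps ->
  exists delta, 0 < delta /\
    forall t, 0 <= t < delta -> forall x, Rabs (wsg t f x - f x) <= eps.
Proof.
move=> Cf e0; have [g H] := exp_dense p0 k0 Cf (ltac:(lra) : 0 < eps / 4).
have [C [C00 HC]] := evt_small_time g.
exists (eps / (2 * (C + 1))); split; first by apply: Rdiv_lt_0_compat; lra.
move=> t [t0 td] x.
have /Rabs_le_between h1 := wsgP x t0 Cf H; have /Rabs_le_between h2 := H x.
have /Rabs_le_between h3 := HC t _ t0 (proj1 (proj2_sig x)).
have : (C + 1) * t < eps / 2.
  have := Rmult_lt_compat_l (C + 1) _ _ ltac:(lra) td.
  by have -> : (C + 1) * (eps / (2 * (C + 1))) = eps / 2 by field; lra.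
by move=> h; apply: Rabs_le; lra.
Qed.

Lemma wsg_wishart : wishart_semigroup p (Dp p k) alpha wsg.
Proof.
split; last first.
  move=> u t x pu t0; pose g : comb p := [:: (1, exist _ u pu : pdmat p)].
  have E y : f_u p (Dp p k) u y = ev g (proj1_sig y).
    by rewrite /ev /g big_cons big_nil /mu /= Rmult_1_l Rplus_0_r.
  have Ef : f_u p (Dp p k) u = (fun y => ev g (proj1_sig y)).
    exact: functional_extensionality.
  have Cf : C0 p (Dp p k) (f_u p (Dp p k) u) by rewrite Ef; apply: ev_C0.
  (* [f_u] is itself a combination, hence approximated with error 0, and the prescribed formula
     holds exactly. *)
  have cl : close (f_u p (Dp p k) u) g 0.
    by move=> y; rewrite E Rminus_diag Rabs_R0; lra.
  have := wsgP x t0 Cf cl; rewrite /evt /g big_cons big_nil /= wtE //= => H.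
  have {}H : 1 * (dfac alpha t u * exp (- mtrace p (mmul p (proj1_sig x) (flow t u)))) + 0
      - wsg t (f_u p (Dp p k) u) x = 0 by move/Rabs_le_between: H; lra.
  by rewrite -/(flow t u) -/(dfac alpha t u); lra.
split; first by move=> t f; apply: wsg_C0.
split; first by move=> t a b f f' t0 Cf Cf' x; apply: wsg_lin.
split; first by move=> f Cf x; apply: wsg_0.
split; first by move=> t s f t0 s0 Cf x; apply: wsg_add.
split.
  move=> t f t0 Cf f0 x; have [Cm Em] := wsg_opp x t0 Cf.
  have := @wsg_le t _ 0 x t0 (Rle_refl 0) Cm; rewrite Em => H.
  by suff : - wsg t f x <= 0; [lra|apply: H => y; have := f0 y; lra].
split; last by move=> f Cf eps; apply: wsg_strongly_continuous.
move=> t f t0 Cf c fc x; have [Cm Em] := wsg_opp x t0 Cf.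
have c0 : 0 <= c by apply: Rle_trans (fc x); apply: Rabs_pos.
have := @wsg_le t _ c x t0 c0 Cm; rewrite Em => H1.
have := @wsg_le t _ c x t0 c0 Cf => H2.
apply: Rabs_le; split.
  suff : - wsg t f x <= c by lra.
  by apply: H1 => y; have /Rabs_le_between := fc y; lra.
by apply: H2 => y; have /Rabs_le_between := fc y; lra.
Qed.

End Construction.

(** * Necessity of the conditions on the drift *)

Lemma rsum_seq_const I (r : seq I) c : \rsum_(i <- r) c = INR (size r) * c.
Proof.
elim: r => [|a r IH]; first by rewrite big_nil /=; lra.
by rewrite big_cons IH [size (a :: r)]/= S_INR; lra.
Qed.

Lemma rsum_seq_term_le (I : eqType) (r : seq I) (F : I -> R) i :
  (forall j, 0 <= F j) -> i \in r -> F i <= \rsum_(j <- r) F j.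
Proof.
move=> F0; elim: r => [//|a r IH]; rewrite inE big_cons => /orP[/eqP->|/IH].
  by have := @rsum_ge0 _ r xpredT F (fun j _ => F0 j); lra.
by have := F0 a; lra.
Qed.

Lemma exists_argmax (I : finType) (j : I) (F : I -> R) : exists i, forall a, F a <= F i.
Proof.
suff [i H] : exists i, forall a, a \in enum I -> F a <= F i.
  by exists i => a; apply: H; rewrite mem_enum.
elim: (enum I) => [|b s [i H]]; first by exists j.
case: (Rle_lt_dec (F b) (F i)) => [bi|ib].
  by exists i => a; rewrite inE => /orP[/eqP->|/H].
by exists b => a; rewrite inE => /orP[/eqP->|/H]; lra.
Qed.

Section Necessity.
Variables (p k : nat) (alpha : R).
Hypotheses (kp : (1 <= k <= p)%N) (alpha0 : 0 <= alpha).
Variable P : R -> fnD p (Dp p k) -> fnD p (Dp p k).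
Hypothesis WP : wishart_semigroup p (Dp p k) alpha P.
Implicit Types (g : comb p).

Lemma semigroup_ev t g x : 0 <= t ->
  P t (fun y => ev g (proj1_sig y)) x = evt alpha t g (proj1_sig x).
Proof.
case: WP => [[_ [lin _]] HW] t0.
elim: g => [|a g IH].
  have C0nil := @ev_C0 p k kp [::].
  have := lin t 0 0 _ _ t0 C0nil C0nil x; rewrite /evt big_nil.
  have -> : (fun y : {x | Dp p k x} => 0 * ev [::] (proj1_sig y) + 0 * ev [::] (proj1_sig y)) =
            (fun y => ev [::] (proj1_sig y)).
    by apply: functional_extensionality => y; rewrite /ev big_nil; lra.
  by move=> ->; lra.
have E1 : f_u p (Dp p k) (mu a) = (fun y => ev [:: (1, a.2)] (proj1_sig y)).
  by apply: functional_extensionality => y; rewrite /ev big_cons big_nil /f_u /mu /=; lra.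
have C1 : C0 p (Dp p k) (f_u p (Dp p k) (mu a)) by rewrite E1; apply: (ev_C0 kp).
have := lin t a.1 1 _ _ t0 C1 (ev_C0 kp g) x.
have -> : (fun y => a.1 * f_u p (Dp p k) (mu a) y + 1 * ev g (proj1_sig y)) =
          (fun y => ev (a :: g) (proj1_sig y)).
  by apply: functional_extensionality => y; rewrite /ev big_cons /f_u; lra.
move=> ->; rewrite IH HW //; last exact: mu_pd.
by rewrite /evt big_cons wtE // /dfac /flow /mu; lra.
Qed.

(** Both bounds on [alpha] use the semigroup through this statement alone. *)
Lemma evt_pos t g x : 0 <= t -> (forall y, Dp p k y -> 0 <= ev g y) -> Dp p k x ->
  0 <= evt alpha t g x.
Proof.
move=> t0 g0 Dx; have := semigroup_ev g (exist _ x Dx) t0; rewrite /= => <-.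
case: WP => [[_ [_ [_ [_ [pos _]]]]] _].
by apply: pos => // [|[y Dy]] /=; [exact: (ev_C0 kp)|exact: g0].
Qed.

(** ** The upper bound *)

Lemma rprod_ge I (r : seq I) (l : I -> R) : (forall i, 0 <= l i) ->
  1 + \rsum_(i <- r) l i <= \big[Rmult/1]_(i <- r) (1 + l i).
Proof.
move=> l0; elim: r => [|a r IH]; first by rewrite !big_nil; lra.
rewrite !big_cons; have S0 : 0 <= \rsum_(i <- r) l i by apply: rsum_ge0.
move: IH S0; move: (\rsum_(i <- r) l i) (\big[Rmult/1]_(i <- r) _) => s q h1 h2.
by have := l0 a; nra.
Qed.

(** At time 1/2 the determinant is [det (I + u)], which is at least [1 + tr u]. *)
Lemma dfac_half_le u : pd p u -> dfac alpha (/ 2) u <= exp (- (alpha / 2 * ln (1 + mtrace p u))).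
Proof.
move=> /pd_spec [l [q [oq l0 ->]]]; rewrite dfac_spec //; last by lra.
rewrite mtrace_spec //; apply: exp_le_mono.
have h i : 0 < 1 + l i by have := l0 i; lra.
have l0' i : 0 <= l i by apply: Rlt_le.
have S0 : 0 <= \rsum_(i < p) l i by apply: rsum_ge0.
have -> : \rsum_(i < p) ln (1 + 2 * / 2 * l i) = \rsum_(i < p) ln (1 + l i).
  by apply: eq_bigr => i _; congr ln; lra.
rewrite -(proj2 (ln_rprod _ h)).
have H : ln (1 + \rsum_(i < p) l i) <= ln (\big[Rmult/1]_(i < p) (1 + l i)).
  by apply: ln_le; [lra|exact: rprod_ge].
by have := Rmult_le_compat_l _ _ _ alpha0 H; rewrite /=; lra.
Qed.

Lemma nearest_nat N y : 0 <= y <= INR N -> exists n, (n <= N)%N /\ Rabs (INR n - y) <= 1.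
Proof.
elim: N => [|N IH] yN.
  by exists O; split=> //; apply: Rabs_le; move: yN; rewrite /=; lra.
case: (Rle_lt_dec y (INR N)) => [yl|yl].
  by have [n [nN Hn]] := IH ltac:(lra); exists n; split=> //; apply: leqW.
by exists N.+1; split=> //; apply: Rabs_le; move: yN; rewrite S_INR; lra.
Qed.

(** * A net of almost kernel vectors *)

Section Net.
Variable m : nat.
Hypothesis m0 : (0 < m)%N.
Hypothesis kltp : (k < p)%N.

Let M := INR m.
Let M0 : 0 < M. Proof. by apply: lt_0_INR; apply/ltP. Qed.

Definition netset : {set 'I_p} := [set a : 'I_p | (a < k.+1)%N].

Lemma card_netset : #|netset| = k.+1.
Proof.
rewrite -sum1_card (eq_bigl (fun a : 'I_p => (a < k.+1)%N)) => [|a]; last by rewrite inE.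
by rewrite -(big_ord_widen p (fun _ => 1%N)) // sum1_card card_ord.
Qed.

(** Vectors with entries in [[-1, 1]] that are multiples of [1 / m]: the code [F a] runs over
    [0 .. 2 m], and [F a = m] stands for 0. Entry [i], meant to be the largest one of the
    approximated vector, is normalized to 1. *)
Definition netvec (i : 'I_p) (F : {ffun 'I_p -> 'I_(m + m).+1}) : rvec p :=
  fun a => if a == i then 1 else (INR (F a) - M) / M.

(** With [v = netvec i F], the exponential of this matrix is [exp (- m^2 v^T x v - tr x)]; it stays
    above a fixed power of [exp (- tr x)] where [x] nearly annihilates [v]. The identity makes the
    matrix positive definite. *)
Definition netmat i F : rmat p :=
  fun a b => M ^ 2 * (netvec i F a * netvec i F b) + mid p a b.

Lemma quad_netmat i F v :
  quad p (netmat i F) v = M ^ 2 * (\rsum_(a < p) (netvec i F a * v a)) ^ 2 + \rsum_(a < p) v a ^ 2.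
Proof.
rewrite rsum_sqr rsum_mull -rsum_add; apply: eq_bigr => a _.
rewrite (eq_bigr (fun b => M ^ 2 * (netvec i F a * v a * (netvec i F b * v b)) +
  mid p a b * (v a * v b))); last by move=> b _; rewrite /netmat; lra.
by rewrite rsum_add rsum_deltal -rsum_mull /=; lra.
Qed.

Lemma netmat_pd i F : pd p (netmat i F).
Proof.
split; first by move=> a b; rewrite /netmat midC; lra.
move=> v /norm2_gt0 H; rewrite quad_netmat.
have := pow2_ge_0 M; have := pow2_ge_0 (\rsum_(a < p) (netvec i F a * v a)).
by move=> h1 h2; have := Rmult_le_pos _ _ h2 h1; lra.
Qed.

Lemma mtrace_netmat_ge i F : M ^ 2 <= mtrace p (netmat i F).
Proof.
rewrite /mtrace /netmat.
have h a : 0 <= M ^ 2 * (netvec i F a * netvec i F a) + mid p a a.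
  rewrite /mid eqxx; have := Rle_0_sqr (netvec i F a); rewrite /Rsqr => h1.
  by have := Rmult_le_pos _ _ (pow2_ge_0 M) h1; lra.
apply: Rle_trans (rsum_term_le i h).
by rewrite /netvec eqxx /mid eqxx; lra.
Qed.

Lemma mtrace_netmat_mul i F x :
  mtrace p (mmul p (netmat i F) x) = M ^ 2 * quad p x (netvec i F) + mtrace p x.
Proof.
rewrite mtrace_mulC quad_rank1 -[X in _ = _ + mtrace p X](mmul1 x).
rewrite /mtrace rsum_mull -rsum_add; apply: eq_bigr => a _.
rewrite /mmul rsum_mull -rsum_add; apply: eq_bigr => b _.
by rewrite /netmat; lra.
Qed.

(** Codes equal to [m], the code of 0, outside [netset] and at [i]; for [i] in [netset] there remain
    [k] free coordinates, whence [(2 m + 1)^k] codes. *)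
Definition netfuns i := enum (pffun_on (inord m : 'I_(m + m).+1) (netset :\ i) predT).

Lemma size_netfuns i : i \in netset -> size (netfuns i) = ((m + m).+1 ^ k)%N.
Proof.
move=> iS; rewrite /netfuns -cardE card_pffun_on card_ord; congr expn.
by have := cardsD1 i netset; rewrite iS card_netset add1n => -[].
Qed.

(** The first [k + 1] columns of [x] are dependent, so the kernel contains a nonzero vector
    supported there. Divided by its largest entry, it is rounded to the grid. As [x] annihilates the
    unrounded vector, only the rounding error, of squared length at most [p / m^2], contributes to
    the form. *)
Lemma net_covers x : Dp p k x -> exists i F, [/\ i \in netset, F \in netfuns i &
  M ^ 2 * quad p x (netvec i F) <= INR p * mtrace p x].
Proof.
move=> [psx rk].
have dep : ~ lin_indep_cols p x netset by move/rk; rewrite card_netset ltnn.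
have [c [cS [xc [j cj]]]] : exists c, (forall j, j \notin netset -> c j = 0) /\
    (forall i, \rsum_(j < p) (x i j * c j) = 0) /\ exists j, c j <> 0.
  apply: NNPP => no; apply: dep => c h1 h2 j; apply: NNPP => h3; apply: no.
  by exists c; split=> //; split=> //; exists j.
have [i mxi] : exists i, forall a, Rabs (c a) <= Rabs (c i).
  exact: (exists_argmax j (fun a => Rabs (c a))).
have ci : c i <> 0.
  by move=> E; have := mxi j; rewrite E Rabs_R0; have := Rabs_pos_lt _ cj; lra.
have iS : i \in netset by apply: contraT => /cS.
pose z a := c a / c i.
have zb a : -1 <= z a <= 1.
  suff /Rabs_le_between : Rabs (z a) <= 1 by lra.
  rewrite /z Rabs_div //; apply: (Rmult_le_reg_r (Rabs (c i))).
    exact: Rabs_pos_lt.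
  rewrite /Rdiv Rmult_assoc Rinv_l; last exact: Rabs_no_R0.
  by have := mxi a; lra.
have ex a : exists n, (n <= m + m)%N /\ Rabs (INR n - M * (z a + 1)) <= 1.
  apply: nearest_nat; rewrite -plusE plus_INR -/M.
  by have := zb a; have := M0; nra.
pose n a := proj1_sig (constructive_indefinite_description _ (ex a)).
have nP a : (n a <= m + m)%N /\ Rabs (INR (n a) - M * (z a + 1)) <= 1.
  exact: proj2_sig (constructive_indefinite_description _ (ex a)).
pose F : {ffun 'I_p -> 'I_(m + m).+1} :=
  [ffun a => if a \in netset :\ i then inord (n a) else inord m].
exists i, F; split=> //.
  rewrite mem_enum; apply/pffun_onP; split=> //.
  by apply/supportP => a aS; rewrite ffunE (negbTE aS).
have dz a : (netvec i F a - z a) ^ 2 <= / M ^ 2.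
  have iM : 0 < / M ^ 2 by apply: Rinv_0_lt_compat; apply: pow2_gt_0; have := M0; lra.
  rewrite /netvec; case: eqVneq => [->|ai].
    have -> : z i = 1 by rewrite /z; field.
    by lra.
  rewrite ffunE !inE ai andTb; case: ifP => aS.
    have [nm /Rabs_le_between Hn] := nP a.
    rewrite inordK; last by rewrite ltnS.
    have -> : (INR (n a) - M) / M - z a = (INR (n a) - M * (z a + 1)) / M.
      by field; have := M0; lra.
    have -> : ((INR (n a) - M * (z a + 1)) / M) ^ 2 =
      (INR (n a) - M * (z a + 1)) ^ 2 * / M ^ 2 by field; have := M0; lra.
    rewrite -[X in _ <= X]Rmult_1_l; apply: Rmult_le_compat_r; first exact: Rlt_le.
    by nra.
  rewrite inordK; last by rewrite ltnS leq_addr.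
  have -> : z a = 0 by rewrite /z cS ?inE ?aS //; lra.
  rewrite -/M; have -> : ((M - M) / M - 0) ^ 2 = 0 by rewrite Rminus_diag /Rdiv; lra.
  exact: Rlt_le.
have qz : quad p x (netvec i F) = quad p x (fun a => netvec i F a - z a).
  have xz a : \rsum_(b < p) (x a b * z b) = 0.
    rewrite (eq_bigr (fun b => x a b * c b * / c i)) => [|b _]; last by rewrite /z; lra.
    by rewrite -rsum_mulr xc; lra.
  have zx a : \rsum_(b < p) (z b * x b a) = 0.
    by rewrite -[RHS](xz a); apply: eq_bigr => b _; rewrite (proj1 psx b a); lra.
  move: (netvec i F) => v; rewrite /quad.
  transitivity (\rsum_(a < p) \rsum_(b < p) (v a * x a b * v b) -
     \rsum_(a < p) (v a * (\rsum_(b < p) (x a b * z b))) -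
     \rsum_(a < p) ((\rsum_(b < p) (z b * x b a)) * (v a - z a))).
    have -> : \rsum_(a < p) (v a * (\rsum_(b < p) (x a b * z b))) = 0.
      by apply: rsum0 => a _; rewrite xz; lra.
    have -> : \rsum_(a < p) ((\rsum_(b < p) (z b * x b a)) * (v a - z a)) = 0.
      by apply: rsum0 => a _; rewrite zx; lra.
    by lra.
  have -> : \rsum_(a < p) ((\rsum_(b < p) (z b * x b a)) * (v a - z a)) =
            \rsum_(b < p) \rsum_(a < p) (z b * x b a * (v a - z a)).
    by rewrite exchange_big /=; apply: eq_bigr => a _; rewrite rsum_mulr.
  rewrite -!rsum_sub; apply: eq_bigr => a _.
  by rewrite rsum_mull -!rsum_sub; apply: eq_bigr => b _; lra.
have tr0 : 0 <= mtrace p x by apply: rsum_ge0 => a _; apply: psd_diag_ge0.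
rewrite qz; apply: Rle_trans (Rmult_le_compat_l _ _ _ (pow2_ge_0 M) (quad_le_mtrace _ psx)) _.
rewrite -Rmult_assoc; apply: Rmult_le_compat_r => //.
have -> : INR p = M ^ 2 * (\rsum_(a < p) / M ^ 2).
  by rewrite rsum_const card_ord; field; have := M0; lra.
apply: Rmult_le_compat_l; first exact: pow2_ge_0.
by apply: rsum_le => a _; apply: dz.
Qed.

End Net.

Lemma scaled_mid_pd c : 0 < c -> pd p (mscale p c (mid p)).
Proof.
move=> c0; have [l [q [oq l0 E]]] := pd_spec (mid_pd p).
by rewrite E spec_scale; apply: spec_pd => // i; apply: Rmult_lt_0_compat.
Qed.

Lemma evt_zero t g : 0 <= t ->
  evt alpha t g (fun _ _ => 0) = \rsum_(a <- g) (a.1 * dfac alpha t (mu a)).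
Proof.
move=> t0; apply: eq_bigr => a _; rewrite wtE //.
have -> : mtrace p (mmul p (fun _ _ => 0) (flow t (proj1_sig a.2))) = 0.
  by apply: rsum0 => i _; apply: rsum0 => j _; lra.
by rewrite Ropp_0 exp_0 /mu; lra.
Qed.

Lemma Dp_zero : Dp p k (fun _ _ => 0).
Proof.
have -> : (fun _ _ => 0) = gram (fun (_ : 'I_p) (_ : 'I_k) => 0).
  by apply: mat_ext => a b; rewrite /gram rsum0 // => l _; lra.
exact: gram_Dp.
Qed.

(* Every matrix of rank at most [k] nearly annihilates one of the [O(m^k)] vectors of the net,
   whereas the probability that [X_t] nearly annihilates a given one is of order [m^(-alpha)]. *)
Lemma net_bound m : (0 < m)%N -> (k < p)%N ->
  dfac alpha (/ 2) (mscale p (INR p + 1) (mid p)) <=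
  INR k.+1 * 3 ^ k * exp (- ((alpha - INR k) * ln (INR m))).
Proof.
move=> m0 kltp; have M0 : 0 < INR m by apply: lt_0_INR; apply/ltP.
have c0 : 0 < INR p + 1 by have := pos_INR p; lra.
pose net : comb p := flatten [seq [seq (1, exist _ (netmat i F) (netmat_pd i F) : pdmat p)
  | F <- @netfuns m i] | i <- enum netset].
(* [exp (- (p + 1) tr x)] lies below the term of the covering vector [v], whose exponent satisfies
   [m^2 v^T x v + tr x <= (p + 1) tr x]. *)
pose top : pdmat p := exist _ _ (scaled_mid_pd c0).
have evE x : ev (net ++ [:: (-1, top)]) x =
    \rsum_(i <- enum netset) \rsum_(F <- @netfuns m i) exp (- mtrace p (mmul p (netmat i F) x))
    - exp (- ((INR p + 1) * mtrace p x)).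
  rewrite ev_cat /net /ev big_flatten big_map big_cons big_nil /= /mu /=; congr (_ + _).
    apply: eq_bigr => i _; rewrite big_map; apply: eq_bigr => F _ /=; lra.
  have -> : mmul p (mscale p (INR p + 1) (mid p)) x = mscale p (INR p + 1) x.
    rewrite -[in RHS](mul1m x); apply: mat_ext => a b; rewrite /mmul /mscale rsum_mull.
    by apply: eq_bigr => c _; lra.
  have -> : mtrace p (mscale p (INR p + 1) x) = (INR p + 1) * mtrace p x.
    by rewrite /mtrace rsum_mull.
  by lra.
have g0 x : Dp p k x -> 0 <= ev (net ++ [:: (-1, top)]) x.
  move=> Dx; rewrite evE.
  have [i [F [iS FS H]]] := net_covers m0 kltp Dx.
  suff : exp (- ((INR p + 1) * mtrace p x)) <= \rsum_(i <- enum netset)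
      \rsum_(F <- @netfuns m i) exp (- mtrace p (mmul p (netmat i F) x)) by lra.
  apply: Rle_trans (rsum_seq_term_le _ (_ : i \in enum netset)); first last.
  - by rewrite mem_enum.
  - by move=> i'; apply: rsum_ge0 => F' _; apply: Rlt_le; apply: exp_pos.
  apply: Rle_trans (rsum_seq_term_le _ FS); last by move=> F'; apply: Rlt_le; apply: exp_pos.
  by apply: exp_le_mono; rewrite mtrace_netmat_mul; lra.
(* At [x = 0] the evolved exponentials are 1, and only the determinant factors remain. *)
have := evt_pos (ltac:(lra) : 0 <= / 2) g0 Dp_zero.
rewrite evt_zero; last by lra.
rewrite /net big_cat big_flatten big_map big_cons big_nil /= /mu /= => H.
pose e := exp (- (alpha * ln (INR m))).
have He : \rsum_(i <- enum netset) \rsum_(a <- [seq (1, exist _ (netmat i F) (netmat_pd i F)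
    : pdmat p) | F <- @netfuns m i]) (a.1 * dfac alpha (/ 2) (proj1_sig a.2)) <=
    \rsum_(i <- enum netset) (INR ((m + m).+1 ^ k) * e).
  rewrite !big_enum /=; apply: rsum_le => i iS; rewrite big_map -(size_netfuns m kltp iS).
  rewrite -rsum_seq_const; apply: rsum_le => F _ /=; rewrite Rmult_1_l.
  apply: Rle_trans (dfac_half_le (netmat_pd i F)) _; apply: exp_le_mono.
  have : ln (INR m ^ 2) <= ln (1 + mtrace p (netmat i F)).
    apply: ln_le; first exact: pow_lt.
    by have := mtrace_netmat_ge i F; lra.
  have -> : ln (INR m ^ 2) = 2 * ln (INR m) by rewrite /= Rmult_1_r ln_mult //; lra.
  by move=> h; have := Rmult_le_compat_l _ _ _ alpha0 h; lra.
rewrite rsum_seq_const -cardE card_netset // in He.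
have card : INR ((m + m).+1 ^ k) <= (3 * INR m) ^ k.
  have -> : INR ((m + m).+1 ^ k) = INR (m + m).+1 ^ k.
    by elim: (k) => [//|n IH]; rewrite expnS -multE mult_INR IH.
  apply: pow_incr; split; first exact: pos_INR.
  rewrite S_INR -plusE plus_INR.
  have : INR 1 <= INR m by apply: le_INR; apply/leP.
  by rewrite /=; lra.
have Mk : INR m ^ k = exp (INR k * ln (INR m)) by rewrite -Rpower_pow.
have e0 : 0 < e by apply: exp_pos.
have -> : exp (- ((alpha - INR k) * ln (INR m))) = INR m ^ k * e.
  by rewrite Mk /e -exp_plus; congr exp; lra.
have k0 := pos_INR k.+1.
have : INR k.+1 * (INR ((m + m).+1 ^ k) * e) <= INR k.+1 * ((3 * INR m) ^ k * e).
  by apply: Rmult_le_compat_l => //; apply: Rmult_le_compat_r => //; lra.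
rewrite Rpow_mult_distr; move: H He; rewrite /= => H He; lra.
Qed.

(** The left side of [net_bound] is a positive constant, while for [alpha > k] its right side tends
    to 0 as [m] grows. Taking [ln m > A / (c * b)] suffices, because [exp (- L) <= 1 / (1 + L)]. *)
Lemma drift_le : (k < p)%N -> alpha <= INR k.
Proof.
move=> kltp; apply: Rnot_lt_le => lt; pose b := alpha - INR k.
have b0 : 0 < b by rewrite /b; lra.
pose c := dfac alpha (/ 2) (mscale p (INR p + 1) (mid p)).
have c0 : 0 < c by apply: dfac_pos.
pose A := INR k.+1 * 3 ^ k.
have A0 : 0 < A by apply: Rmult_lt_0_compat; [apply: lt_0_INR; lia|apply: pow_lt; lra].
have cb : 0 < c * b by apply: Rmult_lt_0_compat.
have [m Hm] := INR_unbounded (exp (A / (c * b))).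
have M0 : 0 < INR m by have := exp_pos (A / (c * b)); lra.
have lnm : A / (c * b) < ln (INR m).
  by rewrite -[X in X < _]ln_exp; apply: ln_increasing; [exact: exp_pos|exact: Hm].
have m0 : (0 < m)%N by apply/ltP; apply: INR_lt.
have := net_bound m0 kltp; rewrite -/c -/A -/b.
have Alt : A < c * (b * ln (INR m)).
  have := Rmult_lt_compat_r _ _ _ cb lnm.
  by have -> : A / (c * b) * (c * b) = A by [field; lra]; lra.
move: Alt; move: (b * ln (INR m)) => L Alt.
have : exp (- L) * exp L = 1 by rewrite -exp_plus Rplus_opp_l exp_0.
have := exp_ineq1_le L; have := exp_pos (- L).
move: (exp (- L)) (exp L) => e e' h1 h2 h3 h4.
have h5 : c * e' <= A by have := Rmult_le_compat_r e' _ _ ltac:(nra) h4; nra.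
nra.
Qed.

End Necessity.

(** ** The lower bound *)

Section Schur.
Variable p : nat.

(** With [A = Y Y^T], the form at [v] is the sum of the forms of [B] at the entrywise products of
    [v] with the columns of [Y]. *)
Lemma hadamard_psd (A B : rmat p) : psd p A -> psd p B -> psd p (fun i j => A i j * B i j).
Proof.
move=> psA [sB pB]; have [Y E] := proj1 (Dp_gramP p A) (Dp_full psA).
split; first by move=> i j; rewrite (proj1 psA i j) sB.
move=> v; suff -> : quad p (fun i j => A i j * B i j) v =
    \rsum_(l < p) quad p B (fun a => v a * Y a l) by apply: rsum_ge0 => l _; apply: pB.
rewrite E /quad /gram [RHS]exchange_big /=; apply: eq_bigr => a _.
rewrite [RHS]exchange_big /=; apply: eq_bigr => b _.
by rewrite !rsum_mulr rsum_mull rsum_mulr; apply: eq_bigr => l _; lra.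
Qed.

Lemma hadamard_pow_psd (A : rmat p) n : psd p A -> psd p (fun i j => A i j ^ n).
Proof.
move=> psA; elim: n => [|n IH]; last exact: (hadamard_psd psA IH).
split=> // v; suff -> : quad p (fun i j => A i j ^ 0) v = (\rsum_(i < p) v i) ^ 2.
  exact: pow2_ge_0.
by rewrite rsum_sqr; apply: eq_bigr => a _; apply: eq_bigr => b _; rewrite /=; lra.
Qed.

Lemma quad_add (A B : rmat p) v : quad p (fun i j => A i j + B i j) v = quad p A v + quad p B v.
Proof.
rewrite /quad -rsum_add; apply: eq_bigr => a _.
by rewrite -rsum_add; apply: eq_bigr => b _; lra.
Qed.

Lemma quad_scale c (A : rmat p) v : quad p (fun i j => c * A i j) v = c * quad p A v.
Proof.
rewrite /quad rsum_mull; apply: eq_bigr => a _.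
by rewrite rsum_mull; apply: eq_bigr => b _; lra.
Qed.

(** Without its constant term the exponential series still has nonnegative coefficients, and
    Hadamard powers preserve positivity. *)
Lemma exp_minus_one_psd (A : rmat p) v : psd p A -> 0 <= quad p (fun i j => exp (A i j) - 1) v.
Proof.
move=> psA.
pose T N y := sum_f_R0 (fun n => / INR (fact n) * y ^ n) N.
have T0 N : 0 <= quad p (fun i j => T N (A i j) - 1) v.
  elim: N => [|N IH].
    right; rewrite /quad rsum0 // => a _; rewrite rsum0 // => b _.
    by rewrite /T /= Rinv_1; lra.
  have -> : (fun i j => T N.+1 (A i j) - 1) =
      (fun i j => (T N (A i j) - 1) + / INR (fact N.+1) * A i j ^ N.+1).
    by apply: mat_ext => i j; rewrite /T /sum_f_R0 -/sum_f_R0; lra.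
  rewrite quad_add (quad_scale _ (fun i j => A i j ^ N.+1)).
  have := proj2 (hadamard_pow_psd N.+1 psA) v => h.
  have : 0 < / INR (fact N.+1) by apply: Rinv_0_lt_compat; apply: lt_0_INR; apply: lt_O_fact.
  by nra.
have L : is_lim_seq (fun N => quad p (fun i j => T N (A i j) - 1) v)
    (quad p (fun i j => exp (A i j) - 1) v).
  apply: is_lim_seq_rsum => a; apply: is_lim_seq_rsum => b.
  apply: (is_lim_seq_mult' (fun N => v a * (T N (A a b) - 1)) (fun _ => v b)); last first.
    exact: is_lim_seq_const.
  apply: (is_lim_seq_mult' (fun _ => v a) (fun N => T N (A a b) - 1)).
    exact: is_lim_seq_const.
  apply: is_lim_seq_minus'; last exact: is_lim_seq_const.
  apply/is_lim_seq_Reals; exact: (proj2_sig (exist_exp (A a b))).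
have := is_lim_seq_le (fun _ => 0) _ 0 _ _ (is_lim_seq_const 0) L; exact.
Qed.

End Schur.

(** * The test combination at a matrix of rank r *)

Section LowerBound.
Variables (p k : nat) (alpha : R).
Hypothesis kp : (1 <= k <= p)%N.
Variable P : R -> fnD p (Dp p k) -> fnD p (Dp p k).
Hypothesis WP : wishart_semigroup p (Dp p k) alpha P.

(** Minimum principle in time: [evt alpha t g x0] is nonnegative for [t >= 0] and vanishes at
    [t = 0], so its derivative there is nonnegative. *)
Lemma genc_ge0 (g : comb p) x0 : (forall x, Dp p k x -> 0 <= ev g x) -> Dp p k x0 ->
  ev g x0 = 0 -> 0 <= genc alpha g x0.
Proof.
move=> g0 D0 E0; apply: Rnot_lt_le => neg.
have E : genc alpha (flowc alpha (Rle_refl 0) g) x0 = genc alpha g x0.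
  rewrite /genc /flowc big_map; apply: eq_bigr => a _.
  have -> : mu (a.1 * dfac alpha 0 (mu a), exist _ _ (flow_pd (Rle_refl 0) (mu_pd a))) = mu a.
    exact: flow_0 (mu_pd a).
  by rewrite /= dfac_0 ?Rmult_1_r //; exact: mu_pd.
have := is_derive_opp _ _ _ (is_derive_evt alpha (Rle_refl 0) g x0).
rewrite E => /derive_pos_right [|d [d0 H]]; first by rewrite /opp /=; lra.
have := H (d / 2) ltac:(lra); rewrite /opp /= evt_0 E0 Rplus_0_l.
by have := evt_pos kp WP (ltac:(lra) : 0 <= d / 2) g0 D0; lra.
Qed.

Variables (r : nat) (rp : (r < p)%N) (rk : (r <= k)%N) (h : R).
Hypothesis h0 : 0 < h.

Implicit Types i j : 'I_p.

(** The index of the first zero on the diagonal of [base]; it exists because [r < p]. *)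
Let s : 'I_p := Ordinal rp.

Definition dg (a : 'I_p) : R := if (a < r)%N then 1 else 0.

Definition base : rmat p := fun a b => dg a * mid p a b.

Lemma base_Dp : Dp p k base.
Proof.
pose Y (a : 'I_p) (l : 'I_k) : R := if (a == l :> nat) && (a < r)%N then 1 else 0.
suff -> : base = gram Y by apply: gram_Dp.
apply: mat_ext => a b; rewrite /base /dg /gram /Y.
case ar: (a < r)%N; last first.
  by rewrite rsum0 => [|l _]; [lra|rewrite andbF; lra].
rewrite (bigD1 (Ordinal (leq_trans ar rk))) //= eqxx rsum0 => [|l]; last first.
  by rewrite -val_eqE /= eq_sym => /negbTE ->; rewrite /=; lra.
rewrite /mid /= -val_eqE /= (eq_sym (val b)).
by case: eqP => [<-|_]; rewrite ?ar /=; lra.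
Qed.

Definition symE (i j : 'I_p) : rmat p :=
  fun a b => / 2 * (mid p i a * mid p j b + mid p j a * mid p i b).

Lemma mtrace_symE_mul i j x : msymmetric p x -> mtrace p (mmul p (symE i j) x) = x i j.
Proof.
move=> symx; rewrite /mtrace /mmul /symE.
transitivity (\rsum_(a < p) (mid p i a * (/ 2 * x j a) + mid p j a * (/ 2 * x i a))).
  apply: eq_bigr => a _.
  rewrite (eq_bigr (fun b => mid p j b * (/ 2 * mid p i a * x b a) +
    mid p i b * (/ 2 * mid p j a * x b a))); last by move=> b _; lra.
  by rewrite rsum_add !rsum_deltal; lra.
by rewrite rsum_add !rsum_deltal (symx j i); lra.
Qed.

Lemma mtrace_symE i j : mtrace p (symE i j) = mid p i j.
Proof.
rewrite /mtrace /symE (eq_bigr (fun a => mid p i a * (/ 2 * mid p j a) +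
  mid p j a * (/ 2 * mid p i a))); last by move=> a _; lra.
by rewrite rsum_add !rsum_deltal (midC j i); lra.
Qed.

Lemma quad_symE i j v : quad p (symE i j) v = v i * v j.
Proof.
rewrite /quad /symE.
transitivity (\rsum_(a < p) (mid p i a * (/ 2 * v a * v j) + mid p j a * (/ 2 * v a * v i))).
  apply: eq_bigr => a _.
  rewrite (eq_bigr (fun b => mid p j b * (/ 2 * mid p i a * v a * v b) +
    mid p i b * (/ 2 * mid p j a * v a * v b))); last by move=> b _; lra.
  by rewrite rsum_add !rsum_deltal; lra.
by rewrite rsum_add !rsum_deltal; lra.
Qed.

(** Four times this sum is the covariation of the coordinates [x i j] and [x l m] at [base], the
    second-order part of the generator. *)
Lemma base_symE2 i j l m : \rsum_(a < p) (dg a * (\rsum_(b < p) (symE i j a b * symE l m a b))) =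
  / 4 * ((dg i + dg j) * (mid p i l * mid p j m + mid p i m * mid p j l)).
Proof.
rewrite /symE.
transitivity (\rsum_(a < p) (mid p i a * (/ 4 * dg a * (mid p l a * mid p m j + mid p m a * mid p l j))
   + mid p j a * (/ 4 * dg a * (mid p l a * mid p m i + mid p m a * mid p l i)))).
  apply: eq_bigr => a _.
  rewrite (eq_bigr (fun b => mid p j b * (/ 4 * mid p i a * (mid p l a * mid p m b + mid p m a * mid p l b))
     + mid p i b * (/ 4 * mid p j a * (mid p l a * mid p m b + mid p m a * mid p l b)))); last first.
    by move=> b _; lra.
  by rewrite rsum_add !rsum_deltal; lra.
by rewrite rsum_add !rsum_deltal (midC i l) (midC j m) (midC i m) (midC j l); lra.
Qed.

Definition bR (b : bool) : R := if b then 1 else 0.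

Definition wmat i j (b1 b2 b3 : bool) : rmat p := fun a b =>
  h * (bR b1 * symE i s a b + bR b2 * symE j s a b + bR b3 * symE i j a b).

(** A product of up to three factors [exp (h * x a b)] has exponent [tr (w x)] with [w <= 3 h I], as
    [v a * v b <= |v|^2]. Multiplying by [exp (- c tr x)] therefore leaves a decaying exponential
    with a positive definite matrix. *)
Let c := 3 * h + 1.

Definition tmat i j b1 b2 b3 : rmat p := fun a b => c * mid p a b - wmat i j b1 b2 b3 a b.

Lemma wmat_sym i j b1 b2 b3 : msymmetric p (wmat i j b1 b2 b3).
Proof. by move=> a b; rewrite /wmat /symE; lra. Qed.

Lemma tmat_pd i j b1 b2 b3 : pd p (tmat i j b1 b2 b3).
Proof.
split; first by move=> a b; rewrite /tmat midC wmat_sym.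
move=> v /norm2_gt0 v0.
have sq a : 0 <= v a ^ 2 by apply: pow2_ge_0.
have vb a a' : v a * v a' <= \rsum_(b < p) v b ^ 2.
  have := rsum_term_le a sq; have := rsum_term_le a' sq.
  by have := pow2_ge_0 (v a - v a'); rewrite /=; lra.
have -> : quad p (tmat i j b1 b2 b3) v = c * (\rsum_(a < p) v a ^ 2) -
    h * (bR b1 * (v i * v s) + bR b2 * (v j * v s) + bR b3 * (v i * v j)).
  rewrite -!quad_symE /quad !rsum_mull -!rsum_add rsum_mull -rsum_sub; apply: eq_bigr => a _.
  rewrite !rsum_mull -!rsum_add rsum_mull.
  have -> : c * v a ^ 2 = \rsum_(b < p) (mid p a b * (c * v a * v b)).
    by rewrite rsum_deltal; lra.
  by rewrite -rsum_sub; apply: eq_bigr => b _; rewrite /tmat /wmat; lra.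
have := vb i s; have := vb j s; have := vb i j.
move: v0; move: (\rsum_(b < p) _) => N N0 h1 h2 h3.
have B b y : y <= N -> bR b * y <= N by case: b => /= ?; lra.
have := B b1 _ h3; have := B b2 _ h2; have := B b3 _ h1 => g1 g2 g3.
have : h * (bR b1 * (v i * v s) + bR b2 * (v j * v s) + bR b3 * (v i * v j)) <= h * (3 * N).
  by apply: Rmult_le_compat_l; lra.
by rewrite /c; lra.
Qed.

Lemma mtrace_tmat_mul i j b1 b2 b3 x : msymmetric p x ->
  mtrace p (mmul p (tmat i j b1 b2 b3) x) =
  c * mtrace p x - h * (bR b1 * x i s + bR b2 * x j s + bR b3 * x i j).
Proof.
move=> symx; rewrite -!(mtrace_symE_mul _ _ symx) -[in X in _ = c * X - _](mul1m x).
rewrite /mtrace !rsum_mull -!rsum_add rsum_mull -rsum_sub; apply: eq_bigr => a _.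
rewrite /mmul !rsum_mull -!rsum_add rsum_mull -rsum_sub; apply: eq_bigr => b _.
by rewrite /tmat /wmat; lra.
Qed.

Definition tterm i j b1 b2 b3 : pdmat p := exist _ _ (tmat_pd i j b1 b2 b3).

Lemma ev_tterm i j b1 b2 b3 x : msymmetric p x ->
  exp (- mtrace p (mmul p (tmat i j b1 b2 b3) x)) = exp (- (c * mtrace p x)) *
    ((if b1 then exp (h * x i s) else 1) * (if b2 then exp (h * x j s) else 1) *
     (if b3 then exp (h * x i j) else 1)).
Proof.
move=> symx; rewrite mtrace_tmat_mul //.
have E b y : (if b then exp y else 1) = exp (bR b * y).
  by case: b; rewrite /bR ?Rmult_1_l ?Rmult_0_l ?exp_0.
by rewrite !E -!exp_plus; congr exp; lra.
Qed.

Lemma base_sym : msymmetric p base.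
Proof. exact: (proj1 (proj1 base_Dp)). Qed.

Let E0 := exp (- (c * mtrace p base)).
(** The contribution of [c] times the identity, common to all terms; it cancels in the alternating
    sums [corner], [squares] and [triples]. *)
Let K := 2 * c ^ 2 * mtrace p base - alpha * c * INR p.

Lemma mtrace_tmat i j b1 b2 b3 : mtrace p (tmat i j b1 b2 b3) =
  c * INR p - h * (bR b1 * mid p i s + bR b2 * mid p j s + bR b3 * mid p i j).
Proof.
rewrite -!mtrace_symE /mtrace !rsum_mull -!rsum_add rsum_mull.
have -> : c * INR p = \rsum_(a < p) c by rewrite rsum_const card_ord; lra.
by rewrite -rsum_sub; apply: eq_bigr => a _; rewrite /tmat /wmat /mid eqxx; lra.
Qed.

Lemma mtrace_base_tmat2 i j b1 b2 b3 :
  mtrace p (mmul p base (mmul p (tmat i j b1 b2 b3) (tmat i j b1 b2 b3))) =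
  c ^ 2 * mtrace p base - 2 * c * h * (bR b1 * base i s + bR b2 * base j s + bR b3 * base i j)
  + h ^ 2 * \rsum_(a < p) (dg a * (\rsum_(b < p) (bR b1 * symE i s a b + bR b2 * symE j s a b +
      bR b3 * symE i j a b) ^ 2)).
Proof.
rewrite -!(mtrace_symE_mul _ _ base_sym).
rewrite /mtrace !rsum_mull -!rsum_add !rsum_mull -!rsum_sub -!rsum_add.
apply: eq_bigr => a _.
have bE (F : 'I_p -> R) : \rsum_(l < p) (base a l * F l) = dg a * F a.
  rewrite (eq_bigr (fun l => mid p a l * (dg a * F l))) ?rsum_deltal //.
  by move=> l _; rewrite /base; lra.
rewrite {1}/mmul bE /mmul.
have bE' (F : 'I_p -> R) : \rsum_(l < p) (F l * base l a) = dg a * F a.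
  rewrite (eq_bigr (fun l => mid p a l * (dg l * F l))) ?rsum_deltal //.
  by move=> l _; rewrite /base (midC l a); lra.
rewrite !bE' {1}/base /mid eqxx.
have -> : \rsum_(l < p) (tmat i j b1 b2 b3 a l * tmat i j b1 b2 b3 l a) =
   \rsum_(l < p) (mid p a l * (c ^ 2 - 2 * c * wmat i j b1 b2 b3 l a) +
     h ^ 2 * (bR b1 * symE i s a l + bR b2 * symE j s a l + bR b3 * symE i j a l) ^ 2).
  apply: eq_bigr => l _; rewrite /tmat (wmat_sym i j b1 b2 b3 l a) (midC l a).
  have -> : h ^ 2 * (bR b1 * symE i s a l + bR b2 * symE j s a l + bR b3 * symE i j a l) ^ 2
    = wmat i j b1 b2 b3 a l ^ 2 by rewrite /wmat; lra.
  by move: (wmat _ _ _ _ _ _ _) => w; rewrite /mid; case: eqP => _; lra.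
by rewrite rsum_add rsum_deltal -rsum_mull /wmat /=; lra.
Qed.

Lemma dg_quadratic (A B C : rmat p) (x y z : R) :
  \rsum_(a < p) (dg a * (\rsum_(b < p) (x * A a b + y * B a b + z * C a b) ^ 2)) =
  x ^ 2 * (\rsum_(a < p) (dg a * (\rsum_(b < p) (A a b * A a b)))) +
  y ^ 2 * (\rsum_(a < p) (dg a * (\rsum_(b < p) (B a b * B a b)))) +
  z ^ 2 * (\rsum_(a < p) (dg a * (\rsum_(b < p) (C a b * C a b)))) +
  2 * x * y * (\rsum_(a < p) (dg a * (\rsum_(b < p) (A a b * B a b)))) +
  2 * x * z * (\rsum_(a < p) (dg a * (\rsum_(b < p) (A a b * C a b)))) +
  2 * y * z * (\rsum_(a < p) (dg a * (\rsum_(b < p) (B a b * C a b)))).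
Proof.
rewrite !rsum_mull -!rsum_add; apply: eq_bigr => a _.
rewrite !rsum_mull -!rsum_add; apply: eq_bigr => b _; lra.
Qed.

Definition gterm i j b1 b2 b3 :=
  (2 * mtrace p (mmul p base (mmul p (tmat i j b1 b2 b3) (tmat i j b1 b2 b3))) -
   alpha * mtrace p (tmat i j b1 b2 b3)) * exp (- mtrace p (mmul p (tmat i j b1 b2 b3) base)).

Lemma gterm_block i j b1 b2 b3 : (i < r)%N -> (j < r)%N -> gterm i j b1 b2 b3 =
  E0 * (K - 4 * c * h * (bR b3 * mid p i j) + 2 * h ^ 2 * (/ 4 * (bR b1 ^ 2 + bR b2 ^ 2)
    + / 2 * (bR b1 * bR b2 * mid p i j) + / 2 * (bR b3 ^ 2 * (1 + mid p i j))) +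
    alpha * h * (bR b3 * mid p i j)) * exp (h * (bR b3 * mid p i j)).
Proof.
move=> ir jr.
have mis : mid p i s = 0 by rewrite /mid -val_eqE /= (ltn_eqF ir).
have mjs : mid p j s = 0 by rewrite /mid -val_eqE /= (ltn_eqF jr).
have m1 (a : 'I_p) : mid p a a = 1 by rewrite /mid eqxx.
have ds : dg s = 0 by rewrite /dg /= ltnn.
have di : dg i = 1 by rewrite /dg ir.
have dj : dg j = 1 by rewrite /dg jr.
rewrite /gterm mtrace_base_tmat2 mtrace_tmat mtrace_tmat_mul; last exact: base_sym.
rewrite dg_quadratic !base_symE2 /base ds di dj (midC s i) (midC s j) mis mjs !m1 (midC j i).
have -> : exp (- (c * mtrace p (fun a b : 'I_p => dg a * mid p a b) -
     h * (bR b1 * (1 * 0) + bR b2 * (1 * 0) + bR b3 * (1 * mid p i j)))) =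
   E0 * exp (h * (bR b3 * mid p i j)).
  by rewrite /E0 -exp_plus; congr exp; rewrite -/base; lra.
rewrite /K -/base; move: (mtrace p base) (exp _) => T X.
rewrite (_ : mid p i j = bR (i == j)) //; case: (i == j); rewrite /bR; lra.
Qed.

Lemma gterm_corner b : gterm s s b false false = E0 * (K + alpha * h * bR b).
Proof.
have ds : dg s = 0 by rewrite /dg /= ltnn.
have m1 : mid p s s = 1 by rewrite /mid eqxx.
rewrite /gterm mtrace_base_tmat2 mtrace_tmat mtrace_tmat_mul; last exact: base_sym.
rewrite dg_quadratic !base_symE2 {2 3 4 5 6 7}/base ds m1.
rewrite (_ : - (c * mtrace p base - h * _) = - (c * mtrace p base)); last first.
  by rewrite /base ds /=; lra.
by rewrite -/E0 /K /bR; case: b; lra.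
Qed.

(** [corner], [squares] and [triples] expand [N s s], [N i s ^ 2] and [N i s * N j s * N i j], times
    [exp (- c tr x)], where [N] is [exp (h * x) - 1] entrywise. The square arises by taking the
    index [i] twice. *)
Definition corner : comb p :=
  [:: (1, tterm s s true false false); (-1, tterm s s false false false)].

Definition squares i : comb p :=
  [:: (1, tterm i i true true false); (-1, tterm i i true false false);
      (-1, tterm i i false true false); (1, tterm i i false false false)].

Definition triples i j : comb p :=
  [:: (1, tterm i j true true true); (-1, tterm i j true true false);
      (-1, tterm i j true false true); (1, tterm i j true false false);
      (-1, tterm i j false true true); (1, tterm i j false true false);
      (1, tterm i j false false true); (-1, tterm i j false false false)].

Let N x (i j : 'I_p) := exp (h * x i j) - 1.

Lemma ev_corner x : msymmetric p x -> ev corner x = exp (- (c * mtrace p x)) * N x s s.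
Proof.
by move=> symx; rewrite /ev /corner !big_cons big_nil /mu /= !ev_tterm // /N; lra.
Qed.

Lemma ev_squares i x : msymmetric p x ->
  ev (squares i) x = exp (- (c * mtrace p x)) * N x i s ^ 2.
Proof.
by move=> symx; rewrite /ev /squares !big_cons big_nil /mu /= !ev_tterm // /N; lra.
Qed.

Lemma ev_triples i j x : msymmetric p x ->
  ev (triples i j) x = exp (- (c * mtrace p x)) * (N x i s * N x j s * N x i j).
Proof.
by move=> symx; rewrite /ev /triples !big_cons big_nil /mu /= !ev_tterm // /N; lra.
Qed.

Lemma genc_corner : genc alpha corner base = E0 * (alpha * h).
Proof.
rewrite /genc /corner !big_cons big_nil /mu /= -!/(gterm _ _ _ _ _) !gterm_corner /bR.
by lra.
Qed.

Lemma genc_squares i : (i < r)%N -> genc alpha (squares i) base = E0 * h ^ 2.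
Proof.
move=> ir; rewrite /genc /squares !big_cons big_nil /mu /= -!/(gterm _ _ _ _ _).
have e0 : exp (h * (bR false * mid p i i)) = 1 by rewrite /bR Rmult_0_l Rmult_0_r exp_0.
by rewrite !gterm_block // e0 /bR /mid eqxx; lra.
Qed.

(** The factors [N i s] and [N j s] vanish at [base], so only their covariation [h^2 * mid p i j]
    times the value of [N i j] remains. *)
Lemma genc_triples i j : (i < r)%N -> (j < r)%N ->
  genc alpha (triples i j) base = E0 * (mid p i j * (h ^ 2 * (exp h - 1))).
Proof.
move=> ir jr; rewrite /genc /triples !big_cons big_nil /mu /= -!/(gterm _ _ _ _ _).
have e0 : exp (h * (bR false * mid p i j)) = 1 by rewrite /bR Rmult_0_l Rmult_0_r exp_0.
have e1 : exp (h * (bR true * mid p i j)) = 1 + mid p i j * (exp h - 1).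
  rewrite /bR /mid; case: (i == j); first by rewrite !Rmult_1_r; lra.
  by rewrite !Rmult_0_r exp_0; lra.
rewrite !gterm_block // e0 e1 (_ : mid p i j = bR (i == j)) //.
by case: (i == j); rewrite /bR; lra.
Qed.

(** At [base] the leading block of [N] is [(exp h - 1) I], with inverse [kap I]. This value
    minimizes [- 2 kap + kap^2 (exp h - 1)], and so gives the best bound. *)
Let kap := / (exp h - 1).

Lemma exp_h_gt1 : 0 < exp h - 1.
Proof. by have := exp_increasing _ _ h0; rewrite exp_0; lra. Qed.

Lemma sum_dg : \rsum_(a < p) dg a = INR r.
Proof.
rewrite /dg -big_mkcond /= -(big_ord_widen p (fun _ => 1)); last exact: ltnW.
by rewrite rsum_const card_ord; lra.
Qed.

(* [z^T N z] for [z = e_s - kap * sum_(i < r) (N i s) e_i], to second order a Schur complement. *)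
Definition testc : comb p := corner ++ (
  flatten [seq scalec (-2 * kap * dg i) (squares i) | i <- index_enum 'I_p] ++
  flatten [seq scalec (kap ^ 2 * dg i * dg j) (triples i j)
    | i <- index_enum 'I_p, j <- index_enum 'I_p]).

Lemma ev_flatten (gs : seq (comb p)) x : ev (flatten gs) x = \rsum_(g <- gs) ev g x.
Proof. by rewrite /ev big_flatten. Qed.

Lemma ev_testc x : msymmetric p x -> ev testc x = exp (- (c * mtrace p x)) *
  (N x s s + (\rsum_(i < p) (-2 * kap * dg i * N x i s ^ 2)) +
   \rsum_(i < p) \rsum_(j < p) (kap ^ 2 * dg i * dg j * (N x i s * N x j s * N x i j))).
Proof.
move=> symx; rewrite !ev_cat ev_corner // !ev_flatten big_map big_allpairs_dep.
have D (e a b d : R) : e * (a + b + d) = e * a + (e * b + e * d) by lra.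
rewrite D; congr (_ + (_ + _)); rewrite rsum_mull.
  by apply: eq_bigr => i _; rewrite ev_scale ev_squares //; lra.
apply: eq_bigr => i _; rewrite rsum_mull.
by apply: eq_bigr => j _; rewrite ev_scale ev_triples //; lra.
Qed.

Lemma ev_testc_ge0 x : psd p x -> 0 <= ev testc x.
Proof.
move=> psx; have symx := proj1 psx; rewrite ev_testc //.
apply: Rmult_le_pos; first by apply: Rlt_le; apply: exp_pos.
have psh : psd p (fun i j => h * x i j).
  split; first by move=> i j; rewrite symx.
  by move=> v; rewrite quad_scale; have := proj2 psx v; nra.
pose y a := - kap * (dg a * N x a s).
have := exp_minus_one_psd (fun a => mid p s a + y a) psh.
suff -> : quad p (fun i j => exp (h * x i j) - 1) (fun a => mid p s a + y a) =
  N x s s + (\rsum_(i < p) (-2 * kap * dg i * N x i s ^ 2)) +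
  \rsum_(i < p) \rsum_(j < p) (kap ^ 2 * dg i * dg j * (N x i s * N x j s * N x i j)) by [].
rewrite /quad.
transitivity (\rsum_(a < p) (mid p s a * (N x a s + \rsum_(b < p) (N x a b * y b)) +
    (y a * N x a s + \rsum_(b < p) (y a * N x a b * y b)))).
  apply: eq_bigr => a _.
  rewrite (eq_bigr (fun b => mid p s b * ((mid p s a + y a) * N x a b) +
    (mid p s a * (N x a b * y b) + y a * N x a b * y b))); last first.
    by move=> b _; rewrite /N; lra.
  by rewrite !rsum_add rsum_deltal -rsum_mull /=; lra.
rewrite !rsum_add rsum_deltal.
have -> : \rsum_(b < p) (N x s b * y b) = \rsum_(a < p) (y a * N x a s).
  by apply: eq_bigr => b _; rewrite /N (symx s b); lra.
have -> : \rsum_(i < p) (-2 * kap * dg i * N x i s ^ 2) = 2 * (\rsum_(a < p) (y a * N x a s)).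
  by rewrite rsum_mull; apply: eq_bigr => a _; rewrite /y; lra.
have -> : \rsum_(i < p) \rsum_(j < p) (kap ^ 2 * dg i * dg j * (N x i s * N x j s * N x i j)) =
    \rsum_(a < p) \rsum_(b < p) (y a * N x a b * y b).
  by apply: eq_bigr => a _; apply: eq_bigr => b _; rewrite /y; lra.
by rewrite /=; lra.
Qed.

Lemma ev_testc_base : ev testc base = 0.
Proof.
rewrite ev_testc; last exact: base_sym.
have Ns i : N base i s = 0.
  rewrite /N (_ : base i s = 0) ?Rmult_0_r ?exp_0; first by lra.
  rewrite /base /mid; case: eqP => [->|_]; last by lra.
  by rewrite /dg /= ltnn; lra.
rewrite Ns rsum0 => [|i _]; last by rewrite Ns; lra.
rewrite rsum0 => [|i _]; first by lra.
by apply: rsum0 => j _; rewrite Ns; lra.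
Qed.

Lemma genc_cat (g g' : comb p) x :
  genc alpha (g ++ g') x = genc alpha g x + genc alpha g' x.
Proof. by rewrite /genc big_cat. Qed.

Lemma genc_scale d (g : comb p) x : genc alpha (scalec d g) x = d * genc alpha g x.
Proof. by rewrite /genc big_map rsum_mull; apply: eq_bigr => a _; rewrite /mu /=; lra. Qed.

Lemma genc_flatten (gs : seq (comb p)) x :
  genc alpha (flatten gs) x = \rsum_(g <- gs) genc alpha g x.
Proof. by rewrite /genc big_flatten. Qed.

(** Up to [E0], the three parts give [alpha h], [- 2 kap r h^2] and [kap^2 (exp h - 1) r h^2]; as
    [kap (exp h - 1) = 1], the last two combine to [- kap r h^2]. *)
Lemma genc_testc : genc alpha testc base = E0 * (h * (alpha - kap * (INR r * h))).
Proof.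
rewrite !genc_cat genc_corner !genc_flatten big_map big_allpairs_dep.
have dgP i : (i < r)%N \/ dg i = 0 by rewrite /dg; case: (i < r)%N; [left|right].
have -> : \rsum_(i < p) genc alpha (scalec (-2 * kap * dg i) (squares i)) base = -2 * kap * (E0 * h ^ 2) * INR r.
  rewrite -sum_dg rsum_mull; apply: eq_bigr => i _.
  rewrite genc_scale.
  by case: (dgP i) => [ir|->]; [rewrite genc_squares //; lra|lra].
have -> : \rsum_(i < p) \rsum_(j < p)
    genc alpha (scalec (kap ^ 2 * dg i * dg j) (triples i j)) base =
    kap ^ 2 * (E0 * (h ^ 2 * (exp h - 1))) * INR r.
  rewrite -sum_dg rsum_mull; apply: eq_bigr => i _.
  transitivity (\rsum_(j < p) (mid p i j *
     (kap ^ 2 * dg i * dg j * (E0 * (h ^ 2 * (exp h - 1)))))).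
    apply: eq_bigr => j _; rewrite genc_scale.
    case: (dgP i) => [ir|->]; last by lra.
    by case: (dgP j) => [jr|->]; [rewrite genc_triples //; lra|lra].
  rewrite rsum_deltal; case: (dgP i) => [ir|->]; last by lra.
  by rewrite /dg ir; lra.
have := exp_h_gt1; rewrite /kap; move: (exp h - 1) E0 => z e z0.
by field; lra.
Qed.

Lemma drift_ge_aux : INR r * h <= alpha * (exp h - 1).
Proof.
have := genc_ge0 (fun x Dx => ev_testc_ge0 (proj1 Dx)) base_Dp ev_testc_base.
rewrite genc_testc => H; have E0p : 0 < E0 by apply: exp_pos.
have z0 := exp_h_gt1; have kz : kap * (exp h - 1) = 1 by rewrite /kap; field; lra.
have h1 : 0 <= alpha - kap * (INR r * h).
  apply: (Rmult_le_reg_l h) => //; rewrite Rmult_0_r.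
  by apply: (Rmult_le_reg_l E0) => //; rewrite Rmult_0_r.
have := Rmult_le_pos _ _ h1 (Rlt_le _ _ z0).
have -> : (alpha - kap * (INR r * h)) * (exp h - 1) =
  alpha * (exp h - 1) - kap * (exp h - 1) * (INR r * h) by lra.
by rewrite kz; lra.
Qed.

End LowerBound.

Lemma drift_ge (p k : nat) (alpha : R) (P : R -> fnD p (Dp p k) -> fnD p (Dp p k)) (r : nat) :
  (1 <= k <= p)%N -> 0 <= alpha -> wishart_semigroup p (Dp p k) alpha P ->
  (r < p)%N -> (r <= k)%N -> INR r <= alpha.
Proof.
move=> kp a0 WP rp rk; apply: Rnot_lt_le => lt.
have r0 := pos_INR r.
have rpos : 0 < INR r by lra.
(* An explicit value in place of the limit [h -> 0]: from [(1 - h) (exp h - 1) <= h] follows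
   [(1 - h) r <= alpha], while [(1 - h) r = (r + alpha) / 2 > alpha]. *)
pose h := (INR r - alpha) / (2 * INR r).
have h0 : 0 < h by apply: Rdiv_lt_0_compat; lra.
have hr : h * INR r = (INR r - alpha) / 2 by rewrite /h; field; lra.
have h1 : h < 1 by nra.
have := drift_ge_aux kp WP rp rk h0.
have : exp (- h) * exp h = 1 by rewrite -exp_plus Rplus_opp_l exp_0.
have := exp_ineq1_le (- h); have := exp_pos h.
move: (exp (- h)) (exp h) => e' e ep le ee H.
have he : (1 - h) * (e - 1) <= h by nra.
have : (1 - h) * (INR r * h) <= alpha * h.
  have := Rmult_le_compat_l (1 - h) _ _ ltac:(lra) H.
  by have := Rmult_le_compat_l _ _ _ a0 he; lra.
move=> H2; have : (1 - h) * INR r <= alpha by apply: (Rmult_le_reg_r h) => //; lra.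
lra.
Qed.

Theorem mainTheorem9 (p k : nat) (alpha : R) :
  (1 <= p)%N -> (1 <= k <= p)%N -> 0 <= alpha ->
  ((exists P, wishart_semigroup p (Dp p k) alpha P) <->
   (((k < p)%N -> alpha = INR k) /\ (k = p -> INR p - 1 <= alpha))).
Proof.
move=> p1 kp a0; split=> [[P WP]|adm]; last first.
  by exists (wsg alpha); apply: wsg_wishart.
split=> [kltp|E].
  apply: Rle_antisym; first exact: (drift_le kp a0 WP).
  exact: (drift_ge kp a0 WP kltp (leqnn k)).
(* On the full cone [r = p - 1] is the largest possible choice, since the corner index [r] must be a
   coordinate. *)
have pp : (p.-1 < p)%N by rewrite prednK.
have := drift_ge kp a0 WP pp; rewrite E leq_pred => /(_ isT).
by rewrite -[in INR p - 1](prednK p1) S_INR; lra.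
Qed.
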